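(* Let $\Phi\in L^\infty(\mathbb{M}_{n,n})$ satisfy $\|H_\Phi\|\le1$ and $\|H_\Phi\|_{\mathrm e}<1$. Then $\Phi$ has a unique unitary interpolant if and only if all superoptimal singular values of $\Phi$ are equal to $1$.
   Context: $\mathbb{M}_{m,n}$ complex $m\times n$ matrices; $H_\Phi f=\mathbb{P}_-\Phi f$ is the Hankel operator from $H^2(\mathbb{C}^n)$ to $H^2_-(\mathbb{C}^n)=L^2(\mathbb{C}^n)\ominus H^2(\mathbb{C}^n)$; $\|\cdot\|_{\mathrm e}$ the essential norm. A unitary interpolant of $\Phi$ is a unitary-valued $U\in L^\infty(\mathbb{M}_{n,n})$ with $\Phi-U\in H^\infty(\mathbb{M}_{n,n})$. Superoptimal singular values: let $\Omega_0$ be the set of $F\in H^\infty(\mathbb{M}_{n,n})$ minimizing $t_0=\operatorname{ess\,sup}_\zeta\|\Phi(\zeta)-F(\zeta)\|$, and for $j\ge1$ let $\Omega_j$ be the set of $F\in\Omega_{j-1}$ minimizing $t_j=\operatorname{ess\,sup}_\zeta s_j(\Phi(\zeta)-F(\zeta))$, where $s_j(A)=\inf\{\|A-R\|:\operatorname{rank}R\le j\}$; $t_0,\dots,t_{n-1}$ are the superoptimal singular values of $\Phi$. *)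

(* Defs.v *)
From HB Require Import structures.
From mathcomp Require Import all_boot all_order all_algebra.
From mathcomp Require Import all_classical all_reals all_analysis.
From mathcomp Require Import complex.
Set Implicit Arguments.
Unset Strict Implicit.
Unset Printing Implicit Defensive.
Import Order.TTheory GRing.Theory Num.Theory.
Import numFieldNormedType.Exports.
Local Open Scope classical_set_scope.
Local Open Scope ring_scope.

(* The unit circle T is parametrized by zeta = e^{i t}, t in D = [0, 2 pi),
   with (normalized or not: irrelevant for all notions below) Lebesgue measure. *)

Section HankelDefs.
Variable R : realType.
Local Notation C := (complex R).

Definition circD : set R := [set t | 0 <= t < 2 * pi].
Definition mu := (@lebesgue_measure R).

Definition cRe (z : C) : R := complex.Re z.
Definition cIm (z : C) : R := complex.Im z.
Definition cabs (z : C) : R := Num.sqrt (cRe z ^+ 2 + cIm z ^+ 2).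
Definition cconj (z : C) : C := Complex (cRe z) (- cIm z).
Definition cexp (t : R) : C := Complex (cos t) (sin t).
Definition cmeas (f : R -> C) : Prop :=
  measurable_fun circD (fun t => cRe (f t)) /\
  measurable_fun circD (fun t => cIm (f t)).
Definition cint (f : R -> C) : C :=
  Complex (\int[mu]_(t in circD) cRe (f t)) (\int[mu]_(t in circD) cIm (f t)).

Definition esssupD (g : R -> R) : \bar R :=
  ereal_inf [set y : \bar R | {ae mu, forall t, circD t -> ((g t)%:E <= y)%E}].
Definition ae_eq (T : Type) (f g : R -> T) : Prop :=
  {ae mu, forall t, circD t -> f t = g t}.

Definition vnorm m (v : 'cV[C]_m) : R := Num.sqrt (\sum_i cabs (v i 0) ^+ 2).
Definition opnorm m k (A : 'M[C]_(m, k)) : R :=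
  sup [set vnorm (A *m v) | v in [set v : 'cV[C]_k | vnorm v <= 1]].
Definition sval m (j : nat) (A : 'M[C]_m) : R :=
  inf [set opnorm (A - B) | B in [set B : 'M[C]_m | (\rank B <= j)%N]].
Definition adjmx m (A : 'M[C]_m) : 'M[C]_m := (map_mx cconj A)^T.

Definition mxmeas m (F : R -> 'M[C]_m) : Prop := forall i j, cmeas (fun t => F t i j).
Definition Linf m (F : R -> 'M[C]_m) : Prop :=
  mxmeas F /\ (esssupD (fun t => opnorm (F t)) < +oo)%E.
(* H^infty: all Fourier coefficients of negative index vanish *)
Definition Hinf m (F : R -> 'M[C]_m) : Prop :=
  Linf F /\ forall (k : nat), (0 < k)%N -> forall i j,
    cint (fun t => F t i j * cexp (k%:R * t)) = 0.

Definition vmeas m (f : R -> 'cV[C]_m) : Prop := forall i, cmeas (fun t => f t i 0).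
Definition L2 m (f : R -> 'cV[C]_m) : Prop :=
  vmeas f /\ mu.-integrable circD (fun t => ((vnorm (f t)) ^+ 2)%:E).
Definition l2norm m (f : R -> 'cV[C]_m) : R :=
  Num.sqrt (\int[mu]_(t in circD) (vnorm (f t) ^+ 2)).
Definition inner m (f g : R -> 'cV[C]_m) : C :=
  cint (fun t => \sum_i f t i 0 * cconj (g t i 0)).
Definition H2 m (f : R -> 'cV[C]_m) : Prop :=
  L2 f /\ forall (k : nat), (0 < k)%N -> forall i,
    cint (fun t => f t i 0 * cexp (k%:R * t)) = 0.
Definition H2minus m (f : R -> 'cV[C]_m) : Prop :=
  L2 f /\ forall g, H2 g -> inner f g = 0.
(* p = P_- g : the orthogonal projection of g in L^2 onto H^2_- *)
Definition is_Pminus m (g p : R -> 'cV[C]_m) : Prop :=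
  L2 g /\ H2minus p /\ H2 (fun t => g t - p t).
Definition is_Hankel m (Phi : R -> 'M[C]_m) (f p : R -> 'cV[C]_m) : Prop :=
  H2 f /\ is_Pminus (fun t => Phi t *m f t) p.

Definition hankel_norm_le m (Phi : R -> 'M[C]_m) (c : R) : Prop :=
  forall f p, is_Hankel Phi f p -> l2norm p <= c * l2norm f.

Definition compact_op m (K : (R -> 'cV[C]_m) -> (R -> 'cV[C]_m)) : Prop :=
  (forall f, H2 f -> H2minus (K f)) /\
  (forall (a : C) f g, H2 f -> H2 g ->
     ae_eq (K (fun t => a *: f t + g t)) (fun t => a *: K f t + K g t)) /\
  (forall u : nat -> (R -> 'cV[C]_m),
     (forall k, H2 (u k) /\ l2norm (u k) <= 1) ->
     exists phi : nat -> nat, (forall k, (phi k < phi k.+1)%N) /\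
       forall e : R, 0 < e -> exists N : nat, forall k l, (N <= k)%N -> (N <= l)%N ->
         l2norm (fun t => K (u (phi k)) t - K (u (phi l)) t) <= e).

(* ||H_Phi||_e < 1, where ||T||_e = inf { ||T - K|| : K compact } *)
Definition hankel_ess_norm_lt1 m (Phi : R -> 'M[C]_m) : Prop :=
  exists K, compact_op K /\ exists r : R, r < 1 /\
    forall f p, is_Hankel Phi f p ->
      l2norm (fun t => p t - K f t) <= r * l2norm f.

Definition unitary_interpolant m (Phi U : R -> 'M[C]_m) : Prop :=
  Linf U /\ {ae mu, forall t, circD t -> adjmx (U t) *m U t = 1%:M} /\
  Hinf (fun t => Phi t - U t).
Definition unique_unitary_interpolant m (Phi : R -> 'M[C]_m) : Prop :=
  exists U, unitary_interpolant Phi U /\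
    forall V, unitary_interpolant Phi V -> ae_eq V U.

Definition dev m (Phi : R -> 'M[C]_m) (j : nat) (F : R -> 'M[C]_m) : \bar R :=
  esssupD (fun t => sval j (Phi t - F t)).
Definition Omega_step m (Phi : R -> 'M[C]_m) (j : nat) (prev : set (R -> 'M[C]_m)) :=
  [set F | prev F /\ dev Phi j F = ereal_inf [set dev Phi j G | G in prev]].
Fixpoint Omega m (Phi : R -> 'M[C]_m) (j : nat) : set (R -> 'M[C]_m) :=
  match j with
  | 0 => Omega_step Phi 0 (@Hinf m)
  | j'.+1 => Omega_step Phi j (Omega Phi j')
  end.
Definition superopt_sv m (Phi : R -> 'M[C]_m) (j : nat) : \bar R :=
  let prev := match j with 0 => @Hinf m | j'.+1 => Omega Phi j' end in
  ereal_inf [set dev Phi j G | G in prev].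

End HankelDefs.

(* Main.v *)
(** Write [H f] for the Hankel operator, [z] for the coordinate on the circle, and call [m] in
    [H2] maximizing when [|H m| = |m|]. Since the essential norm is less than 1, the form
    [|f|^2 - |H f|^2] is bounded below by [eps |f|^2] on the [f] orthogonal to all maximizing
    vectors (the gap). If [F] is in [Hinf] and [Phi - F] is contractive, then [(Phi - F) m = H m]
    and [(Phi - F)^* H m = m] almost everywhere.

    Unique interpolant implies singular values 1. Suppose first that some constant vector [c <> 0]
    has [zbar c] orthogonal to all the [H m]. By the gap the functional [f |-> <H f, zbar c>] is
    represented, in the form above, by some [s] in [H2], and a rational expression in [U] and [s]
    yields a second unitary interpolant; its analyticity reduces to that of the reciprocal of a
    function with positive real part, obtained from Galerkin approximations. Otherwise, comparing
    lowest Fourier coefficients shows that [Phi - F = U] for every contractive [Phi - F], whence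
    all superoptimal singular values are those of a unitary matrix.

    Singular values 1 imply unique interpolant. Let [N] be the closed shift-invariant subspace
    generated by the maximizing vectors. As in Beurling's theorem, [N] is spanned over the shift by
    pointwise orthonormal [g_1, ..., g_d]; let [Pi] be the pointwise projection onto their span.
    The gap gives [|H f|^2 <= <W f, f>] on [H2] for [W := 1 - eps (1 - Pi)], and a weighted Nehari
    theorem yields [F] in [Hinf] with [(Phi - F)^* (Phi - F) <= W]. Such an [F] belongs to all the
    [Omega_j]; if [d < n] then [s_(n-1)(Phi - F) <= sqrt (1 - eps)], contradicting [t_(n-1) = 1].
    Hence [d = n], and the values on the maximizing vectors determine [Phi - F], which is
    unitary, as well as every other unitary interpolant. *)
Require Import Defs.
From HB Require Import structures.
From mathcomp Require Import all_boot all_order all_algebra.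
From mathcomp Require Import all_classical all_reals all_analysis.
From mathcomp Require Import measurable_realfun complex ring lra.
Set Implicit Arguments.
Unset Strict Implicit.
Unset Printing Implicit Defensive.
Import Order.TTheory GRing.Theory Num.Theory.
Import numFieldNormedType.Exports.
Local Open Scope classical_set_scope.
Local Open Scope ring_scope.
Local Open Scope complex_scope.

(** Everything takes place on the circle: analytic means that the Fourier coefficients of negative
    index vanish, and neither extensions to the disc nor outer functions are used. This shapes two
    arguments. A product of [H2] functions is only integrable, so the analyticity of [1 / d] is
    obtained from the partial sums of the formal reciprocal of [d], controlled by a weighted [L^2]
    bound strong enough to make [d b] integrable for their limit [b]. The inverse of an analytic
    matrix function and the expansion in Beurling's theorem rest on repeated division by [z]: the
    remainder is [z^N g] with [g] bounded, and its pairing with a fixed vector tends to 0. The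
    weight [W] is dictated by the gap. If [f = m + f'] with [m] maximizing and [f'] orthogonal to
    all maximizing vectors, then [|f|^2 - |H f|^2 = |f'|^2 - |H f'|^2 >= eps |f'|^2 >= eps |(1 - Pi)
    f|^2], because [Pi m = m]. The weighted Nehari problem is first solved for a coercive form by a
    quotient [Q P^-1] built from reproducing kernels at the origin; coercivity is gained by adding a
    small multiple of the identity to [W]. *)

Section ComplexNumbers.
Variable R : realType.
Local Notation C := (complex R).
Implicit Types z w : C.

Definition nsq z : R := cRe z ^+ 2 + cIm z ^+ 2.

Lemma complexP z w : cRe z = cRe w -> cIm z = cIm w -> z = w.
Proof. by case: z w => [a b] [c d] /= -> ->. Qed.

Lemma cReD z w : cRe (z + w) = cRe z + cRe w. Proof. by case: z w => [a b] []. Qed.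
Lemma cImD z w : cIm (z + w) = cIm z + cIm w. Proof. by case: z w => [a b] []. Qed.
Lemma cReN z : cRe (- z) = - cRe z. Proof. by case: z. Qed.
Lemma cImN z : cIm (- z) = - cIm z. Proof. by case: z. Qed.
Lemma cReM z w : cRe (z * w) = cRe z * cRe w - cIm z * cIm w.
Proof. by case: z w => [a b] []. Qed.
Lemma cImM z w : cIm (z * w) = cRe z * cIm w + cIm z * cRe w.
Proof. by case: z w => [a b] []. Qed.
Lemma cRe_conj z : cRe (cconj z) = cRe z. Proof. by []. Qed.
Lemma cIm_conj z : cIm (cconj z) = - cIm z. Proof. by []. Qed.
Lemma cRe_real (a : R) : cRe a%:C = a. Proof. by []. Qed.
Lemma cIm_real (a : R) : cIm a%:C = 0. Proof. by []. Qed.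
Lemma cRe0 : cRe 0 = 0 :> R. Proof. by []. Qed.
Lemma cIm0 : cIm 0 = 0 :> R. Proof. by []. Qed.
Lemma cRe1 : cRe 1 = 1 :> R. Proof. by []. Qed.
Lemma cIm1 : cIm 1 = 0 :> R. Proof. by []. Qed.
Definition cRIE := (cReD, cImD, cReN, cImN, cReM, cImM, cRe_conj, cIm_conj,
  cRe_real, cIm_real, cRe0, cIm0, cRe1, cIm1).

Lemma cconjD z w : cconj (z + w) = cconj z + cconj w.
Proof. by apply: complexP; rewrite !cRIE // opprD. Qed.
Lemma cconjN z : cconj (- z) = - cconj z.
Proof. by apply: complexP; rewrite !cRIE. Qed.
Lemma cconjB z w : cconj (z - w) = cconj z - cconj w.
Proof. by rewrite cconjD cconjN. Qed.
Lemma cconjM z w : cconj (z * w) = cconj z * cconj w.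
Proof. by apply: complexP; rewrite !cRIE; ring. Qed.
Lemma cconjK z : cconj (cconj z) = z.
Proof. by apply: complexP; rewrite !cRIE // opprK. Qed.
Lemma cconj0 : cconj 0 = 0 :> C. Proof. by apply: complexP; rewrite !cRIE // oppr0. Qed.
Lemma cconj1 : cconj 1 = 1 :> C. Proof. by apply: complexP; rewrite !cRIE // oppr0. Qed.
Lemma cconj_real (a : R) : cconj a%:C = a%:C.
Proof. by apply: complexP; rewrite !cRIE // oppr0. Qed.
Lemma cconj_nat (k : nat) : cconj k%:R = k%:R :> C.
Proof. by elim: k => [|k IH]; rewrite ?cconj0 // -natr1 cconjD IH cconj1. Qed.

Lemma cconj_sum (I : Type) (r : seq I) (P : pred I) (F : I -> C) :
  cconj (\sum_(i <- r | P i) F i) = \sum_(i <- r | P i) cconj (F i).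
Proof. exact: (big_morph _ cconjD cconj0). Qed.
Lemma cRe_sum (I : Type) (r : seq I) (P : pred I) (F : I -> C) :
  cRe (\sum_(i <- r | P i) F i) = \sum_(i <- r | P i) cRe (F i).
Proof. exact: (big_morph _ cReD cRe0). Qed.
Lemma cIm_sum (I : Type) (r : seq I) (P : pred I) (F : I -> C) :
  cIm (\sum_(i <- r | P i) F i) = \sum_(i <- r | P i) cIm (F i).
Proof. exact: (big_morph _ cImD cIm0). Qed.

Lemma nsq_ge0 z : 0 <= nsq z. Proof. by rewrite addr_ge0 // sqr_ge0. Qed.
Lemma nsq_eq0 z : (nsq z == 0) = (z == 0).
Proof.
rewrite /nsq paddr_eq0 ?sqr_ge0 // !sqrf_eq0; apply/andP/eqP => [[/eqP a /eqP b]|->].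
  exact: complexP.
by rewrite !cRIE.
Qed.
Lemma nsq_gt0 z : z != 0 -> 0 < nsq z.
Proof. by move=> z0; rewrite lt_def nsq_eq0 z0 nsq_ge0. Qed.
Lemma nsq0 : nsq 0 = 0. Proof. by rewrite /nsq !cRIE; ring. Qed.
Lemma nsq1 : nsq 1 = 1. Proof. by rewrite /nsq !cRIE; ring. Qed.
Lemma nsqN z : nsq (- z) = nsq z. Proof. by rewrite /nsq !cRIE !sqrrN. Qed.
Lemma nsqM z w : nsq (z * w) = nsq z * nsq w.
Proof. by rewrite /nsq !cRIE; ring. Qed.
Lemma nsq_conj z : nsq (cconj z) = nsq z.
Proof. by rewrite /nsq !cRIE; ring. Qed.
Lemma nsq_real (a : R) : nsq a%:C = a ^+ 2.
Proof. by rewrite /nsq !cRIE; ring. Qed.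
Lemma nsqD_le z w : nsq (z + w) <= 2 * nsq z + 2 * nsq w.
Proof.
rewrite /nsq !cRIE.
have := sqr_ge0 (cRe z - cRe w); have := sqr_ge0 (cIm z - cIm w); nra.
Qed.
Lemma nsqB_le z w : nsq (z - w) <= 2 * nsq z + 2 * nsq w.
Proof. by rewrite -(nsqN w) nsqD_le. Qed.
Lemma mulcconj z : z * cconj z = (nsq z)%:C.
Proof. by apply: complexP; rewrite !cRIE /nsq; ring. Qed.
Lemma cabs2 z : cabs z ^+ 2 = nsq z.
Proof. by rewrite /cabs sqr_sqrtr // nsq_ge0. Qed.
Lemma cRe_le_nsq z : cRe z ^+ 2 <= nsq z.
Proof. by rewrite /nsq lerDl sqr_ge0. Qed.
Lemma cIm_le_nsq z : cIm z ^+ 2 <= nsq z.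
Proof. by rewrite /nsq lerDr sqr_ge0. Qed.

Lemma cexpD (s t : R) : cexp (s + t) = cexp s * cexp t.
Proof. by apply: complexP; rewrite !cRIE /cexp /cRe /cIm /= ?cosD ?sinD; ring. Qed.
Lemma cexp0 : cexp 0 = 1 :> C. Proof. by rewrite /cexp cos0 sin0. Qed.
Lemma cexpN (t : R) : cexp (- t) = cconj (cexp t).
Proof. by rewrite /cexp cosN sinN. Qed.
Lemma nsq_cexp (t : R) : nsq (cexp t) = 1. Proof. exact: cos2Dsin2. Qed.

End ComplexNumbers.

(** * Positive semidefinite Hermitian forms and Riesz representation *)

Section HermitianForms.
Variable R : realType.
Local Notation C := (complex R).
Variable V : lmodType C.

(** Definiteness is left out on purpose: functions that agree almost everywhere stay distinct, and
    the defect form of the Hankel operator vanishes on maximizing vectors. The predicate [S] plays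
    the part of a subspace. *)
Record hform (S : V -> Prop) (B : V -> V -> C) : Prop := HForm {
  hform0 : S 0;
  hformS : forall a u v, S u -> S v -> S (a *: u + v);
  hformL : forall a u v w, S u -> S v -> S w -> B (a *: u + v) w = a * B u w + B v w;
  hformC : forall u v, S u -> S v -> B v u = cconj (B u v);
  hform_ge0 : forall u, S u -> 0 <= cRe (B u u) }.

Definition hcauchy (B : V -> V -> C) (u : nat -> V) := forall e : R, 0 < e ->
  exists N : nat, forall k l, (N <= k)%N -> (N <= l)%N ->
    cRe (B (u k - u l) (u k - u l)) <= e.
Definition hlim (B : V -> V -> C) (u : nat -> V) (v : V) := forall e : R, 0 < e ->
  exists N : nat, forall k, (N <= k)%N -> cRe (B (u k - v) (u k - v)) <= e.
Definition hcomplete (S : V -> Prop) (B : V -> V -> C) := forall u : nat -> V,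
  (forall k, S (u k)) -> hcauchy B u -> exists2 v, S v & hlim B u v.

Section Theory.
Variables (S : V -> Prop) (B : V -> V -> C).
Hypothesis hB : hform S B.
Let q u := cRe (B u u).

Lemma hformZS a u : S u -> S (a *: u).
Proof. by move=> Su; rewrite -[_ *: _]addr0; apply: (hformS hB) => //; apply: hform0 hB. Qed.
Lemma hformDS u v : S u -> S v -> S (u + v).
Proof. by move=> Su Sv; rewrite -[u]scale1r; apply: (hformS hB). Qed.
Lemma hformNS u : S u -> S (- u).
Proof. by move=> Su; rewrite -scaleN1r; apply: hformZS. Qed.
Lemma hformBS u v : S u -> S v -> S (u - v).
Proof. by move=> Su Sv; apply: hformDS => //; apply: hformNS. Qed.

Lemma hform0l u : S u -> B 0 u = 0.
Proof.
move=> Su; have h0 := hform0 hB; have := hformL hB 1 h0 h0 Su.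
by rewrite scale1r addr0 mul1r => /eqP; rewrite -subr_eq subrr eq_sym => /eqP.
Qed.
Lemma hformZl a u w : S u -> S w -> B (a *: u) w = a * B u w.
Proof.
move=> Su Sw; have := hformL hB a Su (hform0 hB) Sw.
by rewrite addr0 hform0l // addr0.
Qed.
Lemma hformDl u v w : S u -> S v -> S w -> B (u + v) w = B u w + B v w.
Proof. by move=> *; rewrite -{1}[u]scale1r (hformL hB) // mul1r. Qed.
Lemma hformNl u w : S u -> S w -> B (- u) w = - B u w.
Proof. by move=> *; rewrite -scaleN1r hformZl // mulN1r. Qed.
Lemma hformBl u v w : S u -> S v -> S w -> B (u - v) w = B u w - B v w.
Proof. by move=> Su Sv Sw; rewrite hformDl ?hformNl //; apply: hformNS. Qed.
Lemma hformDr u v w : S u -> S v -> S w -> B w (u + v) = B w u + B w v.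
Proof.
move=> Su Sv Sw; have Suv := hformDS Su Sv.
by rewrite (hformC hB Suv Sw) hformDl // cconjD -!(hformC hB).
Qed.
Lemma hformZr a u w : S u -> S w -> B w (a *: u) = cconj a * B w u.
Proof.
move=> Su Sw; have Sau := hformZS a Su.
by rewrite (hformC hB Sau Sw) hformZl // cconjM -(hformC hB).
Qed.
Lemma hformNr u w : S u -> S w -> B w (- u) = - B w u.
Proof. by move=> *; rewrite -scaleN1r hformZr // cconjN cconj1 mulN1r. Qed.
Lemma hformBr u v w : S u -> S v -> S w -> B w (u - v) = B w u - B w v.
Proof. by move=> Su Sv Sw; rewrite hformDr ?hformNr //; apply: hformNS. Qed.
Lemma hform_real u : S u -> B u u = (q u)%:C.
Proof.
move=> Su; apply: complexP; rewrite !cRIE //.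
have := congr1 (@cIm R) (hformC hB Su Su); rewrite !cRIE => h; lra.
Qed.

Lemma hqD u v : S u -> S v -> q (u + v) = q u + q v + 2 * cRe (B u v).
Proof.
move=> Su Sv; rewrite /q hformDl ?hformDr ?(hformC hB Su Sv) ?cRIE //; last exact: hformDS.
ring.
Qed.
Lemma hqZ a u : S u -> q (a *: u) = nsq a * q u.
Proof.
move=> Su; rewrite /q hformZl ?hformZr //; last exact: hformZS.
rewrite mulrA mulcconj !cRIE; ring.
Qed.
Lemma hqN u : S u -> q (- u) = q u.
Proof. by move=> Su; rewrite -scaleN1r hqZ // nsqN nsq1 mul1r. Qed.
Lemma hqB u v : S u -> S v -> q (u - v) = q u + q v - 2 * cRe (B u v).
Proof. by move=> Su Sv; rewrite hqD ?hqN ?hformNr ?cRIE //; [ring|exact: hformNS]. Qed.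
Lemma hq_par u v : S u -> S v -> q (u + v) + q (u - v) = 2 * q u + 2 * q v.
Proof. by move=> Su Sv; rewrite hqD // hqB //; ring. Qed.
Lemma hqD_le u v : S u -> S v -> q (u + v) <= 2 * q u + 2 * q v.
Proof.
by move=> Su Sv; rewrite -hq_par // lerDl; apply: hform_ge0 hB _ _; exact: hformBS.
Qed.
Lemma hqB_le u v : S u -> S v -> q (u - v) <= 2 * q u + 2 * q v.
Proof.
by move=> Su Sv; rewrite -hq_par // lerDr; apply: hform_ge0 hB _ _; exact: hformDS.
Qed.

Lemma hform_CS u v : S u -> S v -> nsq (B u v) <= q u * q v.
Proof.
move=> Su Sv.
have h a : 0 <= q u + nsq a * q v - 2 * cRe (cconj a * B u v).
  have Sav := hformZS a Sv; rewrite -hqZ // -hformZr // -hqB //.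
  by apply: hform_ge0 hB _ _; exact: hformBS.
have pu : 0 <= q u by exact: hform_ge0 hB _ Su.
have pv : 0 <= q v by exact: hform_ge0 hB _ Sv.
have k (r : R) : 0 <= q u + r ^+ 2 * nsq (B u v) * q v - 2 * (r * nsq (B u v)).
  have := h (r%:C * B u v); rewrite nsqM nsq_real cconjM cconj_real
    -(mulrA r%:C) [cconj _ * _]mulrC mulcconj !cRIE; lra.
have pn := nsq_ge0 (B u v); set N := nsq _ in k pn *.
(* If [q v = 0], the bound [k] is affine in [r] and fails at [r := (q u + 1) / N] unless [N = 0];
   otherwise [r := (q v)^-1] is its minimizer. *)
have [v0|v0] := eqVneq (q v) 0.
  have [->|N0] := eqVneq N 0; first by rewrite v0 mulr0.
  have := k ((q u + 1) / N); rewrite v0 mulr0 addr0 divfK //; lra.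
have := k (q v)^-1; have -> : q u + (q v)^-1 ^+ 2 * N * q v - 2 * ((q v)^-1 * N) =
  q u - N / q v by field.
by rewrite subr_ge0 ler_pdivrMr // lt_def v0.
Qed.

Lemma hform_CS0 u v : S u -> S v -> q u = 0 -> B u v = 0.
Proof.
move=> Su Sv u0; have := hform_CS Su Sv; rewrite u0 mul0r => h.
by apply/eqP; rewrite -nsq_eq0 eq_le h nsq_ge0.
Qed.

Lemma hlim_form u v w : (forall k, S (u k)) -> S v -> S w -> hlim B u v ->
  forall e : R, 0 < e -> exists N : nat, forall k, (N <= k)%N ->
    nsq (B (u k) w - B v w) <= e.
Proof.
move=> Su Sv Sw uv e e0; have pw : 0 <= q w by exact: hform_ge0 hB _ Sw.
have [N hN] := uv (e / (q w + 1)) (divr_gt0 e0 (ltr_wpDl pw ltr01)).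
exists N => k /hN h; rewrite -hformBl //.
have Suv : S (u k - v) by exact: hformBS.
apply: le_trans (hform_CS Suv Sw) _; rewrite -/(q _) in h.
have := hform_ge0 hB Suv; rewrite -/(q _) => p.
have q1 : 0 < q w + 1 by lra.
move: h; rewrite ler_pdivlMr // => h; nra.
Qed.

(* A minimising sequence of [B u u - 2 Re (l u)] is Cauchy by the parallelogram
   identity; its limit represents [l]. *)
Lemma riesz (l : V -> C) (c : R) : hcomplete S B ->
  (forall a u v, S u -> S v -> l (a *: u + v) = a * l u + l v) ->
  (forall u, S u -> nsq (l u) <= c * q u) ->
  exists2 p, S p & forall u, S u -> B u p = l u.
Proof.
move=> cB lL lc.
have S0 := hform0 hB.
have l0 : l 0 = 0.
  have := lL 1 _ _ S0 S0; rewrite scale1r addr0 mul1r => /eqP.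
  by rewrite -subr_eq subrr eq_sym => /eqP.
have lZ a u : S u -> l (a *: u) = a * l u.
  by move=> Su; have := lL a _ _ Su S0; rewrite !addr0 l0 addr0.
have lD u v : S u -> S v -> l (u + v) = l u + l v.
  by move=> Su Sv; have := lL 1 _ _ Su Sv; rewrite scale1r mul1r.
pose J u := q u - 2 * cRe (l u).
have Jlb u : S u -> - `|c| <= J u.
  move=> Su; have := lc _ Su; have pu : 0 <= q u by exact: hform_ge0 hB _ Su.
  have := cRe_le_nsq (l u); have := ler_norm c; have := normr_ge0 c.
  rewrite /J; move: (cRe (l u)) => x c0 c1 xn nc.
  have {nc xn} : x ^+ 2 <= `|c| * q u.
    by apply: le_trans xn (le_trans nc _); rewrite ler_wpM2r.
  have := sqr_ge0 (q u - `|c|) => h1 h2.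
  have h3 : (2 * x) ^+ 2 <= (q u + `|c|) ^+ 2.
    have -> : (q u + `|c|) ^+ 2 = (q u - `|c|) ^+ 2 + 4 * (`|c| * q u) by ring.
    have -> : (2 * x) ^+ 2 = 4 * x ^+ 2 by ring.
    lra.
  have : 2 * x <= q u + `|c|.
    by apply: le_trans (ler_norm _) _; rewrite -ler_sqr ?nnegrE ?addr_ge0 // real_normK // num_real.
  lra.
pose I := inf [set J u | u in S].
have hI : has_inf [set J u | u in S].
  split; first by exists (J 0); exists 0.
  by exists (- `|c|) => _ [u Su <-]; exact: Jlb.
have Ile u : S u -> I <= J u by move=> Su; apply: ge_inf hI.2 _ _; exists u.
have /choice [u hu] : forall k : nat, exists u, S u /\ J u <= I + k.+1%:R^-1.
  move=> k; have k0 : (0 : R) < k.+1%:R^-1 by rewrite invr_gt0.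
  by have [_ [u Su <-] h] := inf_adherent k0 hI; exists u; split => //; exact: ltW.
have Su k : S (u k) by case: (hu k).
have Ju k : J (u k) <= I + k.+1%:R^-1 by case: (hu k).
have inv_small (e : R) : 0 < e -> exists N : nat, forall k, (N <= k)%N -> k.+1%:R^-1 <= e.
  move=> e0; exists (Num.truncn e^-1) => k hk; rewrite invf_ple ?posrE ?ltr0Sn //.
  apply: ltW; apply: lt_le_trans (truncnS_gt _) _; by rewrite ler_nat ltnS.
have [|p Sp up] := cB u Su.
  move=> e e0; have [|N hN] := inv_small (e / 4); first lra.
  exists N => k l' hk hl; rewrite -/(q _).
  have := hq_par (Su k) (Su l'); have Skl := hformDS (Su k) (Su l').
  have := Ile _ (hformZS (2^-1)%:C Skl); rewrite /J hqZ // lZ // lD // nsq_real !cRIE.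
  have := Ju k; have := Ju l'; have := hN _ hk; have := hN _ hl; rewrite /J.
  move: (q (u k + u l')) (q (u k - u l')) (k.+1%:R^-1) (l'.+1%:R^-1) => x y r s.
  have -> : (2^-1 : R) ^+ 2 = 4^-1 by rewrite exprVn -natrX.
  lra.
exists p => // v Sv.
(* Since [u k] minimizes [J] up to [k.+1%:R^-1], no perturbation by [a *: v] gains more than that.
   Taking for [a] the conjugate of the error divided by [- (q v + 1)] turns this into a bound on the
   error; the added 1 keeps the quotient meaningful when [q v = 0]. *)
have key k : nsq (B v (u k) - l v) <= (q v + 1) * k.+1%:R^-1.
  have h (a : C) : 0 <= k.+1%:R^-1 + nsq a * q v + 2 * cRe (a * (B v (u k) - l v)).
    have Sa := hformZS a Sv; have Sua := hformDS (Su k) Sa.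
    have := Ile _ Sua; rewrite /J hqD // lD // lZ // hqZ // hformZr //.
    have := Ju k; rewrite /J (hformC hB Sv (Su k)) -cconjM cRe_conj mulrBr !(cReD, cReN).
    move: (q _) (q _) (cRe _) (cRe _) (nsq a) (k.+1%:R^-1) => x y z t s r; lra.
  set d := B v (u k) - l v in h *; set e := k.+1%:R^-1 in h *.
  have e0 : 0 < e by rewrite invr_gt0.
  have pv : 0 <= q v by exact: hform_ge0 hB _ Sv.
  have := h (- ((q v + 1)^-1)%:C * cconj d).
  rewrite nsqM nsqN nsq_real nsq_conj -(mulrA (- _)) [cconj d * d]mulrC mulcconj mulNr !cRIE mul0r subr0.
  set r := (q v + 1)^-1 => hh.
  have r0 : 0 < r by rewrite invr_gt0; lra.
  have rq : r * (q v + 1) = 1 by rewrite mulVf // gt_eqF //; lra.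
  have nd := nsq_ge0 d.
  have : r * nsq d <= e.
    have h2 : r ^+ 2 * nsq d * q v + r ^+ 2 * nsq d = r * nsq d.
      by rewrite -[RHS]mulr1 -rq; ring.
    have h3 : 0 <= r ^+ 2 * nsq d by rewrite mulr_ge0 // sqr_ge0.
    lra.
  move=> h1; have : (q v + 1) * (r * nsq d) <= (q v + 1) * e by rewrite ler_pM2l //; lra.
  by rewrite mulrA [(q v + 1) * r]mulrC rq mul1r.
apply/eqP; rewrite -subr_eq0 -nsq_eq0 eq_le nsq_ge0 andbT; apply/ler_addgt0Pr => e e0.
rewrite add0r.
have [|N1 h1] := hlim_form Su Sp Sv up (e := e / 4); first lra.
have pv : 0 <= q v by exact: hform_ge0 hB _ Sv.
have q1 : 0 < q v + 1 by lra.
have [|N2 h2] := inv_small (e / 4 / (q v + 1)); first by rewrite !divr_gt0.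
pose k := maxn N1 N2.
have {}h1 := h1 k (leq_maxl _ _); have {}h2 := h2 k (leq_maxr _ _).
have := key k; rewrite ler_pdivlMr // in h2 => h3.
have -> : B v p - l v = (B v (u k) - l v) - (B v (u k) - B v p) by ring.
apply: le_trans (nsqB_le _ _) _.
move: h1; rewrite (hformC hB Sv (Su k)) (hformC hB Sv Sp) -cconjB nsq_conj => h1.
have {}h3 := le_trans h3 (eq_ind_r (fun x => x <= e / 4) h2 (mulrC _ _)).
lra.
Qed.

End Theory.

Lemma hform_sub (S T : V -> Prop) (B : V -> V -> C) : hform S B ->
  (forall u, T u -> S u) -> T 0 -> (forall a u v, T u -> T v -> T (a *: u + v)) ->
  hform T B.
Proof.
move=> hB TS T0 TL; split=> //.
- by move=> a u v w Tu Tv Tw; apply: (hformL hB); exact: TS.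
- by move=> u v Tu Tv; apply: (hformC hB); exact: TS.
- by move=> u Tu; apply: (hform_ge0 hB); exact: TS.
Qed.

End HermitianForms.

(** * Almost everywhere statements and real integrals over [[0, 2 pi)] *)

Section RealIntegrals.
Variable R : realType.
Local Notation mu := (@lebesgue_measure R).
Local Notation D := (@circD R).
Implicit Types (f g h : R -> R) (P Q : R -> Prop).

Definition aeD P : Prop := {ae mu, forall t, D t -> P t}.
Definition rmeas g : Prop := measurable_fun D g.
Definition rint g : Prop := mu.-integrable D (EFin \o g).
Definition Ri g : R := \int[mu]_(t in D) g t.

Lemma circDE : D = [set` `[0, 2 * pi[].
Proof. by apply/seteqP; split=> t /=; rewrite in_itv. Qed.

Lemma measurable_circD : measurable D.
Proof. by rewrite circDE; exact: measurable_itv. Qed.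
Lemma measurable_circD' : @measurable _ (measurableTypeR R) D.
Proof. exact: measurable_circD. Qed.
Local Hint Resolve measurable_circD measurable_circD' : core.

Lemma twopi_gt0 : 0 < 2 * pi :> R. Proof. by rewrite mulr_gt0 // pi_gt0. Qed.

Lemma mu_circD : mu D = (2 * pi)%:E.
Proof. by rewrite circDE [LHS]lebesgue_measure_itv /= lte_fin twopi_gt0 sube0. Qed.

Let aeF : Filter (almost_everywhere mu).
Proof. exact: ae_filter_ringOfSetsType. Qed.

Lemma aeDT P : (forall t, D t -> P t) -> aeD P.
Proof. by move=> h; apply: (@filterE _ _ aeF). Qed.
Lemma aeDS P Q : (forall t, D t -> P t -> Q t) -> aeD P -> aeD Q.
Proof. by move=> PQ; apply: (@filterS _ _ aeF) => t Pt Dt; apply: PQ => //; exact: Pt. Qed.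
Lemma aeD2 P Q : aeD P -> aeD Q -> aeD (fun t => P t /\ Q t).
Proof. by apply: (@filterS2 _ _ aeF) => t Pt Qt Dt; split; [exact: Pt|exact: Qt]. Qed.
Lemma aeDS2 P Q (S : R -> Prop) : (forall t, D t -> P t -> Q t -> S t) ->
  aeD P -> aeD Q -> aeD S.
Proof. by move=> h p q; apply: aeDS (aeD2 p q) => t Dt []; exact: h. Qed.
Lemma aeD_nat (P : nat -> R -> Prop) : (forall k, aeD (P k)) ->
  aeD (fun t => forall k, P k t).
Proof.
move=> h; have : {ae mu, forall t, forall k, D t -> P k t} by apply/ae_foralln.
by apply: (@filterS _ _ aeF) => t Pt Dt k; exact: Pt.
Qed.
Lemma aeD_fin (I : finType) (P : I -> R -> Prop) : (forall i, aeD (P i)) ->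
  aeD (fun t => forall i, P i t).
Proof.
move=> h.
case: (pickP (@predT I)) => [i0 _|h0]; last first.
  by apply: aeDT => t Dt i; have := h0 i.
have : aeD (fun t => forall k : nat, P (nth i0 (enum I) k) t) by apply: aeD_nat.
apply: aeDS => t Dt hk i; have := hk (index i (enum I)).
by rewrite nth_index // mem_enum.
Qed.
(** The circle has positive measure. This turns pointwise facts about constants, such as the bound
    on the size of an orthonormal family, into plain propositions. *)
Lemma aeD_const (P : Prop) : aeD (fun=> P) -> P.
Proof.
move=> h; apply: contrapT => nP.
have hn : mu.-negligible D by apply: negligibleS h => t Dt /= hP; exact: nP (hP Dt).
have h1 : mu D = 0%E by exact: (proj1 (@negligibleP _ _ R (@lebesgue_measure R) _ measurable_circD) hn).
have := mu_circD; rewrite [LHS]h1 => -[] h2.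
by have := twopi_gt0; rewrite -h2 ltxx.
Qed.

Lemma rint_meas g : rint g -> rmeas g.
Proof. by move=> /measurable_int /measurable_EFinP. Qed.

Lemma rint_le f g : rmeas f -> rint g -> (forall t, D t -> `|f t| <= g t) -> rint f.
Proof.
move=> mf ig fg; apply: le_integrable ig => //; first exact/measurable_EFinP.
by move=> t Dt /=; rewrite lee_fin (le_trans (fg t Dt)) // ler_norm.
Qed.
Lemma rint_cst (c : R) : rint (fun=> c).
Proof.
apply/integrableP; split; first exact: measurable_cst.
by rewrite /= integral_cst // [X in (_ * X)%E]mu_circD -EFinM ltry.
Qed.
Lemma rintD f g : rint f -> rint g -> rint (fun t => f t + g t).
Proof. by move=> hf hg; have := integrableD measurable_circD' hf hg. Qed.
Lemma rintZ (c : R) f : rint f -> rint (fun t => c * f t).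
Proof. by move=> hf; have := integrableZl measurable_circD' c hf. Qed.
Lemma rintN f : rint f -> rint (fun t => - f t).
Proof. by move=> hf; have := integrableN hf. Qed.
Lemma rintB f g : rint f -> rint g -> rint (fun t => f t - g t).
Proof. by move=> hf hg; exact: rintD hf (rintN hg). Qed.
Lemma rint_norm f : rint f -> rint (fun t => `|f t|).
Proof. by move=> hf; have := integrable_norm hf. Qed.
Lemma rint_sum (I : Type) (r : seq I) (P : pred I) (F : I -> R -> R) :
  (forall i, rint (F i)) -> rint (fun t => \sum_(i <- r | P i) F i t).
Proof.
move=> hF; elim: r => [|i r IH].
  by under eq_fun do rewrite big_nil; exact: rint_cst.
under eq_fun do rewrite big_cons.
by case: (P i) => //; exact: rintD.
Qed.

Lemma RiD f g : rint f -> rint g -> Ri (fun t => f t + g t) = Ri f + Ri g.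
Proof. by move=> hf hg; rewrite /Ri RintegralD. Qed.
Lemma RiZ (c : R) f : rint f -> Ri (fun t => c * f t) = c * Ri f.
Proof. by move=> hf; rewrite /Ri RintegralZl. Qed.
Lemma RiN f : rint f -> Ri (fun t => - f t) = - Ri f.
Proof. by move=> hf; under eq_fun do rewrite -mulN1r; rewrite RiZ // mulN1r. Qed.
Lemma RiB f g : rint f -> rint g -> Ri (fun t => f t - g t) = Ri f - Ri g.
Proof. by move=> hf hg; rewrite RiD ?RiN //; exact: rintN. Qed.
Lemma Ri_cst (c : R) : Ri (fun=> c) = c * (2 * pi).
Proof.
by rewrite /Ri Rintegral_cst // [X in fine X]mu_circD.
Qed.
Lemma eq_Ri f g : (forall t, D t -> f t = g t) -> Ri f = Ri g.
Proof. by move=> fg; apply: eq_Rintegral => t /set_mem /fg. Qed.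
Lemma Ri_ae f g : rmeas f -> rmeas g -> aeD (fun t => f t = g t) -> Ri f = Ri g.
Proof.
move=> mf mg fg; congr fine; apply: ae_eq_integral => //; try exact/measurable_EFinP.
by apply: aeDS fg => t _ ->.
Qed.
Lemma rint_ae f g : rint f -> rmeas g -> aeD (fun t => f t = g t) -> rint g.
Proof.
move=> hf mg fg; apply/integrableP; split; first exact/measurable_EFinP.
have /integrableP [mf] := hf; congr (_ < _)%E; apply: ae_eq_integral => //.
- by apply: measurableT_comp.
- by apply: measurableT_comp => //; exact/measurable_EFinP.
- by apply: aeDS fg => t _ /= ->.
Qed.
Lemma Ri_sum (I : Type) (r : seq I) (P : pred I) (F : I -> R -> R) :
  (forall i, rint (F i)) ->
  Ri (fun t => \sum_(i <- r | P i) F i t) = \sum_(i <- r | P i) Ri (F i).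
Proof.
move=> hF; elim: r => [|i r IH].
  by under eq_fun do rewrite big_nil; rewrite big_nil Ri_cst mul0r.
under eq_fun do rewrite big_cons.
rewrite big_cons; case: (P i) => //; rewrite RiD ?IH //; exact: rint_sum.
Qed.
Lemma Ri_ge0 f : (forall t, D t -> 0 <= f t) -> 0 <= Ri f.
Proof. by move=> f0; rewrite /Ri; apply: Rintegral_ge0. Qed.
Lemma Ri_le f g : rint f -> rint g -> (forall t, D t -> f t <= g t) -> Ri f <= Ri g.
Proof.
move=> hf hg fg; rewrite -subr_ge0 -RiB //; apply: Ri_ge0 => t Dt.
by rewrite subr_ge0 fg.
Qed.
Lemma Ri_le_ae f g : rint f -> rint g -> aeD (fun t => f t <= g t) -> Ri f <= Ri g.
Proof.
move=> hf hg fg; pose h t := Num.max (f t) (g t).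
have mh : rmeas h by apply: measurable_maxr; exact: rint_meas.
have hh : aeD (fun t => g t = h t) by apply: aeDS fg => t _ /max_idPr; rewrite /h.
rewrite (Ri_ae _ _ hh) //; last exact: rint_meas.
apply: Ri_le => //; last by move=> t _; rewrite /h le_max lexx.
exact: rint_ae hg _ _.
Qed.
Lemma Ri_eq0 f : rint f -> (forall t, D t -> 0 <= f t) -> Ri f = 0 -> aeD (fun t => f t = 0).
Proof.
move=> hf f0 i0.
have : (\int[mu]_(t in D) `|(EFin \o f) t|)%E = 0%E.
  have : (\int[mu]_(t in D) (EFin \o f) t)%E = 0%E.
    by rewrite -[LHS]fineK ?[fine _]i0 //; exact: integrable_fin_num.
  move=> h; rewrite -[RHS]h; apply: eq_integral => t /set_mem Dt /=.
  by rewrite ger0_norm // f0.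
move/(ae_eq_integral_abs _ measurable_circD') => h.
have : aeD (fun t => (f t)%:E = 0%E) by apply: h; apply/measurable_EFinP; exact: rint_meas.
by apply: aeDS => t _ [].
Qed.
Lemma Ri_eq0_ae f : rint f -> aeD (fun t => 0 <= f t) -> Ri f = 0 -> aeD (fun t => f t = 0).
Proof.
move=> hf f0 i0; pose g t := Num.max (f t) 0.
have mg : rmeas g by apply: measurable_maxr; [exact: rint_meas|exact: measurable_cst].
have fg : aeD (fun t => f t = g t) by apply: aeDS f0 => t _ /max_idPl; rewrite /g.
have : aeD (fun t => g t = 0).
  apply: Ri_eq0; first exact: rint_ae hf _ _.
    by move=> t _; rewrite /g le_max lexx orbT.
  by rewrite -i0; apply/esym; apply: Ri_ae => //; exact: rint_meas.
by apply: aeDS2 fg => t _ -> .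
Qed.

Lemma rdct (F : nat -> R -> R) f g : (forall k, rmeas (F k)) -> rmeas f -> rint g ->
  aeD (fun t => F ^~ t @ \oo --> f t) -> aeD (fun t => forall k, `|F k t| <= g t) ->
  rint f /\ Ri (F k) @[k --> \oo] --> Ri f.
Proof.
move=> mF mf ig cF Fg.
have h1 k : measurable_fun D (EFin \o F k) by apply/measurable_EFinP; exact: mF.
have h2 : measurable_fun D (EFin \o f) by exact/measurable_EFinP.
have h3 : {ae mu, forall t, D t -> (EFin \o F k) t @[k --> \oo] --> (EFin \o f) t}.
  by apply: aeDS cF => t _ h; apply: cvg_EFin => //; apply: nearW.
have h4 : {ae mu, forall t, forall k, D t -> (`|(EFin \o F k) t| <= (EFin \o g) t)%E}.
  by apply: (@filterS _ _ aeF) Fg => t h k Dt; rewrite /= lee_fin; exact: h.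
have [hf _ h] := dominated_convergence measurable_circD' h1 h2 h3 ig h4.
split=> //.
have -> : Ri f = fine (\int[mu]_(t in D) (EFin \o f) t)%E by [].
by apply: fine_cvg; rewrite fineK //; exact: integrable_fin_num.
Qed.

Lemma rfatou (w : nat -> R -> R) g (e : R) : (forall k, rmeas (w k)) -> rmeas g ->
  (forall k, rint (w k)) -> (forall k t, D t -> 0 <= w k t) -> (forall t, D t -> 0 <= g t) ->
  aeD (fun t => w ^~ t @ \oo --> g t) ->
  (exists N : nat, forall k, (N <= k)%N -> Ri (w k) <= e) -> rint g /\ Ri g <= e.
Proof.
move=> mw mg iw w0 g0 cw [N hN].
have mEw k : measurable_fun D (EFin \o w k) by apply/measurable_EFinP; exact: mw.
have Ew0 k t : D t -> (0 <= (EFin \o w k) t)%E by move=> Dt; rewrite lee_fin w0.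
have mEg : measurable_fun D (EFin \o g) by apply/measurable_EFinP.
have le_e : (\int[mu]_(t in D) (EFin \o g) t <= e%:E)%E.
  have -> : (\int[mu]_(t in D) (EFin \o g) t =
      \int[mu]_(t in D) limn_einf (fun k => (EFin \o w k) t))%E.
    apply: ae_eq_integral => //.
      have -> : (fun t => limn_einf (fun k => (EFin \o w k) t)) =
          -%E \o (fun t => limn_esup (fun k => (-%E \o (EFin \o w k)) t)).
        apply/funext => t /=; rewrite -limn_einfN; congr limn_einf.
        by apply/funext => k /=; rewrite opprK.
      apply: (measurableT_comp (oppe_measurable (D := setT))).
      apply: (measurable_fun_limn_esup (f := fun k => -%E \o (EFin \o w k))) => k.
      by apply: (measurableT_comp (oppe_measurable (D := setT))); exact: mEw.
    apply: aeDS cw => t _ h; rewrite limn_einf_lim; apply/esym/cvg_lim => //.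
    by apply: cvg_einfs; apply: cvg_EFin => //; apply: nearW.
  apply: le_trans (fatou _ measurable_circD' mEw Ew0) _.
  rewrite limn_einf_lim; apply: lime_le; first exact: is_cvg_einfs.
  exists N => // n /= Nn; apply: ereal_inf_le.
  exists (\int[mu]_(t in D) (EFin \o w n) t)%E; first by exists n => /=.
  rewrite -[X in (X <= _)%E]fineK ?lee_fin; first exact: hN.
  exact: (integrable_fin_num measurable_circD' (iw n)).
have ig : rint g.
  apply/integrableP; split => //.
  under eq_integral => t /set_mem Dt do rewrite /= ger0_norm ?g0 //.
  by apply: le_lt_trans le_e _; rewrite ltry.
split=> //; rewrite -lee_fin; apply: le_trans le_e.
by rewrite /Ri /Rintegral fineK //; exact: (integrable_fin_num measurable_circD' ig).
Qed.

Lemma rmeasD f g : rmeas f -> rmeas g -> rmeas (fun t => f t + g t).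
Proof. exact: measurable_funD. Qed.
Lemma rmeasB f g : rmeas f -> rmeas g -> rmeas (fun t => f t - g t).
Proof. exact: measurable_funB. Qed.
Lemma rmeasM f g : rmeas f -> rmeas g -> rmeas (fun t => f t * g t).
Proof. exact: measurable_funM. Qed.
Lemma rmeasN f : rmeas f -> rmeas (fun t => - f t).
Proof. by move=> mf; apply: measurableT_comp. Qed.
Lemma rmeas_cst (c : R) : rmeas (fun=> c).
Proof. exact: measurable_cst. Qed.
Lemma rmeasX f n : rmeas f -> rmeas (fun t => f t ^+ n).
Proof. exact: measurable_funX. Qed.

(* By the arithmetic-geometric inequality [2 a_j <= 2^-j + 2^j a_j^2], so the
   increments [a_j] are summable wherever [\sum_j 2^j a_j^2] is finite. *)
Lemma fast_cvg_ae (v : nat -> R -> R) : (forall k, rmeas (v k)) ->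
  (forall j, rint (fun t => (v j.+1 t - v j t) ^+ 2)) ->
  (forall j, Ri (fun t => (v j.+1 t - v j t) ^+ 2) <= 4^-1 ^+ j) ->
  exists2 f, rmeas f & aeD (fun t => v ^~ t @ \oo --> f t).
Proof.
move=> mv iv hv.
pose a j t := 2 ^+ j * (v j.+1 t - v j t) ^+ 2.
have a0 j t : 0 <= a j t by apply: mulr_ge0; [exact: exprn_ge0|exact: sqr_ge0].
have ma j : measurable_fun D (EFin \o a j).
  apply/measurable_EFinP; apply: rmeasM; first exact: rmeas_cst.
  by apply: rmeasX; apply: rmeasB.
have Ea0 j t : D t -> (0 <= (EFin \o a j) t)%E by move=> _; rewrite lee_fin a0.
have geo (j : nat) : (2^-1 : R) ^+ j = geometric 1 2^-1 j by rewrite /geometric /= mul1r.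
have half1 : `|2^-1 : R| < 1 by rewrite ger0_norm ?invr_ge0 // invf_lt1 // ltr1n.
have sa : (\sum_(j <oo) \int[mu]_(t in D) (EFin \o a j) t < +oo)%E.
  have -> : (fun n => \sum_(0 <= j < n) \int[mu]_(t in D) (EFin \o a j) t)%E =
      (fun n => (\sum_(0 <= j < n) Ri (a j))%:E).
    apply/funext => n; rewrite -sumEFin; apply: eq_bigr => j _.
    rewrite /Ri /Rintegral fineK //; apply: (integrable_fin_num measurable_circD').
    exact: (rintZ (2 ^+ j) (iv j)).
  have le2 n : \sum_(0 <= j < n) Ri (a j) <= 2.
    have : \sum_(0 <= j < n) Ri (a j) <= \sum_(0 <= j < n) geometric 1 2^-1 j.
      apply: ler_sum => j _; rewrite /a RiZ // -geo.
      have p : (0 : R) < 2 ^+ j by rewrite exprn_gt0.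
      apply: (@le_trans _ _ (2 ^+ j * 4^-1 ^+ j)); first by rewrite ler_pM2l.
      rewrite -exprMn; have -> : (2 * 4^-1 : R) = 2^-1; last by [].
      by lra.
    move/le_trans; apply; have := @cvg_geometric_series R 1 2^-1 half1 => h.
    have lim2 : limn (series (geometric 1 (2^-1 : R))) = 2.
      rewrite (cvg_lim _ h) //; have -> : (1 - 2^-1 : R) = 2^-1 by lra.
      by rewrite invrK mul1r.
    rewrite -[X in _ <= X]lim2.
    apply: (nondecreasing_cvgn_le (u_ := series (geometric 1 (2^-1 : R)))).
      by apply: nondecreasing_series => k _ _; rewrite -geo exprn_ge0 // invr_ge0.
    by apply/cvgP; exact: h.
  apply: (@le_lt_trans _ _ 2%:E); last by rewrite ltry.
  apply: lime_le; last by apply: nearW => n; rewrite lee_fin le2.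
  apply: ereal_nondecreasing_is_cvgn => m n mn; rewrite lee_fin.
  by apply: (nondecreasing_series (P := xpredT)) => // k _ _; apply: Ri_ge0 => t _; exact: a0.
have := integral_nneseries mu measurable_circD' ma Ea0 => isum.
have fsum : aeD (fun t => (\sum_(j <oo) (a j t)%:E < +oo)%E).
  have : mu.-integrable D (fun t => \sum_(j <oo) (EFin \o a j) t)%E.
    apply/integrableP; split.
      apply: (ge0_emeasurable_sum (P := xpredT) (h := fun j => EFin \o a j)) => //.
      by move=> k x Dx _; exact: Ea0.
    have -> : (\int[mu]_(t in D) `|\sum_(j <oo) (EFin \o a j) t| =
        \int[mu]_(t in D) \sum_(j <oo) (EFin \o a j) t)%E.
      apply: eq_integral => t _; rewrite gee0_abs // nneseries_ge0 // => j _ _.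
      by rewrite lee_fin.
    by rewrite [X in (X < _)%E]isum.
  move/integrable_ae => /(_ measurable_circD').
  by apply: aeDS => t _; rewrite fin_numElt => /andP[].
have cv : aeD (fun t => cvgn (v ^~ t)).
  apply: aeDS fsum => t Dt h.
  have {h} ca := nnseries_is_cvg (a0 ^~ t) h.
  have cg : cvgn (series (fun j => geometric 1 2^-1 j + a j t)).
    rewrite seriesD; apply: is_cvgD ca.
    by apply/cvgP; exact: (@cvg_geometric_series R 1 2^-1 half1).
  have : cvgn [normed series (telescope (v ^~ t))].
    apply: series_le_cvg cg; [by move=> k /=| |].
      by move=> k; rewrite addr_ge0 // -geo exprn_ge0 // invr_ge0.
    move=> k; rewrite -geo exprVn /a /=.
    set x := v k.+1 t - v k t; have p : (0 : R) < 2 ^+ k by rewrite exprn_gt0.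
    set y := 2 ^+ k in p *.
    have h := sqr_ge0 (y * `|x| - 1).
    have n0 := normr_ge0 x; rewrite -[x ^+ 2]real_normK ?num_real //.
    rewrite -(ler_pM2l p) mulrDr divff ?gt_eqF //; nra.
  move/normed_cvg => h; have -> : v ^~ t = (fun n => v 0%N t + series (telescope (v ^~ t)) n).
    by apply/funext => n; rewrite -eq_sum_telescope.
  by apply: is_cvgD => //; exact: is_cvg_cst.
(* The upper limit is measurable whether or not the sequence converges; [fine] replaces its infinite
   values, which occur only on a null set, by 0. *)
exists (fun t => fine (limn_esup (fun k => (EFin \o v k) t))).
  apply: (measurableT_comp (fine_measurable measurableT)).
  apply: (measurable_fun_limn_esup (f := fun k => EFin \o v k)) => k.
  by apply/measurable_EFinP; exact: mv.
apply: aeDS cv => t Dt ct.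
have h : (EFin \o v k) t @[k --> \oo] --> (limn (v ^~ t))%:E.
  by apply: cvg_EFin => //; apply: nearW.
rewrite limn_esup_lim; have /cvg_lim -> // := cvg_esups h.
Qed.
End RealIntegrals.

(** * Completeness of [L^2] and measurability of complex functions *)

Section SquareIntegrable.
Variable R : realType.
Local Notation mu := (@lebesgue_measure R).
Local Notation D := (@circD R).
Local Notation C := (complex R).

Lemma rint_le_ae (f g : R -> R) : rmeas f -> rint g ->
  aeD (fun t => `|f t| <= g t) -> rint f.
Proof.
move=> mf ig fg; apply/integrableP; split; first exact/measurable_EFinP.
have /integrableP [mg] := rint_norm ig; apply: le_lt_trans.
apply: ae_ge0_le_integral => //; first exact: measurable_circD'.
- by apply: measurableT_comp => //; exact/measurable_EFinP.
- by apply: measurableT_comp.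
by apply: aeDS fg => t _ h; rewrite lee_fin normr_id; apply: le_trans h (ler_norm _).
Qed.

Lemma rint_sqB (f g : R -> R) : rmeas f -> rmeas g -> rint (fun t => f t ^+ 2) ->
  rint (fun t => g t ^+ 2) -> rint (fun t => (f t - g t) ^+ 2).
Proof.
move=> mf mg hf hg; apply: rint_le (rintD (rintZ 2 hf) (rintZ 2 hg)) _.
  by apply: rmeasX; exact: rmeasB.
move=> t _; rewrite ger0_norm ?sqr_ge0 //; have := sqr_ge0 (f t + g t); nra.
Qed.

(** A subsequence whose squared increments have integral at most [4^-j] converges almost everywhere,
    and Fatou's lemma transfers the Cauchy estimates to the pointwise limit. A finite family is
    treated at once to obtain one subsequence common to all coordinates. *)
Lemma L2_family_complete (I : finType) (u : nat -> I -> R -> R) :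
  (forall k i, rmeas (u k i)) -> (forall k i, rint (fun t => u k i t ^+ 2)) ->
  (forall e : R, 0 < e -> exists N : nat, forall k l, (N <= k)%N -> (N <= l)%N ->
     forall i, Ri (fun t => (u k i t - u l i t) ^+ 2) <= e) ->
  exists (f : I -> R -> R) (phi : nat -> nat),
  [/\ forall i, rmeas (f i) /\ rint (fun t => f i t ^+ 2), forall k, (k <= phi k)%N,
      aeD (fun t => forall i, u (phi k) i t @[k --> \oo] --> f i t) &
      forall e : R, 0 < e -> exists N : nat, forall k, (N <= k)%N ->
        forall i, Ri (fun t => (u k i t - f i t) ^+ 2) <= e].
Proof.
move=> mu_ iu cu.
have /choice [N hN] : forall j : nat, exists N : nat, forall k l, (N <= k)%N -> (N <= l)%N ->
     forall i, Ri (fun t => (u k i t - u l i t) ^+ 2) <= 4^-1 ^+ j.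
  by move=> j; apply: cu; rewrite exprn_gt0 // invr_gt0.
pose phi := fix phi j := if j is j'.+1 then maxn (N j'.+1) (phi j').+1 else N 0%N.
have phiN j : (N j <= phi j)%N by case: j => //= j; rewrite leq_maxl.
have phiS j : (phi j < phi j.+1)%N by rewrite /= leq_maxr.
have phik k : (k <= phi k)%N by elim: k => // k IH; apply: leq_ltn_trans IH (phiS k).
have /choice [f hf] : forall i, exists f, rmeas f /\
    aeD (fun t => u (phi k) i t @[k --> \oo] --> f t).
  move=> i; have [|||f mf cf] := @fast_cvg_ae R (fun j => u (phi j) i) => //.
  - by move=> j; exact: rint_sqB.
  - move=> j; apply: hN; apply: leq_trans (phiN j) _ => //; exact: ltnW.
  by exists f.
have lim e : 0 < e -> exists N : nat, forall k, (N <= k)%N -> forall i,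
    rint (fun t => (u k i t - f i t) ^+ 2) /\ Ri (fun t => (u k i t - f i t) ^+ 2) <= e.
  move=> e0; have [N' hN'] := cu e e0; exists N' => k kN i; have [mf cf] := hf i.
  apply: (@rfatou R (fun j t => (u k i t - u (phi j) i t) ^+ 2)).
  - by move=> j; apply: rmeasX; exact: rmeasB.
  - by apply: rmeasX; exact: rmeasB.
  - by move=> j; exact: rint_sqB.
  - by move=> j t _; exact: sqr_ge0.
  - by move=> t _; exact: sqr_ge0.
  - apply: aeDS cf => t _ h; rewrite expr2; under eq_cvg do rewrite expr2.
    by apply: cvgM; apply: cvgB => //; exact: cvg_cst.
  - exists N' => j jN; apply: hN' => //; exact: leq_trans jN (phik j).
exists f, phi; split=> //.
- move=> i; have [mf cf] := hf i; split=> //.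
  have [N' hN'] := lim 1 ltr01; have [h _] := hN' N' (leqnn _) i.
  have -> : (fun t => f i t ^+ 2) = (fun t => (u N' i t - (u N' i t - f i t)) ^+ 2).
    by apply/funext => t; congr (_ ^+ 2); ring.
  by apply: rint_sqB => //; exact: rmeasB.
- by apply: aeD_fin => i; have [] := hf i.
- move=> e /lim [N' hN']; exists N' => k /hN' h i; exact: (h i).2.
Qed.

Section Measurable.
Implicit Types f g : R -> C.

Lemma cmeas_cst (c : C) : cmeas (fun=> c).
Proof. by split; exact: rmeas_cst. Qed.
Lemma cmeasD f g : cmeas f -> cmeas g -> cmeas (fun t => f t + g t).
Proof.
move=> [f1 f2] [g1 g2]; split; rewrite /cRe /cIm.
- by under eq_fun do rewrite -/(cRe _) cReD; exact: rmeasD.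
- by under eq_fun do rewrite -/(cIm _) cImD; exact: rmeasD.
Qed.
Lemma cmeasN f : cmeas f -> cmeas (fun t => - f t).
Proof.
move=> [f1 f2]; split.
- by under eq_fun do rewrite cReN; exact: rmeasN.
- by under eq_fun do rewrite cImN; exact: rmeasN.
Qed.
Lemma cmeasB f g : cmeas f -> cmeas g -> cmeas (fun t => f t - g t).
Proof. by move=> hf hg; apply: cmeasD => //; exact: cmeasN. Qed.
Lemma cmeasM f g : cmeas f -> cmeas g -> cmeas (fun t => f t * g t).
Proof.
move=> [f1 f2] [g1 g2]; split.
- by under eq_fun do rewrite cReM; apply: rmeasB; exact: rmeasM.
- by under eq_fun do rewrite cImM; apply: rmeasD; exact: rmeasM.
Qed.
Lemma cmeas_conj f : cmeas f -> cmeas (fun t => cconj (f t)).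
Proof. by move=> [f1 f2]; split => //; exact: rmeasN. Qed.
Lemma cmeas_real (g : R -> R) : rmeas g -> cmeas (fun t => (g t)%:C).
Proof. by move=> mg; split => //; exact: rmeas_cst. Qed.
Lemma cmeas_sum (I : Type) (r : seq I) (P : pred I) (F : I -> R -> C) :
  (forall i, cmeas (F i)) -> cmeas (fun t => \sum_(i <- r | P i) F i t).
Proof.
move=> hF; elim: r => [|i r IH].
  by under eq_fun do rewrite big_nil; exact: cmeas_cst.
under eq_fun do rewrite big_cons.
by case: (P i) => //; exact: cmeasD.
Qed.
Lemma cmeas_prod (I : Type) (r : seq I) (P : pred I) (F : I -> R -> C) :
  (forall i, cmeas (F i)) -> cmeas (fun t => \prod_(i <- r | P i) F i t).
Proof.
move=> hF; elim: r => [|i r IH].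
  by under eq_fun do rewrite big_nil; exact: cmeas_cst.
under eq_fun do rewrite big_cons.
by case: (P i) => //; exact: cmeasM.
Qed.
Lemma rmeas_nsq f : cmeas f -> rmeas (fun t => nsq (f t)).
Proof. by move=> [f1 f2]; apply: rmeasD; exact: rmeasX. Qed.
Lemma cinvE (z : C) : z^-1 = (nsq z)^-1%:C * cconj z.
Proof.
have [->|z0] := eqVneq z 0; first by rewrite invr0 cconj0 mulr0.
apply: (mulfI z0); rewrite divff // mulrCA mulcconj -rmorphM /= mulVf //.
by rewrite nsq_eq0.
Qed.
Lemma cmeas_inv f : cmeas f -> cmeas (fun t => (f t)^-1).
Proof.
move=> hf; under eq_fun do rewrite cinvE.
apply: cmeasM; last exact: cmeas_conj.
apply: cmeas_real.
have -> : (fun t => (nsq (f t))^-1) = (fun x => x `^ (-1)) \o (fun t => nsq (f t)).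
  by apply/funext => t /=; rewrite powR_inv1 // nsq_ge0.
by apply: measurableT_comp; [exact: measurable_powR|exact: rmeas_nsq].
Qed.
Lemma cmeas_cexp (a : R) : cmeas (fun t => cexp (a * t)).
Proof.
have m : rmeas (fun t => a * t) by apply: rmeasM; [exact: rmeas_cst|exact: measurable_id].
split.
- exact: (measurableT_comp (continuous_measurable_fun (@continuous_cos R)) m).
- exact: (measurableT_comp (continuous_measurable_fun (@continuous_sin R)) m).
Qed.
End Measurable.
End SquareIntegrable.

(** * Functions annihilated by all polynomials in [cos (t - x)] *)

Section FourierUniqueness.
Variable R : realType.
Local Notation mu := (@lebesgue_measure R).
Local Notation D := (@circD R).

(** With [r = s ^+ 2], the product [n * s ^+ n] is at most a geometric sum, hence bounded, and the
    remaining factor [s ^+ n] tends to 0. *)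
Lemma natmul_expr_cvg0 (r : R) : 0 <= r < 1 -> (fun n => n%:R * r ^+ n) @ \oo --> (0 : R).
Proof.
move=> /andP[r0 r1]; set s := Num.sqrt r.
have s0 : 0 <= s by rewrite sqrtr_ge0.
have rs : r = s ^+ 2 by rewrite sqr_sqrtr.
have s1 : s < 1 by rewrite -(ltr_pXn2r (n := 2)) ?nnegrE // expr1n -rs.
have bd n : n%:R * s ^+ n <= (1 - s)^-1.
  have : n%:R * s ^+ n <= \sum_(i < n) s ^+ i.
    rewrite -[n%:R]/(1 *+ n) mulrnAl mul1r -[X in _ *+ X]card_ord -sumr_const.
    apply: ler_sum => i _; apply: ler_wiXn2l => //; first exact: ltW.
    exact: ltnW.
  move/le_trans; apply; rewrite -[leRHS]mul1r ler_pdivlMr ?subr_gt0 //.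
  have -> : (\sum_(i < n) s ^+ i) * (1 - s) = 1 - s ^+ n.
    by rewrite -[RHS]opprB subrX1; ring.
  by rewrite gerBl exprn_ge0.
have c0 : (fun n => (1 - s)^-1 * s ^+ n) @ \oo --> (0 : R).
  rewrite -(mulr0 (1 - s)^-1); apply: cvgM; first exact: cvg_cst.
  by apply: cvg_expr; rewrite ger0_norm.
apply: (squeeze_cvgr _ (cvg_cst 0) c0); apply: nearW => n.
rewrite mulr_ge0 ?exprn_ge0 //= rs -exprM mul2n -addnn exprD mulrA.
by rewrite ler_wpM2r ?exprn_ge0.
Qed.

Lemma bernoulli (x : R) n : -1 <= x -> 1 + n%:R * x <= (1 + x) ^+ n.
Proof.
move=> x1; elim: n => [|n IH]; first by rewrite mul0r addr0 expr0.
rewrite exprS -natr1; have x0 : 0 <= 1 + x by lra.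
apply: le_trans (ler_wpM2l x0 IH).
have := sqr_ge0 x; have : (0 : R) <= n%:R by rewrite ler0n.
nra.
Qed.

(* The exponent [n * m ^ n] makes the limit the indicator of [x < 1 / m] at every
   point, the threshold included. *)
Lemma step_poly_cvg (x : R) (m : nat) : (0 < m)%N -> 0 <= x <= 1 ->
  (fun n => (1 - x ^+ n) ^+ (n * m ^ n) : R) @ \oo --> ((x * m%:R < 1)%R%:R : R).
Proof.
move=> m0 /andP[x0 x1].
have m0' : (0 : R) < m%:R by rewrite ltr0n.
have xn n : 0 <= x ^+ n <= 1 by rewrite exprn_ge0 // exprn_ile1.
have b01 n : 0 <= (1 - x ^+ n) ^+ (n * m ^ n) <= 1.
  have /andP[a b] := xn n; rewrite exprn_ge0 ?subr_ge0 //= exprn_ile1 //; first lra.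
  by rewrite gerBl.
have [xm|xm] := ltP (x * m%:R) 1.
  have h0 := natmul_expr_cvg0 (r := x * m%:R).
  have {h0} h0 : (fun n => n%:R * (x * m%:R) ^+ n) @ \oo --> (0 : R).
    by apply: h0; rewrite xm mulr_ge0 // ltW.
  have h1 : (fun n => 1 - n%:R * (x * m%:R) ^+ n : R) @ \oo --> (1 : R).
    by rewrite -[X in _ --> X]subr0; apply: cvgB => //; exact: cvg_cst.
  rewrite -[X in _ --> X]/(1 : R).
  apply: (squeeze_cvgr _ h1 (cvg_cst (1 : R))); apply: nearW => n.
  have /andP[_ ->] := b01 n; rewrite andbT.
  have /andP[a b] := xn n.
  have := @bernoulli (- x ^+ n) (n * m ^ n)%N; rewrite lerN2 => /(_ b).
  rewrite exprMn natrM natrX; apply: le_trans.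
  by rewrite le_eqVlt; apply/orP; left; apply/eqP; move: (x ^+ n) (m%:R ^+ n) => u v; ring.
have c0 : (fun n : nat => (n%:R + 1)^-1 : R) @ \oo --> (0 : R).
  rewrite (_ : (fun n : nat => _) = @harmonic R); last by apply/funext => n; rewrite /= natr1.
  exact: cvg_harmonic.
rewrite -[X in _ --> X]/(0 : R).
apply: (squeeze_cvgr _ (cvg_cst 0) c0); apply: nearW => n.
have /andP[-> _] := b01 n => /=.
have /andP[a b] := xn n; set y := x ^+ n in a b *; set N := (n * m ^ n)%N.
have n1 : (0 : R) < n%:R + 1 by rewrite ltr_wpDl.
rewrite -[leRHS]mul1r ler_pdivlMr //.
(* Here [N * y = n * (m * x) ^+ n >= n], so Bernoulli's inequality applies; then
   [(1 - y) * (1 + y) <= 1] converts this lower bound into an upper bound on [(1 - y) ^+ N]. *)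
have h : n%:R + 1 <= (1 + y) ^+ N.
  apply: le_trans (@bernoulli y N _); last lra.
  rewrite addrC lerD2l /N natrM natrX -mulrA -exprMn.
  rewrite ler_peMr // exprn_ege1 // mulrC.
  by [].
apply: (@le_trans _ _ ((1 - y) ^+ N * (1 + y) ^+ N)).
  by rewrite ler_wpM2l // exprn_ge0 // subr_ge0.
rewrite -exprMn exprn_ile1 //; first by rewrite mulr_ge0 ?subr_ge0 // addr_ge0.
have := sqr_ge0 y; nra.
Qed.

(** Half the width of the arc around [x] on which [(1 - cos (t - x)) / 2 < 1 / n.+2]. Described in
    this way, the indicator of the arc is a pointwise limit of polynomials in [cos (t - x)]. *)
Let arc (n : nat) : R := acos (1 - 2 / n.+2%:R).

Lemma arc_bound (n : nat) : -1 <= 1 - 2 / n.+2%:R :> R /\ 1 - 2 / n.+2%:R < 1 :> R.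
Proof.
have p : (0 : R) < n.+2%:R by rewrite ltr0n.
split; last by rewrite gtrBl divr_gt0.
have : 2 / n.+2%:R <= (2 : R) by rewrite ler_pdivrMr // ler_peMr // ler1n.
by move: (2 / _) => x; lra.
Qed.

Lemma arc_gt0 n : 0 < arc n.
Proof. by have [a b] := arc_bound n; rewrite acos_gt0 // a b. Qed.
Lemma arc_lepi n : arc n <= pi.
Proof. by have [a b] := arc_bound n; rewrite acos_lepi // a ltW. Qed.
Lemma cos_arc n : cos (arc n) = 1 - 2 / n.+2%:R.
Proof. by have [a b] := arc_bound n; rewrite acosK // in_itv /= a ltW. Qed.

Lemma arc_cvg0 : arc @ \oo --> (0 : R).
Proof.
apply/cvgrPdist_lt => e e0.
pose e' := Num.min e pi.
have e'0 : 0 < e' by rewrite lt_min e0 pi_gt0.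
have c1 : cos e' < 1.
  rewrite -cos0 ltr_cos ?in_itv /= ?lexx ?pi_ge0 //.
  by rewrite (ltW e'0) ge_min lexx orbT.
have d0 : 0 < (1 - cos e') / 2 by rewrite divr_gt0 // subr_gt0.
have /cvgrPdist_lt /(_ _ d0) [N _ hN] := @cvg_harmonic R.
exists N => // n Nn /=; rewrite sub0r normrN ger0_norm ?(ltW (arc_gt0 n)) //.
apply: (@lt_le_trans _ _ e'); last by rewrite ge_min lexx.
rewrite -ltr_cos ?in_itv /= ?(ltW (arc_gt0 n)) ?arc_lepi ?(ltW e'0) ?ge_min ?lexx ?orbT //.
rewrite cos_arc; have := hN n.+1 (leq_trans Nn (leqnSn n)).
rewrite /= sub0r normrN ger0_norm ?invr_ge0 //.
move: (n.+2%:R^-1) => x; lra.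
Qed.

(** The conditions on [x] keep the arc from wrapping around at the ends of [[0, 2 pi)]: when
    [|t - x|] exceeds [pi], the distance measured the other way round still exceeds [arc n]. *)
Lemma arcP (x t : R) n : arc n < x -> x < 2 * pi - arc n -> D t ->
  ((1 - cos (t - x)) / 2 * n.+2%:R < 1) = (`|t - x| < arc n).
Proof.
move=> x1 x2 /andP[t0 t1]; have p : (0 : R) < n.+2%:R by rewrite ltr0n.
have a0 := arc_gt0 n; have ap := arc_lepi n.
have -> : ((1 - cos (t - x)) / 2 * n.+2%:R < 1) = (cos (arc n) < cos `|t - x|).
  rewrite cos_norm cos_arc; move: (cos _) => c.
  have -> : ((1 - c) / 2 * n.+2%:R < 1) = (1 - c < 2 / n.+2%:R).
    by rewrite ltr_pdivlMr // mulrAC ltr_pdivrMr // mul1r.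
  by rewrite ltrBlDr -ltrBlDl.
have [s1|s1] := leP `|t - x| pi.
  by rewrite ltr_cos // in_itv /= ?normr_ge0 ?s1 ?(ltW a0).
have -> : (`|t - x| < arc n) = false by apply/negbTE; rewrite -leNgt; lra.
apply/negbTE; rewrite -leNgt.
have -> : cos `|t - x| = cos (2 * pi - `|t - x|).
  by rewrite -[RHS]cosN -[RHS]cosD2pi; congr cos; rewrite -mulr_natl; ring.
have s2 : `|t - x| < 2 * pi - arc n by rewrite ltr_norml; apply/andP; split; lra.
apply: ltW; rewrite ltr_cos ?in_itv /=.
- lra.
- by apply/andP; split; lra.
- by apply/andP; split; lra.
Qed.

(** By dominated convergence along the polynomials of [step_poly_cvg], the integral of [g] over
    every short arc vanishes; Lebesgue differentiation along these arcs then gives the values of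
    [g]. *)
Lemma ae_eq0_of_cos_poly (g : R -> R) : rint g ->
  (forall (x : R) (p : {poly R}), Ri (fun t => g t * p.[(1 - cos (t - x)) / 2]) = 0) ->
  aeD (fun t => g t = 0).
Proof.
move=> ig hp; have mg := rint_meas ig.
have mcos (x : R) : rmeas (fun t => (1 - cos (t - x)) / 2).
  apply: rmeasM; last exact: rmeas_cst.
  apply: rmeasB; first exact: rmeas_cst.
  apply: (measurableT_comp (continuous_measurable_fun (@continuous_cos R))).
  by apply: rmeasB; [exact: measurable_id|exact: rmeas_cst].
have c01 (x t : R) : 0 <= (1 - cos (t - x)) / 2 <= 1.
  by have := cos_geN1 (t - x); have := cos_le1 (t - x) => h1 h2; apply/andP; split; lra.
have zero (x : R) n : arc n < x -> x < 2 * pi - arc n ->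
    Ri (fun t => g t * (`|t - x| < arc n)%R%:R) = 0.
  move=> x1 x2.
  pose F k t := g t * (1 - ((1 - cos (t - x)) / 2) ^+ k) ^+ (k * n.+2 ^ k).
  have [|||||_ h] := @rdct R F (fun t => g t * ((1 - cos (t - x)) / 2 * n.+2%:R < 1)%R%:R)
     (fun t => `|g t|).
  - move=> k; apply: rmeasM => //; apply: rmeasX; apply: rmeasB; first exact: rmeas_cst.
    by apply: rmeasX.
  - apply: rmeasM => //.
    pose b (k : nat) (t : R) : R := (1 - ((1 - cos (t - x)) / 2) ^+ k) ^+ (k * n.+2 ^ k).
    apply: (measurable_fun_cvg (h := b)).
      move=> k; apply: rmeasX; apply: rmeasB; first exact: rmeas_cst.
      exact: rmeasX.
    by move=> t _; exact: step_poly_cvg.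
  - exact: rint_norm.
  - by apply: aeDT => t _; apply: cvgM; [exact: cvg_cst|exact: step_poly_cvg].
  - apply: aeDT => t _ k; rewrite /F normrM ler_piMr // ger0_norm.
      have /andP[a b] := c01 x t; apply: exprn_ile1; last by rewrite gerBl exprn_ge0.
      by rewrite subr_ge0 exprn_ile1.
    by have /andP[a b] := c01 x t; rewrite exprn_ge0 ?subr_ge0 ?exprn_ile1.
  have F0 k : Ri (F k) = 0.
    rewrite -(hp x ((1 - 'X^k) ^+ (k * n.+2 ^ k))); congr Ri; apply/funext => t.
    by rewrite /F horner_exp !hornerE.
  have {}h : Ri (fun t => g t * ((1 - cos (t - x)) / 2 * n.+2%:R < 1)%R%:R) = 0.
    have h' : Ri (F k) @[k --> \oo] --> (0 : R).
      by rewrite (_ : (fun k => Ri (F k)) = cst 0); [exact: cvg_cst|apply/funext => k].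
    exact: (cvg_unique (@Rhausdorff R) h h').
  by rewrite -h; apply: eq_Ri => t Dt; rewrite arcP.
have locg := integrable_locally_restrict (@measurable_circD R) ig.
have ldt := lebesgue_differentiation locg.
(* The point 0 is discarded because arcs centred there leave [[0, 2 pi)]. Around every other point
   of the interval all sufficiently short arcs fall under [zero]. *)
have ne0 : {ae mu, forall t, t <> 0 :> R}.
  exists [set (0 : R)]; split; [exact: measurable_set1|exact: lebesgue_measure_set1|].
  by move=> t /= /contrapT.
pose rr n : {posnum R} := PosNum (arc_gt0 n).
pose E (x : R) n := ball x (rr n)%:num.
have hE x : nicely_shrinking x (E x).
  split; first by move=> n; exact: measurable_ball.
  exists (1, rr); split => /=; [exact: ltr01|exact: arc_cvg0|by move=> n|].
  by move=> n; rewrite [X in (_ <= X)%E]mul1e.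
have aeF : Filter (almost_everywhere mu) by exact: ae_filter_ringOfSetsType.
apply: (@filterS2 _ _ aeF) ldt ne0 => t lt t0 Dt.
have := nice_lebesgue_differentiation hE locg lt.
rewrite patchE mem_set // => h.
suff h0 : (fun=> 0%E : \bar R) @ \oo --> (g t)%:E.
  have : (g t)%:E = 0%E by exact: (cvg_unique (@ereal_hausdorff R) h0 (cvg_cst 0%E)).
  by case.
apply: cvg_trans h; apply: near_eq_cvg.
have /andP[t1 t2] := Dt.
have d0 : 0 < Num.min t (2 * pi - t) by rewrite lt_min subr_gt0 t2 andbT lt_def t1 andbT; apply/eqP.
have /cvgrPdist_lt /(_ _ d0) [N _ hN] := arc_cvg0.
exists N => // n /hN /=; rewrite sub0r normrN ger0_norm ?(ltW (arc_gt0 n)) // lt_min.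
move=> /andP[n1 n2].
have z := zero t n n1; have {}z : Ri (fun y => g y * (`|y - t| < arc n)%R%:R) = 0 by apply: z; lra.
have -> : (\int[mu]_(y in E t n) ((g \_ D) y)%:E = 0)%E; last by rewrite mule0.
have mb : measurable (E t n) by exact: measurable_ball.
have bE y : `|y - t| < arc n <-> E t n y by rewrite /E -ball_normE /= distrC.
have ib : rint (fun y => g y * (`|y - t| < arc n)%R%:R).
  apply: rint_le (rint_norm ig) _; last first.
    by move=> y _; rewrite normrM ler_piMr // normr_nat; case: (_ < _).
  apply: rmeasM => //.
  have -> : (fun y : R => (`|y - t| < arc n)%R%:R) = \1_(E t n) :> (R -> R).
    apply/funext => y; rewrite indicE; congr ((nat_of_bool _)%:R).
    by apply/idP/idP => [/bE /mem_set //|/set_mem /bE].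
  exact: measurable_indic.
transitivity ((Ri (fun y => g y * (`|y - t| < arc n)%R%:R))%:E); last by rewrite z.
rewrite /Ri /Rintegral fineK; last exact: (integrable_fin_num (@measurable_circD' R) ib).
rewrite [LHS]integral_mkcond [RHS]integral_mkcond; apply: eq_integral => y _.
rewrite !patchE; case: (asboolP (D y)) => Dy.
  rewrite (mem_set Dy); case: ifPn => [/set_mem /bE ->|/negP h]; first by rewrite mulr1.
  have -> : (`|y - t| < arc n) = false; last by rewrite mulr0.
  by apply/negP => /bE h'; apply: h; apply/mem_set.
rewrite (memNset Dy); by case: ifP.
Qed.

End FourierUniqueness.

(** * Complex integrals and uniqueness of Fourier coefficients *)

Section ComplexIntegrals.
Variable R : realType.
Local Notation D := (@circD R).
Local Notation C := (complex R).
Implicit Types f g : R -> C.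

Definition cL1 f : Prop := rint (fun t => cRe (f t)) /\ rint (fun t => cIm (f t)).
(** Integrating against [ez k] extracts, up to the factor [2 pi], the Fourier coefficient of index
    [- k]; this is why analyticity is tested with positive [k]. *)
Definition ez (k : int) (t : R) : C := cexp (k%:~R * t).

Lemma ezD k l t : ez (k + l) t = ez k t * ez l t.
Proof. by rewrite /ez rmorphD /= mulrDl cexpD. Qed.
Lemma ez0 t : ez 0 t = 1. Proof. by rewrite /ez mul0r cexp0. Qed.
Lemma ezN k t : ez (- k) t = cconj (ez k t).
Proof. by rewrite /ez rmorphN /= mulNr cexpN. Qed.
Lemma nsq_ez k t : nsq (ez k t) = 1. Proof. exact: nsq_cexp. Qed.
Lemma ezK k t : ez k t * ez (- k) t = 1. Proof. by rewrite -ezD subrr ez0. Qed.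
Lemma cmeas_ez k : cmeas (ez k). Proof. exact: cmeas_cexp. Qed.

Lemma cL1_meas f : cL1 f -> cmeas f.
Proof. by move=> [h1 h2]; split; exact: rint_meas. Qed.
Lemma cL1D f g : cL1 f -> cL1 g -> cL1 (fun t => f t + g t).
Proof.
move=> [f1 f2] [g1 g2]; split.
- by under eq_fun do rewrite cReD; exact: rintD.
- by under eq_fun do rewrite cImD; exact: rintD.
Qed.
Lemma cL1Z (c : C) f : cL1 f -> cL1 (fun t => c * f t).
Proof.
move=> [f1 f2]; split.
- by under eq_fun do rewrite cReM; apply: rintB; exact: rintZ.
- by under eq_fun do rewrite cImM; apply: rintD; exact: rintZ.
Qed.
Lemma cL1N f : cL1 f -> cL1 (fun t => - f t).
Proof. by move=> /(cL1Z (-1)); under eq_fun do rewrite mulN1r. Qed.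
Lemma cL1B f g : cL1 f -> cL1 g -> cL1 (fun t => f t - g t).
Proof. by move=> hf hg; apply: cL1D => //; exact: cL1N. Qed.
Lemma cL1_cst (c : C) : cL1 (fun=> c).
Proof. by split; exact: rint_cst. Qed.
Lemma cL1_sum (I : Type) (r : seq I) (P : pred I) (F : I -> R -> C) :
  (forall i, cL1 (F i)) -> cL1 (fun t => \sum_(i <- r | P i) F i t).
Proof.
move=> hF; elim: r => [|i r IH].
  by under eq_fun do rewrite big_nil; exact: cL1_cst.
under eq_fun do rewrite big_cons.
by case: (P i) => //; exact: cL1D.
Qed.
Lemma cL1_dom f (g : R -> R) : cmeas f -> rint g ->
  aeD (fun t => `|cRe (f t)| <= g t /\ `|cIm (f t)| <= g t) -> cL1 f.
Proof.
move=> [f1 f2] ig h; split.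
- by apply: rint_le_ae ig _ => //; apply: aeDS h => t _ [].
- by apply: rint_le_ae ig _ => //; apply: aeDS h => t _ [].
Qed.
Lemma cL1_bM (b f : R -> C) (M : R) : cmeas b -> aeD (fun t => nsq (b t) <= M) ->
  cL1 f -> cL1 (fun t => b t * f t).
Proof.
move=> mb bM hf; have [f1 f2] := hf.
have ig := rintZ (M + 1) (rintD (rint_norm f1) (rint_norm f2)).
apply: cL1_dom ig _; first by apply: cmeasM => //; exact: cL1_meas.
have bnd (x y : R) : x ^+ 2 + y ^+ 2 <= M -> `|x| <= M + 1.
  by move=> h; rewrite ler_norml; apply/andP; split; nra.
apply: aeDS bM => t _ h; have h1 := bnd _ _ h.
have h2 : `|cIm (b t)| <= M + 1 by apply: (bnd _ (cRe (b t))); rewrite addrC.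
rewrite cReM cImM; move: h1 h2; move: (cRe (b t)) (cIm (b t)) (cRe (f t)) (cIm (f t)).
move=> x y u v h1 h2; rewrite mulrDr; split.
  by apply: le_trans (ler_normB _ _) _; rewrite !normrM lerD // ler_wpM2r.
by apply: le_trans (ler_normD _ _) _; rewrite !normrM addrC lerD // ler_wpM2r.
Qed.
Lemma cL1_ez f k : cL1 f -> cL1 (fun t => f t * ez k t).
Proof.
move=> hf; under eq_fun do rewrite mulrC; apply: cL1_bM hf => //; first exact: cmeas_ez.
by apply: aeDT => t _; rewrite nsq_ez.
Qed.

Lemma cRe_cint f : cRe (cint f) = Ri (fun t => cRe (f t)). Proof. by []. Qed.
Lemma cIm_cint f : cIm (cint f) = Ri (fun t => cIm (f t)). Proof. by []. Qed.
Lemma cintD f g : cL1 f -> cL1 g -> cint (fun t => f t + g t) = cint f + cint g.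
Proof.
move=> [f1 f2] [g1 g2]; apply: complexP; rewrite !cRIE ?cRe_cint ?cIm_cint.
- by under eq_Ri => t _ do rewrite cReD; exact: RiD.
- by under eq_Ri => t _ do rewrite cImD; exact: RiD.
Qed.
Lemma cintZ (c : C) f : cL1 f -> cint (fun t => c * f t) = c * cint f.
Proof.
move=> [f1 f2]; apply: complexP; rewrite !cRIE ?cRe_cint ?cIm_cint.
- by under eq_Ri => t _ do rewrite cReM; rewrite RiB ?RiZ //; exact: rintZ.
- by under eq_Ri => t _ do rewrite cImM; rewrite RiD ?RiZ //; exact: rintZ.
Qed.
Lemma cintN f : cL1 f -> cint (fun t => - f t) = - cint f.
Proof.
move=> hf; have := cintZ (-1) hf; rewrite mulN1r => <-; congr cint.
by apply/funext => t; rewrite mulN1r.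
Qed.
Lemma cintB f g : cL1 f -> cL1 g -> cint (fun t => f t - g t) = cint f - cint g.
Proof. by move=> hf hg; rewrite cintD ?cintN //; exact: cL1N. Qed.
Lemma cint_conj f : cL1 f -> cint (fun t => cconj (f t)) = cconj (cint f).
Proof. by move=> [f1 f2]; apply: complexP => //; rewrite cIm_conj !cIm_cint -RiN. Qed.
Lemma cint_cst (c : C) : cint (fun=> c) = c * (2 * pi)%:C.
Proof. by apply: complexP; rewrite !cRIE ?cRe_cint ?cIm_cint Ri_cst; ring. Qed.
Lemma cint_sum (I : Type) (r : seq I) (P : pred I) (F : I -> R -> C) :
  (forall i, cL1 (F i)) ->
  cint (fun t => \sum_(i <- r | P i) F i t) = \sum_(i <- r | P i) cint (F i).
Proof.
move=> hF; elim: r => [|i r IH].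
  rewrite big_nil; under eq_fun do rewrite big_nil; by rewrite cint_cst mul0r.
under eq_fun do rewrite big_cons.
rewrite big_cons; case: (P i) => //; rewrite cintD ?IH //; exact: cL1_sum.
Qed.
Lemma cint_ae f g : cmeas f -> cmeas g -> aeD (fun t => f t = g t) -> cint f = cint g.
Proof.
move=> [f1 f2] [g1 g2] fg; apply: complexP; rewrite ?cRe_cint ?cIm_cint.
- by apply: Ri_ae => //; apply: aeDS fg => t _ ->.
- by apply: Ri_ae => //; apply: aeDS fg => t _ ->.
Qed.

(** The factor [(1 - cos (t - x)) / 2] is a combination of 1, [ez 1] and [ez (- 1)], so multiplying
    by it merely moves the index. Induction on the polynomial, for all [k] together, brings the real
    and imaginary parts under [ae_eq0_of_cos_poly]. *)
Lemma fourier_unique f : cL1 f -> (forall k, cint (fun t => f t * ez k t) = 0) ->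
  aeD (fun t => f t = 0).
Proof.
move=> hf f0.
have key (x : R) (p : {poly R}) : forall k,
    cL1 (fun t => f t * (p.[(1 - cos (t - x)) / 2])%:C * ez k t) /\
    cint (fun t => f t * (p.[(1 - cos (t - x)) / 2])%:C * ez k t) = 0.
  elim/poly_ind: p => [|p c IH] k.
    have -> : (fun t => f t * ((0 : {poly R}).[(1 - cos (t - x)) / 2])%:C * ez k t) =
       fun=> 0 by apply/funext => t; rewrite horner0 mulr0 mul0r.
    by split; [exact: cL1_cst|rewrite cint_cst mul0r].
  have [h1 i1] := IH k; have [h2 i2] := IH (k + 1); have [h3 i3] := IH (k - 1).
  have -> : (fun t => f t * ((p * 'X + c%:P).[(1 - cos (t - x)) / 2])%:C * ez k t) =
    fun t => c%:C * (f t * ez k t) +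
      ((2^-1)%:C * (f t * (p.[(1 - cos (t - x)) / 2])%:C * ez k t) +
      (- (4^-1)%:C * cconj (cexp x) *
         (f t * (p.[(1 - cos (t - x)) / 2])%:C * ez (k + 1) t) +
       - (4^-1)%:C * cexp x * (f t * (p.[(1 - cos (t - x)) / 2])%:C * ez (k - 1) t))).
    apply/funext => t; rewrite hornerMXaddC !ezD ezN; move: (p.[_]) => q.
    have -> : ez 1 t = cexp t by rewrite /ez mul1r.
    have -> : (q * ((1 - cos (t - x)) / 2) + c)%:C = c%:C + (2^-1)%:C * q%:C
       - (4^-1)%:C * q%:C * (cconj (cexp x) * cexp t + cexp x * cconj (cexp t)).
      apply: complexP; rewrite !cRIE /cexp /cRe /cIm /= ?cosB; last by ring.
      have h4 : (4^-1 : R) = 2^-1 * 2^-1 by rewrite -invfM -natrM.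
      rewrite h4; have : (2^-1 : R) * 2 = 1 by rewrite mulVf.
      move: (2^-1 : R) => a ha; have -> : (1 - (cos t * cos x + sin t * sin x)) * a =
         a - a * (2 * a) * (cos t * cos x + sin t * sin x) by rewrite mulrC in ha; rewrite ha; ring.
      ring.
    ring.
  have z0 := cL1Z c%:C (cL1_ez k hf); have z1 := cL1Z (2^-1)%:C h1.
  have z2 := cL1Z (- (4^-1)%:C * cconj (cexp x)) h2.
  have z3 := cL1Z (- (4^-1)%:C * cexp x) h3.
  have z23 := cL1D z2 z3; have z123 := cL1D z1 z23.
  split; first exact: cL1D.
  by rewrite cintD // cintD // cintD // !cintZ ?i1 ?i2 ?i3 ?f0 ?mulr0 ?addr0 //; exact: cL1_ez.
have [f1 f2] := hf.
have z1 : aeD (fun t => cRe (f t) = 0).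
  apply: ae_eq0_of_cos_poly => // x p; have [_] := key x p 0.
  move=> /(congr1 (@cRe R)); rewrite cRe_cint !cRIE => <-; congr Ri; apply/funext => t.
  by rewrite ez0 mulr1 !cRIE mulr0 subr0.
have z2 : aeD (fun t => cIm (f t) = 0).
  apply: ae_eq0_of_cos_poly => // x p; have [_] := key x p 0.
  move=> /(congr1 (@cIm R)); rewrite cIm_cint !cRIE => <-; congr Ri; apply/funext => t.
  by rewrite ez0 mulr1 !cRIE mulr0 add0r.
by apply: aeDS2 z1 z2 => t _ h1 h2; apply: complexP.
Qed.

Lemma cdct (F : nat -> R -> C) f (g : R -> R) : (forall k, cmeas (F k)) -> cmeas f ->
  rint g -> aeD (fun t => cRe (F k t) @[k --> \oo] --> cRe (f t) /\
                          cIm (F k t) @[k --> \oo] --> cIm (f t)) ->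
  aeD (fun t => forall k, `|cRe (F k t)| <= g t /\ `|cIm (F k t)| <= g t) ->
  (forall k, cint (F k) = 0) -> cint f = 0.
Proof.
move=> mF [f1 f2] ig cF Fg F0; apply: complexP; rewrite ?cRe_cint ?cIm_cint.
- have [|||||_ h] := @rdct R (fun k t => cRe (F k t)) (fun t => cRe (f t)) g => //.
  + by move=> k; have [] := mF k.
  + by apply: aeDS cF => t _ [].
  + by apply: aeDS Fg => t _ h k; have [] := h k.
  apply: (cvg_unique (@Rhausdorff R) h).
  rewrite (_ : (fun k => _) = cst 0); first exact: cvg_cst.
  by apply/funext => k; rewrite -cRe_cint F0.
- have [|||||_ h] := @rdct R (fun k t => cIm (F k t)) (fun t => cIm (f t)) g => //.
  + by move=> k; have [] := mF k.
  + by apply: aeDS cF => t _ [].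
  + by apply: aeDS Fg => t _ h k; have [] := h k.
  apply: (cvg_unique (@Rhausdorff R) h).
  rewrite (_ : (fun k => _) = cst 0); first exact: cvg_cst.
  by apply/funext => k; rewrite -cIm_cint F0.
Qed.

Definition sL2 f : Prop := cmeas f /\ rint (fun t => nsq (f t)).

Lemma sL2_L1M f g : sL2 f -> sL2 g -> cL1 (fun t => f t * g t).
Proof.
move=> [mf f2] [mg g2]; apply: (cL1_dom (g := fun t => nsq (f t) + nsq (g t))).
- exact: cmeasM.
- exact: rintD.
apply: aeDT => t _; rewrite cReM cImM /nsq.
move: (cRe (f t)) (cIm (f t)) (cRe (g t)) (cIm (g t)) => x y u v.
have h1 := sqr_ge0 (x + u); have h2 := sqr_ge0 (x - u).
have h3 := sqr_ge0 (y + v); have h4 := sqr_ge0 (y - v).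
have h5 := sqr_ge0 (x + v); have h6 := sqr_ge0 (x - v).
have h7 := sqr_ge0 (y + u); have h8 := sqr_ge0 (y - u).
by split; rewrite ler_norml; apply/andP; split; nra.
Qed.
Lemma sL2_cst (c : C) : sL2 (fun=> c).
Proof. by split; [exact: cmeas_cst|exact: rint_cst]. Qed.
Lemma sL2_conj f : sL2 f -> sL2 (fun t => cconj (f t)).
Proof.
move=> [mf f2]; split; first exact: cmeas_conj.
by under eq_fun do rewrite nsq_conj.
Qed.
Lemma sL2_L1 f : sL2 f -> cL1 f.
Proof. by move=> hf; have := sL2_L1M hf (sL2_cst 1); under eq_fun do rewrite mulr1. Qed.
Lemma sL2_L1Mc f g : sL2 f -> sL2 g -> cL1 (fun t => f t * cconj (g t)).
Proof. by move=> hf hg; apply: sL2_L1M => //; exact: sL2_conj. Qed.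
Lemma sL2D f g : sL2 f -> sL2 g -> sL2 (fun t => f t + g t).
Proof.
move=> [mf f2] [mg g2]; split; first exact: cmeasD.
apply: rint_le (rintD (rintZ 2 f2) (rintZ 2 g2)) _; first by apply: rmeas_nsq; exact: cmeasD.
by move=> t _; rewrite ger0_norm ?nsq_ge0 // nsqD_le.
Qed.
Lemma sL2_bM (b f : R -> C) (M : R) : cmeas b -> aeD (fun t => nsq (b t) <= M) ->
  sL2 f -> sL2 (fun t => b t * f t).
Proof.
move=> mb bM [mf f2]; split; first exact: cmeasM.
apply: rint_le_ae (rintZ M f2) _; first by apply: rmeas_nsq; exact: cmeasM.
by apply: aeDS bM => t _ h; rewrite ger0_norm ?nsq_ge0 // nsqM ler_wpM2r // nsq_ge0.
Qed.
Lemma sL2Z (c : C) f : sL2 f -> sL2 (fun t => c * f t).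
Proof. by apply: (sL2_bM (cmeas_cst c) (M := nsq c)); apply: aeDT. Qed.
Lemma sL2N f : sL2 f -> sL2 (fun t => - f t).
Proof. by move=> /(sL2Z (-1)); under eq_fun do rewrite mulN1r. Qed.
Lemma sL2B f g : sL2 f -> sL2 g -> sL2 (fun t => f t - g t).
Proof. by move=> hf hg; apply: sL2D => //; exact: sL2N. Qed.
Lemma sL2_ez k f : sL2 f -> sL2 (fun t => ez k t * f t).
Proof.
apply: (sL2_bM (cmeas_ez k) (M := 1)); apply: aeDT => t _.
by rewrite nsq_ez.
Qed.
Lemma sL2_sum (I : Type) (r : seq I) (P : pred I) (F : I -> R -> C) :
  (forall i, sL2 (F i)) -> sL2 (fun t => \sum_(i <- r | P i) F i t).
Proof.
move=> hF; elim: r => [|i r IH].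
  by under eq_fun do rewrite big_nil; exact: sL2_cst.
under eq_fun do rewrite big_cons.
by case: (P i) => //; exact: sL2D.
Qed.
Lemma sL2_ae f g : sL2 f -> cmeas g -> aeD (fun t => f t = g t) -> sL2 g.
Proof.
move=> [mf f2] mg fg; split=> //; apply: rint_ae f2 (rmeas_nsq mg) _.
by apply: aeDS fg => t _ ->.
Qed.

End ComplexIntegrals.

(** * Finite-dimensional vectors, contractions and singular values *)

Section Vectors.
Variable R : realType.
Local Notation C := (complex R).

Definition vdot m (u v : 'cV[C]_m) : C := \sum_i u i 0 * cconj (v i 0).
Definition vsq m (v : 'cV[C]_m) : R := \sum_i nsq (v i 0).

Lemma vdot_hform m : hform (fun _ : 'cV[C]_m => True) (@vdot m).
Proof.
split=> //.
- move=> a u v w _ _ _; rewrite /vdot mulr_sumr -big_split; apply: eq_bigr => i _.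
  by rewrite !mxE mulrDl mulrA.
- move=> u v _ _; rewrite /vdot cconj_sum; apply: eq_bigr => i _.
  by rewrite cconjM cconjK mulrC.
- move=> u _; rewrite /vdot cRe_sum; apply: sumr_ge0 => i _.
  by rewrite mulcconj nsq_ge0.
Qed.

Lemma vdotvv m (v : 'cV[C]_m) : vdot v v = (vsq v)%:C.
Proof.
rewrite /vdot /vsq rmorph_sum; apply: eq_bigr => i _; exact: mulcconj.
Qed.
Lemma vsqE m (v : 'cV[C]_m) : vsq v = cRe (vdot v v).
Proof. by rewrite vdotvv. Qed.
Lemma vsq_ge0 m (v : 'cV[C]_m) : 0 <= vsq v.
Proof. by apply: sumr_ge0 => i _; exact: nsq_ge0. Qed.
Lemma vsq0 m : vsq (0 : 'cV[C]_m) = 0.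
Proof. by rewrite /vsq big1 // => i _; rewrite mxE nsq0. Qed.
Lemma vsq_eq0 m (v : 'cV[C]_m) : vsq v = 0 -> v = 0.
Proof.
move=> v0; apply/matrixP => i j; rewrite (ord1 j) mxE; apply/eqP; rewrite -nsq_eq0.
have := v0 => /eqP; rewrite psumr_eq0 => [|k _]; last exact: nsq_ge0.
by move=> /allP /(_ i); rewrite mem_index_enum => /(_ isT).
Qed.
Lemma vsqZ m (a : C) (v : 'cV[C]_m) : vsq (a *: v) = nsq a * vsq v.
Proof. by rewrite /vsq mulr_sumr; apply: eq_bigr => i _; rewrite mxE nsqM. Qed.
Lemma vsqN m (v : 'cV[C]_m) : vsq (- v) = vsq v.
Proof. by apply: eq_bigr => i _; rewrite mxE nsqN. Qed.
Lemma nsq_le_vsq m (v : 'cV[C]_m) i : nsq (v i 0) <= vsq v.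
Proof.
by rewrite /vsq (bigD1 i) //= lerDl; apply: sumr_ge0 => k _; exact: nsq_ge0.
Qed.
Lemma vdot_CS m (u v : 'cV[C]_m) : nsq (vdot u v) <= vsq u * vsq v.
Proof. by rewrite !vsqE; apply: hform_CS (vdot_hform m) _ _ _ _. Qed.
Lemma vnorm2 m (v : 'cV[C]_m) : vnorm v ^+ 2 = vsq v.
Proof.
have e : \sum_i cabs (v i 0) ^+ 2 = vsq v by apply: eq_bigr => i _; exact: cabs2.
by rewrite /vnorm e sqr_sqrtr // vsq_ge0.
Qed.
Lemma vnorm_ge0 m (v : 'cV[C]_m) : 0 <= vnorm v. Proof. exact: sqrtr_ge0. Qed.
Lemma vnorm_le m (v : 'cV[C]_m) (a : R) : 0 <= a -> (vnorm v <= a) = (vsq v <= a ^+ 2).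
Proof. by move=> a0; rewrite -vnorm2 ler_sqr ?nnegrE // vnorm_ge0. Qed.

Lemma vdotBl m (u v w : 'cV[C]_m) : vdot (u - v) w = vdot u w - vdot v w.
Proof. exact: (hformBl (vdot_hform m)). Qed.
Lemma vdotDl m (u v w : 'cV[C]_m) : vdot (u + v) w = vdot u w + vdot v w.
Proof. exact: (hformDl (vdot_hform m)). Qed.
Lemma vdotBr m (u v w : 'cV[C]_m) : vdot w (u - v) = vdot w u - vdot w v.
Proof. exact: (hformBr (vdot_hform m)). Qed.
Lemma vdotZl m a (u w : 'cV[C]_m) : vdot (a *: u) w = a * vdot u w.
Proof. exact: (hformZl (vdot_hform m)). Qed.
Lemma vdotZr m a (u w : 'cV[C]_m) : vdot w (a *: u) = cconj a * vdot w u.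
Proof. exact: (hformZr (vdot_hform m)). Qed.
Lemma vdotC m (u v : 'cV[C]_m) : vdot v u = cconj (vdot u v).
Proof. exact: (hformC (vdot_hform m)). Qed.
Lemma vdot_suml m (I : Type) (r : seq I) (P : pred I) (F : I -> 'cV[C]_m) w :
  vdot (\sum_(i <- r | P i) F i) w = \sum_(i <- r | P i) vdot (F i) w.
Proof.
elim/big_rec2: _ => [|i y1 y2 _ <-]; last by rewrite vdotDl.
by rewrite /vdot big1 // => i _; rewrite mxE mul0r.
Qed.
Lemma vsqB m (u v : 'cV[C]_m) : vsq (u - v) = vsq u + vsq v - 2 * cRe (vdot u v).
Proof. by rewrite !vsqE; exact: (hqB (vdot_hform m)). Qed.
Lemma vsqD_le m (u v : 'cV[C]_m) : vsq (u + v) <= 2 * vsq u + 2 * vsq v.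
Proof. by rewrite !vsqE; exact: (hqD_le (vdot_hform m)). Qed.

Lemma adjmxE m (A : 'M[C]_m) i j : adjmx A i j = cconj (A j i).
Proof. by rewrite !mxE. Qed.
Lemma adjmxK m (A : 'M[C]_m) : adjmx (adjmx A) = A.
Proof. by apply/matrixP => i j; rewrite !adjmxE cconjK. Qed.
Lemma vdot_adj m (A : 'M[C]_m) u v : vdot (A *m u) v = vdot u (adjmx A *m v).
Proof.
rewrite /vdot; under eq_bigr do rewrite mxE mulr_suml.
rewrite exchange_big; apply: eq_bigr => j _ /=; rewrite mxE cconj_sum mulr_sumr.
by apply: eq_bigr => i _; rewrite adjmxE cconjM cconjK; ring.
Qed.
Lemma vdot_adjr m (A : 'M[C]_m) u v : vdot u (A *m v) = vdot (adjmx A *m u) v.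
Proof. by rewrite vdot_adj adjmxK. Qed.
Lemma mx_ext m k (A B : 'M[C]_(m, k)) : (forall v : 'cV_k, A *m v = B *m v) -> A = B.
Proof.
move=> h; apply/matrixP => i j; have := h (delta_mx j 0).
by rewrite -!colE => /matrixP /(_ i 0); rewrite !mxE.
Qed.

Definition frob m k (A : 'M[C]_(m, k)) : R := \sum_i \sum_j nsq (A i j).
Lemma frob_ge0 m k (A : 'M[C]_(m, k)) : 0 <= frob A.
Proof. by apply: sumr_ge0 => i _; apply: sumr_ge0 => j _; exact: nsq_ge0. Qed.
Lemma vsq_mulmx m k (A : 'M[C]_(m, k)) v : vsq (A *m v) <= frob A * vsq v.
Proof.
rewrite /frob mulr_suml; apply: ler_sum => i _; rewrite mxE.
have := vdot_CS (\col_j A i j) (\col_j cconj (v j 0)).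
have -> : vdot (\col_j A i j) (\col_j cconj (v j 0)) = \sum_j A i j * v j 0.
  by apply: eq_bigr => j _; rewrite !mxE cconjK.
have -> : vsq (\col_j A i j) = \sum_j nsq (A i j) by apply: eq_bigr => j _; rewrite mxE.
have -> // : vsq (\col_j cconj (v j 0)) = vsq v.
by apply: eq_bigr => j _; rewrite mxE nsq_conj.
Qed.

Lemma opnorm_has_sup m k (A : 'M[C]_(m, k)) :
  has_sup [set vnorm (A *m v) | v in [set v : 'cV[C]_k | vnorm v <= 1]].
Proof.
split; first by exists (vnorm (A *m 0)); exists 0 => //=; rewrite vnorm_le // vsq0 expr1n.
exists (frob A + 1) => _ [v /= v1 <-].
have f0 := frob_ge0 A; rewrite vnorm_le; last lra.
apply: le_trans (vsq_mulmx A v) _; rewrite vnorm_le // expr1n in v1.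
have := vsq_ge0 v; nra.
Qed.

Lemma opnorm_ub m k (A : 'M[C]_(m, k)) v : vnorm v <= 1 -> vnorm (A *m v) <= opnorm A.
Proof.
move=> v1; have h := ub_le_sup (opnorm_has_sup A).2; apply: h; by exists v.
Qed.

Lemma opnorm_ge m k (A : 'M[C]_(m, k)) v : vsq (A *m v) <= opnorm A ^+ 2 * vsq v.
Proof.
have [v0|v0] := eqVneq (vsq v) 0.
  by rewrite (vsq_eq0 v0) mulmx0 !vsq0 mulr0.
have vp : 0 < vsq v by rewrite lt_def v0 vsq_ge0.
pose c : C := ((vnorm v)^-1)%:C.
have h : vnorm (A *m (c *: v)) <= opnorm A.
  by apply: opnorm_ub; rewrite vnorm_le // vsqZ nsq_real exprVn vnorm2 mulVf // expr1n.
have : vsq (A *m (c *: v)) <= opnorm A ^+ 2.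
  by rewrite -vnorm_le //; apply: le_trans h; exact: vnorm_ge0.
rewrite -scalemxAr vsqZ nsq_real exprVn vnorm2.
by rewrite -[X in X <= _]mulrC ler_pdivrMr.
Qed.

Lemma opnorm_le m k (A : 'M[C]_(m, k)) (M : R) : 0 <= M ->
  (forall v, vsq (A *m v) <= M ^+ 2 * vsq v) -> opnorm A <= M.
Proof.
move=> M0 h; apply: ge_sup; first exact: (opnorm_has_sup A).1.
move=> _ [v /= v1 <-]; rewrite vnorm_le //; rewrite vnorm_le // expr1n in v1.
apply: le_trans (h v) _; rewrite -[leRHS]mulr1.
by apply: ler_wpM2l => //; exact: sqr_ge0.
Qed.
Lemma opnorm_ge0 m k (A : 'M[C]_(m, k)) : 0 <= opnorm A.
Proof.
apply: le_trans (vnorm_ge0 (A *m 0)) (opnorm_ub _ _).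
by rewrite vnorm_le // vsq0 expr1n.
Qed.
Lemma contr_adj m (A : 'M[C]_m) (M : R) : (forall v, vsq (A *m v) <= M * vsq v) ->
  forall v, vsq (adjmx A *m v) <= M * vsq v.
Proof.
move=> h v; set w := adjmx A *m v.
have e : vsq w = cRe (vdot (A *m w) v) by rewrite vdot_adj -vsqE.
have := cRe_le_nsq (vdot (A *m w) v); rewrite -e => h1.
have h2 := le_trans h1 (vdot_CS _ _).
have h3 : vsq w ^+ 2 <= vsq w * (M * vsq v).
  apply: le_trans h2 _; rewrite mulrCA mulrA ler_wpM2r ?vsq_ge0 //; exact: h.
(* Division by [vsq w] fails here. What remains is [0 <= M * vsq v], which follows from the
   hypothesis applied to [v] itself, whatever the sign of [M]. *)
have [w0|w0] := eqVneq (vsq w) 0.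
  rewrite w0; have := h w; have := vsq_ge0 (A *m w).
  have [->|v0] := eqVneq (vsq v) 0; first by rewrite mulr0.
  have vp : 0 < vsq v by rewrite lt_def v0 vsq_ge0.
  have : vsq (A *m v) <= M * vsq v by exact: h.
  by move=> a _ _; apply: le_trans a; exact: vsq_ge0.
by rewrite expr2 ler_pM2l // lt_def w0 vsq_ge0 in h3.
Qed.
(** In [|A^* A v - v|^2 = |A^* A v|^2 + |v|^2 - 2 |A v|^2] the first term is at most [|A v|^2]
    because [A^*] is contractive too, so the right side is at most 0. *)
Lemma contr_isom m (A : 'M[C]_m) v : (forall w, vsq (A *m w) <= vsq w) ->
  vsq (A *m v) = vsq v -> adjmx A *m (A *m v) = v.
Proof.
move=> h e; apply/eqP; rewrite -subr_eq0; apply/eqP/vsq_eq0.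
apply/eqP; rewrite eq_le vsq_ge0 andbT vsqB -vdot_adjr -vsqE.
have h' : vsq (adjmx A *m (A *m v)) <= 1 * vsq (A *m v).
  by apply: contr_adj => w; rewrite mul1r.
lra.
Qed.

Lemma sval_le m j (A : 'M[C]_m) B : (\rank B <= j)%N -> Defs.sval j A <= opnorm (A - B).
Proof.
move=> rB; apply: ge_inf; last by exists B.
by exists 0 => _ [B' _ <-]; exact: opnorm_ge0.
Qed.
Lemma sval_le_opnorm m j (A : 'M[C]_m) : Defs.sval j A <= opnorm A.
Proof. by rewrite -[in leRHS](subr0 A); apply: sval_le; rewrite mxrank0. Qed.
(** A matrix [B] of rank at most [j < m] kills a nonzero vector, and there [A - B] acts as the
    isometry [A]. *)
Lemma sval_unitary m j (A : 'M[C]_m) : adjmx A *m A = 1%:M -> (j < m)%N -> Defs.sval j A = 1.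
Proof.
move=> uA jm; have e v : vsq (A *m v) = vsq v.
  by rewrite !vsqE vdot_adj mulmxA uA mul1mx.
apply/eqP; rewrite eq_le; apply/andP; split.
  apply: le_trans (sval_le_opnorm j A) _; apply: opnorm_le => // v.
  by rewrite e expr1n mul1r.
apply: lb_le_inf; first by exists (opnorm (A - 0)); exists 0 => //=; rewrite mxrank0.
move=> _ [B /= rB <-].
have : kermx B^T != 0.
  by rewrite -mxrank_eq0 mxrank_ker mxrank_tr subn_eq0 -ltnNge (leq_ltn_trans rB).
case/rowV0Pn => r /sub_kermxP r0 rn0.
have Bv : B *m r^T = 0 by rewrite -[B]trmxK -trmx_mul r0 trmx0.
have vn0 : r^T != 0 by rewrite -[0]trmx0 (inj_eq (can_inj (@trmxK _ _ _))).
have vp : 0 < vsq r^T.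
  by rewrite lt_def vsq_ge0 andbT; apply: contraNN vn0 => /eqP /vsq_eq0 ->.
have := opnorm_ge (A - B) r^T; rewrite mulmxBl Bv subr0 e.
rewrite -[X in X <= _]mul1r ler_pM2r // => h.
by rewrite -(ler_sqr (x := 1)) ?nnegrE ?opnorm_ge0 // expr1n.
Qed.
(** Subtracting from [A] the operator [w |-> <w, v> A v] leaves a matrix that kills [v], hence one
    of rank at most [m.-1]; the subtracted operator has norm [|A v|]. *)
Lemma sval_small m (A : 'M[C]_m) (v : 'cV[C]_m) (a : R) : 0 <= a -> vsq v = 1 ->
  vsq (A *m v) <= a ^+ 2 -> Defs.sval m.-1 A <= a.
Proof.
move=> a0 v1 Av; pose vt : 'rV[C]_m := (map_mx (@cconj R) v)^T.
have vtE (w : 'cV[C]_m) : vt *m w = (vdot w v)%:M.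
  apply/matrixP => i j; rewrite !ord1 !mxE eqxx mulr1n; apply: eq_bigr => k _.
  by rewrite !mxE mulrC.
have rB : (\rank (A *m (1%:M - v *m vt)) <= m.-1)%N.
  apply: leq_trans (mxrankM_maxr _ _) _.
  rewrite -ltnS prednK; last first.
    by case: (m) v v1 {vt vtE Av A} => // v; rewrite /vsq big_ord0 => /eqP; rewrite eq_sym oner_eq0.
  rewrite ltn_neqAle rank_leq_row andbT -/(row_free _).
  apply/negP => /row_free_inj /(_ vt 0) h.
  have : vt *m (1%:M - v *m vt) = 0.
    by rewrite mulmxBr mulmx1 mulmxA vtE vdotvv v1 mul1mx subrr.
  rewrite -(mul0mx _ (1%:M - v *m vt)) => /h vt0.
  have := vtE v; rewrite vt0 mul0mx vdotvv v1 => /matrixP /(_ 0 0).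
  by rewrite !mxE eqxx mulr1n => /eqP; rewrite eq_sym oner_eq0.
apply: le_trans (sval_le A rB) _; apply: opnorm_le => // w.
have -> : (A - A *m (1%:M - v *m vt)) *m w = vdot w v *: (A *m v).
  rewrite mulmxBr mulmx1 opprB addrC subrK -!mulmxA vtE.
  by rewrite scalar_mxC mul_scalar_mx -scalemxAr.
rewrite vsqZ mulrC; apply: ler_pM => //; rewrite ?vsq_ge0 ?nsq_ge0 //.
by apply: le_trans (vdot_CS _ _) _; rewrite v1 mulr1.
Qed.

End Vectors.

(** * Vector-valued [L^2], matrix-valued [L^infty], orthogonal projections *)

Section FunctionSpaces.
Variable R : realType.
Local Notation D := (@circD R).
Local Notation C := (complex R).

Definition sLinf (b : R -> C) : Prop := cmeas b /\ exists M : R, aeD (fun t => nsq (b t) <= M).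

Lemma sLinf_cst c : sLinf (fun=> c).
Proof. by split; [exact: cmeas_cst|exists (nsq c); apply: aeDT]. Qed.
Lemma sLinfD a b : sLinf a -> sLinf b -> sLinf (fun t => a t + b t).
Proof.
move=> [ma [M hM]] [mb [N hN]]; split; first exact: cmeasD.
exists (2 * M + 2 * N); apply: aeDS2 hM hN => t _ h1 h2.
by apply: le_trans (nsqD_le _ _) _; lra.
Qed.
Lemma sLinfM a b : sLinf a -> sLinf b -> sLinf (fun t => a t * b t).
Proof.
move=> [ma [M hM]] [mb [N hN]]; split; first exact: cmeasM.
exists (M * N); apply: aeDS2 hM hN => t _ h1 h2.
by rewrite nsqM ler_pM // nsq_ge0.
Qed.
Lemma sLinfN a : sLinf a -> sLinf (fun t => - a t).
Proof. by move=> /(sLinfM (sLinf_cst (-1))); under eq_fun do rewrite mulN1r. Qed.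
Lemma sLinfB a b : sLinf a -> sLinf b -> sLinf (fun t => a t - b t).
Proof. by move=> ha hb; apply: sLinfD => //; exact: sLinfN. Qed.
Lemma sLinf_conj a : sLinf a -> sLinf (fun t => cconj (a t)).
Proof.
move=> [ma [M hM]]; split; first exact: cmeas_conj.
by exists M; under eq_fun do rewrite nsq_conj.
Qed.
Lemma sLinf_ez k : sLinf (@ez R k).
Proof. by split; [exact: cmeas_ez|exists 1; apply: aeDT => t _; rewrite nsq_ez]. Qed.
Lemma sLinf_sum (I : Type) (r : seq I) (P : pred I) (F : I -> R -> C) :
  (forall i, sLinf (F i)) -> sLinf (fun t => \sum_(i <- r | P i) F i t).
Proof.
move=> hF; elim: r => [|i r IH].
  by under eq_fun do rewrite big_nil; exact: sLinf_cst.
under eq_fun do rewrite big_cons.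
by case: (P i) => //; exact: sLinfD.
Qed.
Lemma sLinf_sL2 b : sLinf b -> sL2 b.
Proof.
move=> [mb [M hM]]; have := sL2_bM mb hM (sL2_cst 1).
by under eq_fun do rewrite mulr1.
Qed.
Lemma sLinfM_sL2 b f : sLinf b -> sL2 f -> sL2 (fun t => b t * f t).
Proof. by move=> [mb [M hM]]; exact: (sL2_bM mb hM). Qed.

(** The infimum in [esssupD] is attained: the bounds [M + 1 / k.+1] hold off one common null set. *)
Lemma esssup_leP (g : R -> R) (M : R) : (esssupD g <= M%:E)%E <-> aeD (fun t => g t <= M).
Proof.
split=> h; last by apply: ereal_inf_lbound; apply: aeDS h => t _; rewrite lee_fin.
have : aeD (fun t => forall k : nat, g t <= M + k.+1%:R^-1).
  apply: aeD_nat => k.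
  have : (esssupD g < (M + k.+1%:R^-1)%:E)%E.
    by apply: le_lt_trans h _; rewrite lte_fin ltrDl invr_gt0.
  move/ereal_inf_lt => [y hy ltM].
  by apply: aeDS hy => t _ h1; rewrite -lee_fin; apply: le_trans h1 (ltW ltM).
apply: aeDS => t _ hk; apply/ler_addgt0Pr => e e0.
pose k := Num.truncn e^-1; apply: le_trans (hk k) _; rewrite lerD2l.
by rewrite invf_ple ?posrE ?ltr0Sn //; apply: ltW; apply: lt_le_trans (truncnS_gt _) _.
Qed.

Lemma LinfP m (F : R -> 'M[C]_m) : Linf F <-> forall i j, sLinf (fun t => F t i j).
Proof.
split=> [[mF hF] i j|hF]; last split.
- split; first exact: mF.
  have [M hM] : exists M : R, (esssupD (fun t => opnorm (F t)) <= M%:E)%E.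
    move: hF; case: (esssupD _) => [r _|//|_]; first by exists r.
    by exists 0; rewrite leNye.
  exists (M ^+ 2); move/esssup_leP: hM; apply: aeDS => t _ h.
  have := opnorm_ge (F t) (delta_mx j 0); rewrite -colE.
  have -> : vsq (delta_mx j 0 : 'cV[C]_m) = 1.
    rewrite /vsq (bigD1 j) //= mxE !eqxx nsq1 big1 ?addr0 // => k kj.
    by rewrite mxE (negbTE kj) nsq0.
  rewrite mulr1 => h1; have := nsq_le_vsq (col j (F t)) i; rewrite mxE => h2.
  apply: le_trans h2 (le_trans h1 _); rewrite ler_sqr ?nnegrE ?opnorm_ge0 //.
  exact: le_trans (opnorm_ge0 _) h.
- by move=> i j; have [] := hF i j.
- have /choice [M hM] : forall i, exists M : 'I_m -> R, forall j, aeD (fun t => nsq (F t i j) <= M j).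
    move=> i; have /choice [M hM] : forall j, exists M : R, aeD (fun t => nsq (F t i j) <= M).
      by move=> j; have [] := hF i j.
    by exists M.
  pose K := \sum_i \sum_j M i j.
  have : (esssupD (fun t => opnorm (F t)) <= (K + 1)%:E)%E; last by move/le_lt_trans; apply; rewrite ltry.
  apply/esssup_leP.
  have : aeD (fun t => forall i j, nsq (F t i j) <= M i j).
    by apply: aeD_fin => i; apply: aeD_fin => j; exact: hM.
  apply: aeDS => t _ h.
  have fK : frob (F t) <= K by apply: ler_sum => i _; apply: ler_sum.
  have f0 := frob_ge0 (F t).
  apply: opnorm_le => [|v]; first lra.
  apply: le_trans (vsq_mulmx _ _) _; apply: ler_wpM2r; [exact: vsq_ge0|nra].
Qed.

Lemma Linf_mulmx m (F G : R -> 'M[C]_m) : Linf F -> Linf G -> Linf (fun t => F t *m G t).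
Proof.
move=> /LinfP hF /LinfP hG; apply/LinfP => i j; under eq_fun do rewrite mxE.
by apply: sLinf_sum => k; exact: sLinfM.
Qed.
Lemma Linf_add m (F G : R -> 'M[C]_m) : Linf F -> Linf G -> Linf (fun t => F t + G t).
Proof.
move=> /LinfP hF /LinfP hG; apply/LinfP => i j; under eq_fun do rewrite mxE.
exact: sLinfD.
Qed.
Lemma Linf_scale m (F : R -> 'M[C]_m) (a : C) : Linf F -> Linf (fun t => a *: F t).
Proof.
move=> /LinfP hF; apply/LinfP => i j; under eq_fun do rewrite mxE.
by apply: sLinfM => //; exact: sLinf_cst.
Qed.
Lemma Linf_sub m (F G : R -> 'M[C]_m) : Linf F -> Linf G -> Linf (fun t => F t - G t).
Proof.
move=> /LinfP hF /LinfP hG; apply/LinfP => i j; under eq_fun do rewrite !mxE.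
exact: sLinfB.
Qed.
Lemma Linf_adj m (F : R -> 'M[C]_m) : Linf F -> Linf (fun t => adjmx (F t)).
Proof.
move=> /LinfP hF; apply/LinfP => i j; under eq_fun do rewrite adjmxE.
exact: sLinf_conj.
Qed.
Lemma Linf_cst m (A : 'M[C]_m) : Linf (fun=> A).
Proof. by apply/LinfP => i j; exact: sLinf_cst. Qed.
Lemma Linf_bound m (F : R -> 'M[C]_m) : Linf F ->
  exists2 M : R, 0 <= M & aeD (fun t => forall v, vsq (F t *m v) <= M * vsq v).
Proof.
move=> [mF hF].
have [M hM] : exists M : R, (esssupD (fun t => opnorm (F t)) <= M%:E)%E.
  move: hF; case: (esssupD _) => [r _|//|_]; first by exists r.
  by exists 0; rewrite leNye.
exists (M ^+ 2); first exact: sqr_ge0.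
move/esssup_leP: hM; apply: aeDS => t _ h v.
apply: le_trans (opnorm_ge _ v) _; apply: ler_wpM2r; first exact: vsq_ge0.
rewrite ler_sqr ?nnegrE ?opnorm_ge0 //; exact: le_trans (opnorm_ge0 _) h.
Qed.

Lemma L2P m (f : R -> 'cV[C]_m) : L2 f <-> forall i, sL2 (fun t => f t i 0).
Proof.
have e : (fun t => ((vnorm (f t)) ^+ 2)%:E) = EFin \o (fun t => vsq (f t)).
  by apply/funext => t; rewrite vnorm2.
rewrite /L2 e; split=> [[mf hf] i|hf].
  split; first exact: mf.
  apply: rint_le (hf : rint _) _; first by apply: rmeas_nsq; exact: mf.
  by move=> t _; rewrite ger0_norm ?nsq_ge0 // nsq_le_vsq.
split=> [i|]; first by have [] := hf i.
apply: (@rint_sum R _ _ _ (fun i t => nsq (f t i 0))) => i; by have [] := hf i.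
Qed.

Section Inner.
Variable m : nat.
Local Notation V := (R -> 'cV[C]_m).
Implicit Types f g h : V.

(* [ip] is [inner] behind an opaque existence proof: this keeps unification from
   unfolding Lebesgue integrals. *)
Lemma ip_sealed : exists B : V -> V -> C, forall f g, B f g = inner f g.
Proof. by exists (@inner R m). Qed.
Definition ip : V -> V -> C := projT1 (cid ip_sealed).
Lemma ip_inner f g : ip f g = inner f g.
Proof. exact: (projT2 (cid ip_sealed)). Qed.
Lemma ipE f g : ip f g = cint (fun t => vdot (f t) (g t)).
Proof. exact: ip_inner. Qed.

Lemma L2_rint f : L2 f -> rint (fun t => vsq (f t)).
Proof.
move=> /L2P hf; apply: (@rint_sum R _ _ _ (fun i t => nsq (f t i 0))) => i; by have [] := hf i.
Qed.
Lemma L2_L1 f g : L2 f -> L2 g -> cL1 (fun t => vdot (f t) (g t)).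
Proof.
move=> /L2P hf /L2P hg.
by apply: (@cL1_sum R _ _ _ (fun i t => f t i 0 * cconj (g t i 0))) => i; exact: sL2_L1Mc.
Qed.
Lemma inner_sum f g : L2 f -> L2 g ->
  ip f g = \sum_i cint (fun t => f t i 0 * cconj (g t i 0)).
Proof. by move=> /L2P hf /L2P hg; rewrite ipE -cint_sum // => i; exact: sL2_L1Mc. Qed.

Lemma L2_lin (a : C) f g : L2 f -> L2 g -> L2 (a *: f + g).
Proof.
move=> /L2P hf /L2P hg; apply/L2P => i; under eq_fun do rewrite fctE !mxE.
by apply: sL2D => //; exact: sL2Z.
Qed.
Lemma L2_0 : L2 (0 : V).
Proof. by apply/L2P => i; under eq_fun do rewrite mxE; exact: sL2_cst. Qed.
Lemma inner_hform : hform (@L2 R m) ip.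
Proof.
split.
- exact: L2_0.
- exact: L2_lin.
- move=> a f g h hf hg hh; rewrite !ipE.
  have -> : (fun t => vdot ((a *: f + g) t) (h t)) =
     fun t => a * vdot (f t) (h t) + vdot (g t) (h t).
    by apply/funext => t; rewrite -vdotZl -vdotDl.
  have z := L2_L1 hf hh; have w := L2_L1 hg hh.
  by rewrite cintD ?cintZ //; exact: cL1Z.
- move=> f g hf hg; rewrite !ipE -cint_conj; last exact: L2_L1.
  by congr cint; apply/funext => t; exact: vdotC.
- move=> f hf; rewrite ipE cRe_cint; apply: Ri_ge0 => t _.
  by rewrite -vsqE vsq_ge0.
Qed.

Definition N2 f : R := cRe (ip f f).
Lemma N2E f : N2 f = Ri (fun t => vsq (f t)).
Proof. by rewrite /N2 ipE cRe_cint; congr Ri; apply/funext => t; rewrite vsqE. Qed.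
Lemma N2_ge0 f : 0 <= N2 f.
Proof. by rewrite N2E; apply: Ri_ge0 => t _; exact: vsq_ge0. Qed.
Lemma l2normE f : l2norm f = Num.sqrt (N2 f).
Proof.
rewrite N2E /l2norm; congr Num.sqrt; congr Ri; apply/funext => t; exact: vnorm2.
Qed.
Lemma l2norm_le f g : (l2norm f <= l2norm g) = (N2 f <= N2 g).
Proof. by rewrite !l2normE ler_sqrt // N2_ge0. Qed.

Lemma L2_vmeas f : L2 f -> forall i, cmeas (fun t => f t i 0).
Proof. by move=> /L2P hf i; have [] := hf i. Qed.
Lemma inner_ae f g h : L2 f -> L2 g -> L2 h -> aeD (fun t => f t = g t) ->
  ip f h = ip g h.
Proof.
move=> hf hg hh fg; rewrite !ipE; apply: cint_ae.
- exact: cL1_meas (L2_L1 hf hh).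
- exact: cL1_meas (L2_L1 hg hh).
- by apply: aeDS fg => t _ ->.
Qed.
Lemma N2_eq0 f : L2 f -> N2 f = 0 -> aeD (fun t => f t = 0).
Proof.
move=> hf; rewrite N2E => h.
have : aeD (fun t => vsq (f t) = 0).
  by apply: Ri_eq0 => //; [exact: L2_rint|move=> t _; exact: vsq_ge0].
by apply: aeDS => t _; exact: vsq_eq0.
Qed.
Lemma N2_ae0 f : L2 f -> aeD (fun t => f t = 0) -> N2 f = 0.
Proof.
move=> hf h; rewrite /N2 (inner_ae hf L2_0 hf h).
by rewrite (hform0l inner_hform).
Qed.

Lemma L2_sub f g : L2 f -> L2 g -> L2 (f - g).
Proof. exact: (hformBS inner_hform). Qed.
Lemma L2_add f g : L2 f -> L2 g -> L2 (f + g).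
Proof. exact: (hformDS inner_hform). Qed.

Definition shiftf (k : int) f : V := fun t => ez k t *: f t.
Definition mulf (F : R -> 'M[C]_m) f : V := fun t => F t *m f t.

Lemma L2_shift k f : L2 f -> L2 (shiftf k f).
Proof.
move=> /L2P hf; apply/L2P => i; under eq_fun do rewrite mxE.
exact: sL2_ez.
Qed.
Lemma inner_shift k f g : ip (shiftf k f) g = ip f (shiftf (- k) g).
Proof.
rewrite !ipE; congr cint; apply/funext => t.
by rewrite vdotZl vdotZr ezN cconjK.
Qed.
Lemma inner_shift2 k f g : ip (shiftf k f) (shiftf k g) = ip f g.
Proof.
rewrite !ipE; congr cint; apply/funext => t.
by rewrite vdotZl vdotZr mulrA mulcconj nsq_ez mul1r.
Qed.
Lemma N2_shift k f : N2 (shiftf k f) = N2 f.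
Proof. by rewrite /N2 inner_shift2. Qed.
Lemma shiftfD k l f : shiftf k (shiftf l f) = shiftf (k + l) f.
Proof. by apply/funext => t; rewrite /shiftf scalerA ezD. Qed.
Lemma shiftf0 f : shiftf 0 f = f.
Proof. by apply/funext => t; rewrite /shiftf ez0 scale1r. Qed.
Lemma shiftfB k f g : shiftf k (f - g) = shiftf k f - shiftf k g.
Proof. by apply/funext => t; rewrite /shiftf !fctE scalerBr. Qed.

Lemma L2_mulf F f : Linf F -> L2 f -> L2 (mulf F f).
Proof.
move=> /LinfP hF /L2P hf; apply/L2P => i; under eq_fun do rewrite mxE.
by apply: sL2_sum => j; exact: sLinfM_sL2.
Qed.
Lemma inner_mulf F f g : ip (mulf F f) g = ip f (mulf (fun t => adjmx (F t)) g).
Proof.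
by rewrite !ipE; congr cint; apply/funext => t; exact: (vdot_adj (F t) (f t) (g t)).
Qed.
Lemma mulf_lin F a f g : mulf F (a *: f + g) = a *: mulf F f + mulf F g.
Proof. by apply/funext => t; rewrite /mulf !fctE mulmxDr scalemxAr. Qed.
Lemma mulf_shift F k f : mulf F (shiftf k f) = shiftf k (mulf F f).
Proof. by apply/funext => t; rewrite /mulf /shiftf scalemxAr. Qed.
Lemma N2_mulf_le F f (M : R) : Linf F -> L2 f ->
  aeD (fun t => forall v, vsq (F t *m v) <= M * vsq v) -> N2 (mulf F f) <= M * N2 f.
Proof.
move=> hF hf h; rewrite !N2E -RiZ; last exact: L2_rint.
apply: Ri_le_ae; first by apply: L2_rint; exact: L2_mulf.
  by apply: rintZ; exact: L2_rint.
by apply: aeDS h => t _; exact.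
Qed.

Definition cstf (c : 'cV[C]_m) : V := fun=> c.
Lemma L2_cst c : L2 (cstf c).
Proof. by apply/L2P => i; exact: sL2_cst. Qed.

Lemma L2_complete (u : nat -> V) : (forall k, L2 (u k)) -> hcauchy ip u ->
  exists (v : V) (phi : nat -> nat), [/\ L2 v, hlim ip u v, forall k, (k <= phi k)%N &
   aeD (fun t => forall i, cRe (u (phi k) t i 0) @[k --> \oo] --> cRe (v t i 0) /\
                           cIm (u (phi k) t i 0) @[k --> \oo] --> cIm (v t i 0))].
Proof.
move=> hu cu.
pose w (k : nat) (ib : 'I_m * bool) t :=
  if ib.2 then cRe (u k t ib.1 0) else cIm (u k t ib.1 0).
have mw k ib : rmeas (w k ib).
  by have [h1 h2] := L2_vmeas (hu k) ib.1; rewrite /w; case: ib.2.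
have iw k ib : rint (fun t => w k ib t ^+ 2).
  have [mf hf] := (iffLR (L2P _) (hu k)) ib.1; apply: rint_le hf _.
    by apply: rmeasX; exact: mw.
  move=> t _; rewrite ger0_norm ?sqr_ge0 // /w.
  by case: ib.2; [exact: cRe_le_nsq|exact: cIm_le_nsq].
have N2s f : L2 f -> N2 f = \sum_i (Ri (fun t => nsq (f t i 0))).
  move=> /L2P hf; rewrite N2E /vsq Ri_sum // => i; by have [] := hf i.
have [|f [phi [hf phik cf lf]]] := L2_family_complete mw iw.
  move=> e e0; have [N hN] := cu e e0; exists N => k l kN lN ib.
  apply: le_trans (hN k l kN lN).
  have h := L2_sub (hu k) (hu l); rewrite -/(N2 _) N2s // (bigD1 ib.1) //=.
  apply: (@le_trans _ _ (Ri (fun t => nsq ((u k - u l) t ib.1 0)))); last first.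
    by rewrite lerDl; apply: sumr_ge0 => i _; apply: Ri_ge0 => t _; exact: nsq_ge0.
  apply: Ri_le; first exact: rint_sqB.
    by have [] := (iffLR (L2P _) h) ib.1.
  move=> t _; rewrite !fctE !mxE /w.
  by case: ib.2; rewrite -?cReN -?cImN -?cReD -?cImD; [exact: cRe_le_nsq|exact: cIm_le_nsq].
pose v : V := fun t => \col_i Complex (f (i, true) t) (f (i, false) t).
have vE t i : v t i 0 = Complex (f (i, true) t) (f (i, false) t) by rewrite mxE.
have hv : L2 v.
  apply/L2P => i; have [m1 i1] := hf (i, true); have [m2 i2] := hf (i, false).
  under eq_fun do rewrite vE.
  by split=> //; exact: rintD.
exists v, phi; split => //.
(* There are [2 m] real components, each granted an equal share of [e]; the extra 1 covers
   [m = 0]. *)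
- move=> e e0; have [|N hN] := lf (e / (m.*2.+1)%:R); first by rewrite divr_gt0.
  exists N => k /hN h; rewrite -/(N2 _) N2s; last exact: L2_sub.
  apply: (@le_trans _ _ (\sum_(i < m) (e / (m.*2.+1)%:R + e / (m.*2.+1)%:R))).
    apply: ler_sum => i _.
    have -> : (fun t => nsq ((u k - v) t i 0)) = fun t =>
      (w k (i, true) t - f (i, true) t) ^+ 2 + (w k (i, false) t - f (i, false) t) ^+ 2.
      by apply/funext => t; rewrite !fctE !mxE /nsq !cRIE.
    have [m1 i1] := hf (i, true); have [m2 i2] := hf (i, false).
    by rewrite RiD; [apply: lerD; exact: h|exact: rint_sqB|exact: rint_sqB].
  rewrite sumr_const card_ord; set x := e / _.
  have x0 : 0 < x by rewrite divr_gt0.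
  have -> : e = x * (m.*2.+1)%:R by rewrite divfK.
  rewrite -mulr_natr -natr1 -muln2 natrM; nra.
- apply: aeDS cf => t _ h i; rewrite vE; split; [exact: (h (i, true))|exact: (h (i, false))].
Qed.

Lemma inner_complete (S : V -> Prop) : (forall f, S f -> L2 f) ->
  (forall u v, (forall k, S (u k)) -> L2 v -> hlim ip u v -> S v) -> hcomplete S ip.
Proof.
move=> SL clS u Su cu; have [k|v [phi [hv uv _ _]]] := L2_complete _ cu; first exact: SL.
by exists v => //; apply: clS uv.
Qed.

Lemma hlim_inner (u : nat -> V) v g : (forall k, L2 (u k)) -> L2 v -> L2 g ->
  hlim ip u v -> (forall k, ip (u k) g = 0) -> ip v g = 0.
Proof.
move=> hu hv hg uv u0; apply/eqP; rewrite -nsq_eq0 eq_le nsq_ge0 andbT.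
apply/ler_addgt0Pr => e e0; have [N hN] := hlim_form inner_hform hu hv hg uv e0.
by have := hN N (leqnn _); rewrite u0 sub0r nsqN add0r.
Qed.

(** The projection represents [g |-> <g, f>] on [S]. Presenting [S] as an orthogonal complement
    yields its linearity and its closedness together, and for this reason [H2tail], [maxv] and
    [shift_span] are all brought into this form. *)
Lemma proj_exists (S : V -> Prop) (P : V -> Prop) :
  (forall f, S f <-> L2 f /\ forall g, P g -> ip f g = 0) -> (forall g, P g -> L2 g) ->
  forall f, L2 f -> exists p, [/\ S p, L2 p & forall g, S g -> ip (f - p) g = 0].
Proof.
move=> SP PL f hf.
have SL g : S g -> L2 g by move=> /SP [].
have hS : hform S ip.
  apply: hform_sub inner_hform SL _ _.
    by apply/SP; split; [exact: L2_0|move=> g /PL hg; rewrite (hform0l inner_hform)].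
  move=> a u v /SP [hu Pu] /SP [hv Pv]; apply/SP; split; first exact: L2_lin.
  by move=> g Pg; rewrite (hformL inner_hform) ?Pu ?Pv ?mulr0 ?addr0 //; exact: PL.
have cS : hcomplete S ip.
  apply: inner_complete => // u v Su hv uv; apply/SP; split=> // g Pg.
  apply: hlim_inner uv _ => //; [by move=> k; exact: SL|exact: PL|].
  by move=> k; have /SP [_] := Su k; exact.
have [|g Sg|p Sp hp] := riesz (l := fun g => ip g f) (c := N2 f) hS cS.
- by move=> a u v Su Sv; rewrite (hformL inner_hform) //; exact: SL.
- by rewrite mulrC; apply: (hform_CS inner_hform) => //; exact: SL.
exists p; split=> //; first exact: SL.
move=> g Sg; have hp' := SL _ Sp; have hg := SL _ Sg.
rewrite (hformBl inner_hform) // (hformC inner_hform hg hf) (hformC inner_hform hg hp').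
by rewrite hp // subrr.
Qed.

Lemma N2_def f : N2 f = cRe (ip f f). Proof. by []. Qed.
Lemma inner_self f : L2 f -> ip f f = (N2 f)%:C.
Proof. exact: (hform_real inner_hform). Qed.
Lemma N2D f g : L2 f -> L2 g -> N2 (f + g) = N2 f + N2 g + 2 * cRe (ip f g).
Proof. exact: (hqD inner_hform). Qed.
Lemma N2B f g : L2 f -> L2 g -> N2 (f - g) = N2 f + N2 g - 2 * cRe (ip f g).
Proof. exact: (hqB inner_hform). Qed.
Lemma N2Z a f : L2 f -> N2 (a *: f) = nsq a * N2 f.
Proof. exact: (hqZ inner_hform). Qed.
Lemma N2D_le f g : L2 f -> L2 g -> N2 (f + g) <= 2 * N2 f + 2 * N2 g.
Proof. exact: (hqD_le inner_hform). Qed.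
Lemma inner_CS f g : L2 f -> L2 g -> nsq (ip f g) <= N2 f * N2 g.
Proof. exact: (hform_CS inner_hform). Qed.
Lemma hlimP u v : hlim ip u v <-> forall e : R, 0 < e ->
  exists N : nat, forall k, (N <= k)%N -> N2 (u k - v) <= e.
Proof. by []. Qed.
Lemma hcauchyP u : hcauchy ip u <-> forall e : R, 0 < e ->
  exists N : nat, forall k l, (N <= k)%N -> (N <= l)%N -> N2 (u k - u l) <= e.
Proof. by []. Qed.
Lemma N2_aeE f g : L2 f -> L2 g -> aeD (fun t => f t = g t) -> N2 f = N2 g.
Proof.
move=> hf hg h; rewrite /N2 (inner_ae hf hg hf h) (hformC inner_hform hf hg).
by rewrite (inner_ae hf hg hg h) cRe_conj.
Qed.

End Inner.
End FunctionSpaces.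

(** * Hardy spaces on the circle and products of analytic functions *)

Section HardySpaces.
Variable R : realType.
Local Notation D := (@circD R).
Local Notation C := (complex R).

Definition sH2 (f : R -> C) : Prop :=
  sL2 f /\ forall k : nat, (0 < k)%N -> cint (fun t => f t * ez k t) = 0.

Lemma H2P m (f : R -> 'cV[C]_m) : H2 f <-> forall i, sH2 (fun t => f t i 0).
Proof.
split=> [[/L2P hf cf] i|hf]; first by split=> // k k0; exact: cf.
split=> [|k k0 i]; first by apply/L2P => i; have [] := hf i.
by have [_] := hf i; apply.
Qed.

Lemma HinfP m (F : R -> 'M[C]_m) :
  Hinf F <-> forall i j, sLinf (fun t => F t i j) /\ sH2 (fun t => F t i j).
Proof.
split=> [[/LinfP hF cF] i j|hF].
  split; first exact: hF.
  by split; [exact: sLinf_sL2|move=> k k0; exact: cF].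
split=> [|k k0 i j]; first by apply/LinfP => i j; have [] := hF i j.
by have [_ [_]] := hF i j; apply.
Qed.

Lemma Hinf_Linf m (F : R -> 'M[C]_m) : Hinf F -> Linf F.
Proof. by case. Qed.

Section Scalar.
Implicit Types f g : R -> C.

Lemma sH2_L2 f : sH2 f -> sL2 f. Proof. by case. Qed.
Lemma sH2D f g : sH2 f -> sH2 g -> sH2 (fun t => f t + g t).
Proof.
move=> [hf cf] [hg cg]; split; first exact: sL2D.
move=> k k0; under eq_fun do rewrite mulrDl.
by rewrite cintD ?cf ?cg ?addr0 //; apply: cL1_ez; exact: sL2_L1.
Qed.
Lemma sH2Z c f : sH2 f -> sH2 (fun t => c * f t).
Proof.
move=> [hf cf]; split; first exact: sL2Z.
move=> k k0; under eq_fun do rewrite -mulrA.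
by rewrite cintZ ?cf ?mulr0 //; apply: cL1_ez; exact: sL2_L1.
Qed.
Lemma sH2B f g : sH2 f -> sH2 g -> sH2 (fun t => f t - g t).
Proof.
move=> hf hg; have := sH2D hf (sH2Z (-1) hg).
by under eq_fun do rewrite mulN1r.
Qed.
Lemma sH2_sum (I : Type) (r : seq I) (P : pred I) (F : I -> R -> C) :
  (forall i, sH2 (F i)) -> sH2 (fun t => \sum_(i <- r | P i) F i t).
Proof.
move=> hF; elim: r => [|i r IH].
  under eq_fun do rewrite big_nil; split; first exact: sL2_cst.
  by move=> k k0; under eq_fun do rewrite mul0r; rewrite cint_cst mul0r.
under eq_fun do rewrite big_cons.
by case: (P i) => //; exact: sH2D.
Qed.
Lemma Ri_FTC (f F : R -> R) : continuous f -> rint f ->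
  (forall x : R, is_derive x 1 F (f x)) -> Ri f = F (2 * pi) - F 0.
Proof.
move=> cf hf dF.
have itf : (@lebesgue_measure R).-integrable [set` `[0, 2 * pi[] (EFin \o f).
  by rewrite -circDE.
have cF : continuous F.
  by move=> x; apply: differentiable_continuous; apply/derivable1_diffP; have [] := dF x.
rewrite /Ri circDE (Rintegral_itv_bndo_bndc itf) /Rintegral.
rewrite (@continuous_FTC2 _ f F) ?twopi_gt0 //.
- by move=> x; apply: continuous_in_subspaceT => y _; exact: cf.
- split.
  + by move=> x _; have [] := dF x.
  + by apply: cvg_at_right_filter; exact: cF.
  + by apply: cvg_at_left_filter; exact: cF.
- by move=> x _; rewrite derive1E; have [] := dF x.
Qed.

Lemma cint_ez (k : int) : k != 0 -> cint (@ez R k) = 0.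
Proof.
have pos (n : nat) : (0 < n)%N -> cint (@ez R n) = 0.
  move=> n0; have n0' : (n%:R : R) != 0 by rewrite pnatr_eq0 -lt0n.
  have [h1 h2] : cL1 (@ez R n) by exact: sL2_L1 (sLinf_sL2 (sLinf_ez R n)).
  have cl : continuous (fun x : R => n%:R * x).
    by move=> x; apply: cvgM; [exact: cvg_cst|exact: cvg_id].
  have e2 : n%:R * (2 * pi) = 0 + (pi *+ 2) *+ n :> R.
    by rewrite add0r -[RHS]mulr_natl -[pi *+ 2]mulr_natl.
  have dl (x : R) : is_derive x 1 (fun y : R => n%:R * y) n%:R.
    have := @is_deriveZ R R R id (n%:R) x 1 1 _.
    by move=> /(_ (is_derive_id _ _)); rewrite /GRing.scale /= mulr1.
  apply: complexP; rewrite !cRIE ?cRe_cint ?cIm_cint.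
  - have c1 : continuous (fun t : R => cRe (ez n t)).
      by move=> x; apply: continuous_comp; [exact: cl|exact: continuous_cos].
    have d1 (x : R) : is_derive x 1 (fun t : R => n%:R^-1 * sin (n%:R * t)) (cRe (ez n x)).
      have ds : is_derive x 1 (sin \o (fun y : R => n%:R * y)) (cos (n%:R * x) * n%:R).
        exact: (is_derive1_comp (is_derive_sin _) (dl x)).
      have := @is_deriveZ R R R _ (n%:R^-1) x 1 _ ds.
      by rewrite /GRing.scale /= mulrCA mulVf // mulr1.
    rewrite (Ri_FTC c1 h1 d1).
    by rewrite mulr0 e2 (periodicn (@sinD2pi R)) sin0 mulr0 subrr.
  - have c1 : continuous (fun t : R => cIm (ez n t)).
      by move=> x; apply: continuous_comp; [exact: cl|exact: continuous_sin].
    have d1 (x : R) : is_derive x 1 (fun t : R => - n%:R^-1 * cos (n%:R * t)) (cIm (ez n x)).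
      have ds : is_derive x 1 (cos \o (fun y : R => n%:R * y)) (- sin (n%:R * x) * n%:R).
        exact: (is_derive1_comp (is_derive_cos _) (dl x)).
      have := @is_deriveZ R R R _ (- n%:R^-1) x 1 _ ds.
      by rewrite /GRing.scale /= mulrCA [- n%:R^-1 * _]mulNr mulVf // mulrN1 opprK.
    rewrite (Ri_FTC c1 h2 d1).
    by rewrite mulr0 e2 (periodicn (@cosD2pi R)) subrr.
case: k => n k0; first by apply: pos; rewrite lt0n.
have -> : @ez R (Negz n) = fun t => cconj (ez n.+1 t).
  by apply/funext => t; rewrite -ezN NegzE.
rewrite cint_conj ?pos ?cconj0 //; exact: sL2_L1 (sLinf_sL2 (sLinf_ez R n.+1)).
Qed.
Lemma sH2_ez (k : nat) f : sH2 f -> sH2 (fun t => ez k t * f t).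
Proof.
move=> [hf cf]; split; first exact: sL2_ez.
move=> l l0; have := cf (k + l)%N; rewrite addn_gt0 l0 orbT => /(_ isT) <-.
by congr cint; apply/funext => t; rewrite PoszD ezD; ring.
Qed.
Lemma sH2_cst (c : C) : sH2 (fun=> c).
Proof.
split; first exact: sL2_cst.
move=> k k0; rewrite cintZ; last exact: sL2_L1 (sLinf_sL2 (sLinf_ez R k)).
by rewrite cint_ez ?mulr0 // eqz_nat -lt0n.
Qed.
End Scalar.

Section Vector.
Variable m : nat.
Local Notation V := (R -> 'cV[C]_m).
Local Notation ip := (@ip R m).
Implicit Types f g u : V.
Let ipf := inner_hform R m.

Lemma inner_ez f (k : int) (i : 'I_m) : L2 f ->
  ip f (shiftf k (cstf (delta_mx i 0))) = cint (fun t => f t i 0 * ez (- k) t).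
Proof.
move=> hf; rewrite ipE; congr cint; apply/funext => t; rewrite /vdot (bigD1 i) //= big1 ?addr0.
  by rewrite !mxE !eqxx mulr1 ezN.
by move=> j ji; rewrite !mxE (negbTE ji) mulr0 cconj0 mulr0.
Qed.

(** This is the subspace [z^N H2]. *)
Definition H2tail (N : nat) f : Prop := H2 (shiftf (- N%:Z) f).

Lemma H2tailP N f : H2tail N f <-> L2 f /\ forall g,
  (exists (k : nat) (i : 'I_m), (0 < k)%N /\ g = shiftf (N%:Z - k%:Z) (cstf (delta_mx i 0))) ->
  ip f g = 0.
Proof.
have key f' (k : nat) (i : 'I_m) : L2 f' -> ip f' (shiftf (N%:Z - k%:Z) (cstf (delta_mx i 0))) =
    cint (fun t => shiftf (- N%:Z) f' t i 0 * cexp (k%:R * t)).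
  move=> hf'; rewrite inner_ez //; congr cint; apply/funext => t.
  by rewrite opprB addrC ezD mxE -[cexp _]/(ez k t); ring.
have inv f' : shiftf N%:Z (shiftf (- N%:Z) f') = f'.
  by rewrite shiftfD subrr shiftf0.
split=> [[hf cf]|[hf cf]].
  have hf2 : L2 f by rewrite -(inv f); exact: L2_shift.
  by split=> // g [k [i [k0 ->]]]; rewrite key //; exact: cf.
split; first exact: L2_shift.
by move=> k k0 i; rewrite -key //; apply: cf; exists k, i.
Qed.

Lemma H2tail0 f : H2tail 0 f <-> H2 f.
Proof. by rewrite /H2tail oppr0 shiftf0. Qed.

Lemma H2tail_proj N f : L2 f ->
  exists p, [/\ H2tail N p, L2 p & forall g, H2tail N g -> ip (f - p) g = 0].
Proof.
move=> hf; apply: proj_exists (H2tailP N) _ _ hf => g [k [i [_ ->]]].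
by apply: L2_shift; exact: L2_cst.
Qed.

Lemma H2_L2 f : H2 f -> L2 f. Proof. by case. Qed.
Lemma H2m_L2 f : H2minus f -> L2 f. Proof. by case. Qed.
Lemma H2_lin a f g : H2 f -> H2 g -> H2 (a *: f + g).
Proof.
move=> /H2P hf /H2P hg; apply/H2P => i; under eq_fun do rewrite fctE !mxE.
by apply: sH2D => //; exact: sH2Z.
Qed.
Lemma H2_0 : H2 (0 : V).
Proof. by apply/H2P => i; under eq_fun do rewrite mxE; exact: sH2_cst. Qed.
Lemma H2_cst c : H2 (cstf c : V).
Proof. by apply/H2P => i; exact: sH2_cst. Qed.
Lemma H2_form : hform (@H2 R m) ip.
Proof. exact: hform_sub ipf H2_L2 H2_0 H2_lin. Qed.
Lemma H2_sub f g : H2 f -> H2 g -> H2 (f - g).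
Proof. exact: (hformBS H2_form). Qed.
Lemma H2_scale a f : H2 f -> H2 (a *: f).
Proof. exact: (hformZS H2_form). Qed.
Lemma H2_shift (k : nat) f : H2 f -> H2 (shiftf k f).
Proof.
move=> /H2P hf; apply/H2P => i; under eq_fun do rewrite mxE.
exact: sH2_ez.
Qed.
Lemma H2_lim (u : nat -> V) v : (forall k, H2 (u k)) -> L2 v -> hlim ip u v -> H2 v.
Proof.
move=> hu hv uv; apply/H2tail0/H2tailP; split=> // g Pg.
apply: hlim_inner uv _ => //; first by move=> k; exact: H2_L2.
  by case: Pg => [k [i [_ ->]]]; apply: L2_shift; exact: L2_cst.
by move=> k; have /H2tail0/H2tailP [_] := hu k; apply.
Qed.
Lemma H2_unshift f : H2 f -> (forall i, cint (fun t => f t i 0) = 0) ->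
  H2 (shiftf (- 1) f).
Proof.
move=> /H2P hf f0; apply/H2P => i; have [h1 h2] := hf i; split.
  by under eq_fun do rewrite mxE; exact: sL2_ez.
move=> k k0.
have -> : (fun t => shiftf (-1) f t i 0 * ez k t) = fun t => f t i 0 * ez (k.-1) t.
  apply/funext => t; rewrite mxE mulrAC -ezD mulrC; congr (_ * ez _ t).
  by case: k k0 => // k _; rewrite /= -addn1 PoszD addrC addrK.
by case: k k0 => [//|[|k] _] /=; [under eq_fun do rewrite ez0 mulr1|exact: h2].
Qed.
Lemma cint_coord_shift f i : H2 f -> cint (fun t => shiftf 1 f t i 0) = 0.
Proof.
move=> /H2P hf; have [_ /(_ 1%N isT) <-] := hf i.
by congr cint; apply/funext => t; rewrite mxE mulrC.
Qed.

Lemma Pminus_exists f : L2 f -> exists p, is_Pminus f p.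
Proof.
move=> hf; have [h [/H2tail0 hh h2 fh]] := H2tail_proj 0 hf.
exists (f - h); split=> //; split.
  split; first exact: L2_sub.
  by move=> g hg; rewrite -ip_inner; apply: fh; exact/H2tail0.
suff -> : (fun t => f t - (f - h) t) = h by [].
by apply/funext => t; rewrite !fctE opprB addrC subrK.
Qed.
Lemma Pm_sealed : exists P : V -> V, forall f, L2 f -> is_Pminus f (P f).
Proof.
have /choice [P hP] : forall f, exists p, L2 f -> is_Pminus f p; last by exists P.
move=> f; have [/Pminus_exists [p hp]|nf] := pselect (L2 f); first by exists p.
by exists 0.
Qed.
Definition Pm : V -> V := projT1 (cid Pm_sealed).
Lemma PmP f : L2 f -> H2minus (Pm f) /\ H2 (f - Pm f).
Proof. by move=> hf; have [_ []] := projT2 (cid Pm_sealed) f hf. Qed.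

Lemma H2mI f : L2 f -> (forall g, H2 g -> ip f g = 0) -> H2minus f.
Proof. by move=> hf h; split=> // g hg; rewrite -ip_inner h. Qed.
Lemma H2m_orth f g : H2minus f -> H2 g -> ip f g = 0.
Proof. by move=> [_ h] hg; rewrite ip_inner h. Qed.
Lemma H2m_orthr f g : H2minus f -> H2 g -> ip g f = 0.
Proof.
by move=> hf hg; rewrite (hformC ipf (H2m_L2 hf) (H2_L2 hg)) H2m_orth // cconj0.
Qed.
Lemma PmE f p : L2 f -> H2minus p -> H2 (f - p) -> is_Pminus f p.
Proof. by []. Qed.
Lemma H2m_form : hform (@H2minus R m) ip.
Proof.
apply: hform_sub ipf H2m_L2 _ _.
  by apply: H2mI; [exact: L2_0|move=> g /H2_L2 hg; rewrite (hform0l ipf)].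
move=> a f g hf hg; have hf2 := H2m_L2 hf; have hg2 := H2m_L2 hg.
apply: H2mI; first exact: L2_lin.
by move=> h hh; rewrite (hformL ipf) ?H2m_orth ?mulr0 ?addr0 //; exact: H2_L2.
Qed.
Lemma H2m_coef f i (k : nat) : H2minus f -> cint (fun t => f t i 0 * ez (- k%:Z) t) = 0.
Proof.
move=> hf; rewrite -inner_ez; last exact: H2m_L2.
by apply: H2m_orth => //; apply: H2_shift; exact: H2_cst.
Qed.
Lemma H2m_shift (k : nat) f : H2minus f -> H2minus (shiftf (- k%:Z) f).
Proof.
move=> hf; apply: H2mI; first by apply: L2_shift; exact: H2m_L2.
by move=> g hg; rewrite inner_shift opprK; apply: H2m_orth => //; exact: H2_shift.
Qed.
Lemma H2_coef0 f : H2 f -> (forall i (k : nat), cint (fun t => f t i 0 * ez (- k%:Z) t) = 0) ->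
  aeD (fun t => f t = 0).
Proof.
move=> /H2P hf cf.
have : aeD (fun t => forall i, f t i 0 = 0).
  apply: aeD_fin => i; have [h1 h2] := hf i; apply: fourier_unique; first exact: sL2_L1.
  case=> [[|k]|k]; [|exact: h2|by rewrite NegzE; exact: cf].
  exact: (cf i 0%N).
by apply: aeDS => t _ h; apply/matrixP => i j; rewrite (ord1 j) mxE.
Qed.

(** Let [p N] be the projection of [u] onto [z^N H2]. The norms of the [p N] decrease, so they
    converge; the limit lies in every [z^N H2] and is therefore 0. Cauchy-Schwarz against [p N]
    gives a bound uniform in [f], which later disposes of the remainders left by repeated division
    by [z]. *)
Lemma shift_tail u : L2 u -> forall e : R, 0 < e -> exists N : nat, forall f, H2 f ->
  nsq (ip (shiftf N f) u) <= e * N2 f.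
Proof.
move=> hu.
have /choice [p hp] : forall N, exists p, [/\ H2tail N p, L2 p &
    forall g, H2tail N g -> ip (u - p) g = 0] by move=> N; exact: H2tail_proj.
have pT N : H2tail N (p N) by have [] := hp N.
have pL N : L2 (p N) by have [] := hp N.
have pO N g : H2tail N g -> L2 g -> ip u g = ip (p N) g.
  move=> hg hg2; have [_ _ /(_ _ hg)] := hp N.
  by rewrite (hformBl ipf) // => /eqP; rewrite subr_eq0 => /eqP.
have tailS N M f : (N <= M)%N -> H2tail M f -> H2tail N f.
  move=> NM /(H2_shift (M - N)); rewrite shiftfD /H2tail; congr (H2 (shiftf _ f)).
  by rewrite -subzn // addrAC subrr add0r.
have pyth N M : (N <= M)%N -> N2 (p N - p M) = N2 (p N) - N2 (p M).
  move=> NM; rewrite /N2 (hqB ipf) //.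
  have h1 := pO M _ (pT M) (pL M); have h2 := pO N _ (tailS _ _ _ NM (pT M)) (pL M).
  by rewrite -h2 h1; ring.
have mono N M : (N <= M)%N -> N2 (p M) <= N2 (p N).
  by move=> NM; rewrite -subr_ge0 -pyth // N2_ge0.
have [|v [phi [hv pv phik _]]] := L2_complete pL.
  move=> e e0; pose I := inf (range (fun N => N2 (p N))).
  have hI : has_inf (range (fun N => N2 (p N))).
    split; first by exists (N2 (p 0%N)); exists 0%N.
    by exists 0 => _ [N _ <-]; exact: N2_ge0.
  have [_ [N _ <-] hN] := inf_adherent e0 hI.
  have Ile k : I <= N2 (p k) by apply: (ge_inf hI.2); exists k.
  exists N => k l kN lN; rewrite -/(N2 _); have := mono _ _ kN; have := mono _ _ lN => h1 h2.
  have Ik := Ile k; have Il := Ile l.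
  have [kl|lk] := leqP k l; first by rewrite pyth //; rewrite -/I in hN; lra.
  rewrite -opprB /N2 (hqN ipf); last exact: L2_sub.
  by rewrite -/(N2 _) pyth ?(ltnW lk) //; rewrite -/I in hN; lra.
have v0 : aeD (fun t => v t = 0).
  have vT N : H2tail N v.
    apply/H2tailP; split=> // g Pg.
    have hg : L2 g by case: Pg => [k [i [_ ->]]]; apply: L2_shift; exact: L2_cst.
    have cvN : hlim ip (fun k => p (k + N)%N) v.
      move=> e e0; have [N' hN'] := pv e e0; exists N' => k kN; apply: hN'.
      by rewrite (leq_trans kN) // leq_addr.
    apply: hlim_inner cvN _ => // k.
    have /(tailS N) := pT (k + N)%N; rewrite leq_addl => /(_ isT) /H2tailP [_]; exact.
  have vH : H2 v by apply/H2tail0.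
  apply: H2_coef0 => // i k; rewrite -inner_ez //.
  have /H2tailP [_] := vT k.+1; apply; exists 1%N, i; split=> //.
  by congr shiftf; rewrite -[k.+1]addn1 PoszD addrK.
have Nv := N2_ae0 hv v0.
move=> e e0; have [|N hN] := pv (e / 2); first lra.
exists N => f hf; have hf2 := H2_L2 hf.
have fT : H2tail N (shiftf N f) by rewrite /H2tail shiftfD addNr shiftf0.
have hfs := L2_shift N hf2.
rewrite (hformC ipf hu hfs) nsq_conj (pO N) //.
apply: le_trans (hform_CS ipf _ _) _ => //; rewrite inner_shift2 -/(N2 f) -/(N2 (p N)).
rewrite ler_wpM2r ?N2_ge0 //.
have := hN N (leqnn _); rewrite -/(N2 _) => h.
have := hqD_le ipf (L2_sub (pL N) hv) hv; rewrite subrK -/(N2 _) -/(N2 _) -/(N2 v) Nv; lra.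
Qed.

End Vector.

Section Products.
Implicit Types f g : R -> C.

(** The product is only integrable, so its coefficient is read as the inner product of [f] with the
    conjugate of [g * ez k]. That conjugate has no coefficient of nonnegative index, hence agrees
    almost everywhere with its projection to [H2minus], which is orthogonal to [f]. *)
Lemma sH2_prod f g (k : nat) : sH2 f -> sH2 g -> (0 < k)%N ->
  cint (fun t => f t * g t * ez k t) = 0.
Proof.
move=> hf hg k0.
pose F : R -> 'cV[C]_1 := fun t => const_mx (f t).
pose G : R -> 'cV[C]_1 := fun t => const_mx (cconj (g t * ez k t)).
have hF : H2 F by apply/H2P => i; under eq_fun do rewrite mxE.
have sg : sL2 (fun t => g t * ez k t).
  by under eq_fun do rewrite mulrC; apply: sL2_ez; exact: sH2_L2.
have hG : L2 G by apply/L2P => i; under eq_fun do rewrite mxE; exact: sL2_conj.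
have [hm hp] := PmP hG.
have h0 : aeD (fun t => (G - Pm G) t = 0).
  apply: H2_coef0 => // i l.
  have z1 : cL1 (fun t => G t i 0 * ez (- l%:Z) t).
    by apply: cL1_ez; apply: sL2_L1; exact: (iffLR (L2P _) hG).
  have z2 : cL1 (fun t => Pm G t i 0 * ez (- l%:Z) t).
    by apply: cL1_ez; apply: sL2_L1; exact: (iffLR (L2P _) (H2m_L2 hm)).
  have -> : (fun t => (G - Pm G) t i 0 * ez (- l%:Z) t) = fun t =>
      G t i 0 * ez (- l%:Z) t - Pm G t i 0 * ez (- l%:Z) t.
    by apply/funext => t; rewrite -mulrBl; congr (_ * _); rewrite !mxE.
  rewrite cintB ?(H2m_coef i l hm) ?subr0 //.
  have -> : (fun t => G t i 0 * ez (- l%:Z) t) = fun t => cconj (g t * ez (k + l)%N t).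
    by apply/funext => t; rewrite mxE ezN -cconjM PoszD ezD mulrA.
  have [sg2 cg] := hg; rewrite cint_conj ?cg ?cconj0 ?addn_gt0 ?k0 //.
  by apply: cL1_ez; exact: sL2_L1.
have FG : ip F G = ip F (Pm G).
  rewrite (hformC (inner_hform R 1) hG (H2_L2 hF)).
  rewrite (hformC (inner_hform R 1) (H2m_L2 hm) (H2_L2 hF)); congr cconj.
  apply: inner_ae => //; [exact: H2m_L2|exact: H2_L2|].
  by apply: aeDS h0 => t _ /eqP; rewrite subr_eq0 => /eqP.
have -> : cint (fun t => f t * g t * ez k t) = ip F G.
  rewrite ipE; congr cint; apply/funext => t; rewrite /vdot big_ord1 !mxE cconjK; ring.
by rewrite FG H2m_orthr.
Qed.

Lemma sH2M f g : sLinf f -> sH2 f -> sH2 g -> sH2 (fun t => f t * g t).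
Proof.
move=> bf hf hg; split; first by apply: sLinfM_sL2 => //; exact: sH2_L2.
by move=> k k0; exact: sH2_prod.
Qed.

(** With [a] the mean of [f], the function [f - a] is divisible by [z]; [sH2_prod] with [k = 1] then
    says that [(f - a) * g] has integral 0. *)
Lemma sH2_prod0 f g : sH2 f -> sH2 g ->
  cint (fun t => f t * g t) * (2 * pi)%:C = cint f * cint g.
Proof.
move=> hf hg; pose a := cint f / (2 * pi)%:C.
have p0 : (2 * pi)%:C != 0 :> C by rewrite -nsq_eq0 nsq_real expf_neq0 // gt_eqF // twopi_gt0.
have ha : cint (fun t => f t - a) = 0.
  rewrite cintB ?cint_cst ?divfK ?subrr //; last exact: cL1_cst.
  exact: sL2_L1 (sH2_L2 hf).
pose F : R -> 'cV[C]_1 := fun t => const_mx (f t - a).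
have hF : H2 F.
  by apply/H2P => i; under eq_fun do rewrite mxE; apply: sH2B => //; exact: sH2_cst.
have hF1 : H2 (shiftf (-1) F).
  by apply: H2_unshift => // i; rewrite -[RHS]ha; congr cint; apply/funext => t; rewrite mxE.
have h1 : sH2 (fun t => ez (- 1) t * (f t - a)).
  by have /H2P /(_ ord0) := hF1; under eq_fun do rewrite !mxE.
have := sH2_prod h1 hg (ltnSn 0).
have -> : (fun t => ez (- 1) t * (f t - a) * g t * ez 1%N t) = fun t => f t * g t - a * g t.
  by apply/funext => t; rewrite mulrC mulrA mulrA ezK mul1r; ring.
have z : cL1 g by exact: sL2_L1 (sH2_L2 hg).
rewrite cintB ?cintZ //; [|by apply: sL2_L1M; exact: sH2_L2|exact: cL1Z].
by move=> /eqP; rewrite subr_eq0 => /eqP ->; rewrite mulrAC divfK.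
Qed.

Lemma H2_mulf m (F : R -> 'M[C]_m) (f : R -> 'cV[C]_m) : Hinf F -> H2 f -> H2 (mulf F f).
Proof.
move=> /HinfP hF /H2P hf; apply/H2P => i; under eq_fun do rewrite mxE.
by apply: sH2_sum => j; have [h1 h2] := hF i j; exact: sH2M.
Qed.

End Products.
End HardySpaces.

(** * The Hankel operator, its maximizing vectors and the gap *)

Section HankelForm.
Variable R : realType.
Local Notation D := (@circD R).
Local Notation C := (complex R).
Variable n : nat.
Local Notation V := (R -> 'cV[C]_n).
Local Notation ip := (@ip R n).
Implicit Types f g h : V.
Let ipf := inner_hform R n.
Variable Phi : R -> 'M[C]_n.
Hypothesis hPhi : Linf Phi.

Definition Hk f : V := Pm (mulf Phi f).

Lemma HkP f : H2 f -> H2minus (Hk f) /\ H2 (mulf Phi f - Hk f).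
Proof. by move=> /H2_L2 hf; apply: PmP; exact: L2_mulf. Qed.
Lemma Hk_H2m f : H2 f -> H2minus (Hk f).
Proof. by move=> /HkP []. Qed.
Lemma Hk_L2 f : H2 f -> L2 (Hk f).
Proof. by move=> /Hk_H2m /H2m_L2. Qed.
Lemma Hk_hankel f : H2 f -> is_Hankel Phi f (Hk f).
Proof.
move=> hf; have [h1 h2] := HkP hf; split=> //.
by apply: PmE => //; apply: L2_mulf => //; exact: H2_L2.
Qed.
Lemma Hk_inner f g : H2 f -> H2minus g -> ip (mulf Phi f) g = ip (Hk f) g.
Proof.
move=> hf hg; have [h1 h2] := HkP hf.
have hp : L2 (mulf Phi f) by apply: L2_mulf; [assumption|exact: H2_L2].
apply/eqP; rewrite -subr_eq0 -(hformBl ipf hp (Hk_L2 hf) (H2m_L2 hg)).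
by rewrite H2m_orthr.
Qed.
Lemma Hk_lin a f g h : H2 f -> H2 g -> H2minus h ->
  ip (Hk (a *: f + g)) h = a * ip (Hk f) h + ip (Hk g) h.
Proof.
move=> hf hg hh; have hL := H2m_L2 hh.
rewrite -!Hk_inner //; last exact: H2_lin.
by rewrite mulf_lin (hformL ipf) //; apply: L2_mulf => //; exact: H2_L2.
Qed.
Lemma Hk_shift (k : nat) f g : H2 f -> H2minus g ->
  ip (Hk (shiftf k f)) g = ip (shiftf k (Hk f)) g.
Proof.
move=> hf hg; rewrite -Hk_inner //; last exact: H2_shift.
by rewrite mulf_shift !inner_shift; apply: Hk_inner => //; exact: H2m_shift.
Qed.
(** Since [H (z f)] is the projection of [z H f], one has [|H (z f)|^2 = <z H f, H (z f)>], and
    Cauchy-Schwarz applies. *)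
Lemma N2_Hk_shift f : H2 f -> N2 (Hk (shiftf 1%N f)) <= N2 (Hk f).
Proof.
move=> hf; have hz := H2_shift 1 hf; have hm := Hk_H2m hz.
have e : ip (Hk (shiftf 1%N f)) (Hk (shiftf 1%N f)) =
    ip (shiftf 1%N (Hk f)) (Hk (shiftf 1%N f)) by exact: Hk_shift.
have := inner_CS (L2_shift 1%N (Hk_L2 hf)) (Hk_L2 hz).
rewrite -e N2_shift => h.
have := le_trans (cRe_le_nsq _) h; rewrite -N2_def expr2.
have [->|x0] := eqVneq (N2 (Hk (shiftf 1%N f))) 0; first by rewrite N2_ge0.
by rewrite ler_pM2r // lt_def x0 N2_ge0.
Qed.
Lemma Hk_sub (F : R -> 'M[C]_n) f g : Hinf F -> H2 f -> H2minus g ->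
  ip (mulf (fun t => Phi t - F t) f) g = ip (Hk f) g.
Proof.
move=> hF hf hg; have hL := H2m_L2 hg.
have -> : mulf (fun t => Phi t - F t) f = mulf Phi f - mulf F f.
  by apply/funext => t; rewrite /mulf mulmxBl.
have h2 : H2 (mulf F f) by exact: H2_mulf.
have h1 : L2 (mulf Phi f) by apply: L2_mulf; [assumption|exact: H2_L2].
by rewrite (hformBl ipf h1 (H2_L2 h2) hL) Hk_inner // (H2m_orthr hg h2) subr0.
Qed.

(** For [W = 1] this is the defect form, with diagonal [|f|^2 - |H f|^2]; for a general weight its
    nonnegativity is the solvability condition of the weighted Nehari theorem. *)
Definition hkform (W : R -> 'M[C]_n) f g : C := ip (mulf W f) g - ip (Hk f) (Hk g).

Lemma hkform_hform W : Linf W -> aeD (fun t => adjmx (W t) = W t) ->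
  (forall f, H2 f -> 0 <= cRe (hkform W f f)) -> hform (@H2 R n) (hkform W).
Proof.
move=> hW aW pos; split.
- exact: H2_0.
- exact: H2_lin.
- move=> a f g h hf hg hh; rewrite /hkform Hk_lin //; last exact: Hk_H2m.
  rewrite mulf_lin (hformL ipf); [ring| | |exact: H2_L2];
    by apply: L2_mulf; [assumption|exact: H2_L2].
- move=> f g hf hg; have hfL := H2_L2 hf; have hgL := H2_L2 hg.
  rewrite /hkform cconjB -(hformC ipf (L2_mulf hW hfL) hgL).
  rewrite -(hformC ipf (Hk_L2 hf) (Hk_L2 hg)); congr (_ - _); rewrite inner_mulf.
  have z1 : L2 (mulf (fun t => adjmx (W t)) f) by exact: (L2_mulf (Linf_adj hW) hfL).
  have z2 : L2 (mulf W f) by exact: L2_mulf.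
  rewrite (hformC ipf z1 hgL) (hformC ipf z2 hgL); congr cconj.
  by apply: inner_ae => //; apply: aeDS aW => t _ e; rewrite /mulf e.
- by move=> f hf; exact: pos.
Qed.

Lemma hkform_shift W f g (k : nat) : H2 f -> H2 g ->
  hkform W (shiftf k f) g = ip (shiftf k (mulf W f)) g - ip (shiftf k (Hk f)) (Hk g).
Proof. by move=> hf hg; rewrite /hkform mulf_shift Hk_shift //; exact: Hk_H2m. Qed.

(** The weighted part is invariant under multiplication by [z] and the Hankel part decreases. This
    bounds the remainders in the division by [z]. *)
Lemma hkform_expansive W f : H2 f ->
  cRe (hkform W f f) <= cRe (hkform W (shiftf 1%N f) (shiftf 1%N f)).
Proof.
move=> hf; rewrite /hkform mulf_shift inner_shift2 !(cReD, cReN) lerD2l lerN2.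
exact: N2_Hk_shift.
Qed.

Definition idf : R -> 'M[C]_n := fun=> 1%:M.
Lemma mulf1 f : mulf idf f = f.
Proof. by apply/funext => t; rewrite /mulf mul1mx. Qed.
Lemma hkform1E f : cRe (hkform idf f f) = N2 f - N2 (Hk f).
Proof. by rewrite /hkform mulf1 cReD cReN -!N2_def. Qed.
Lemma adj1 m : adjmx (1%:M : 'M[C]_m) = 1%:M.
Proof.
apply/matrixP => i j; rewrite adjmxE !mxE eq_sym.
by case: eqP => _; rewrite ?mulr1n ?mulr0n ?cconj1 ?cconj0.
Qed.

Hypothesis contr : hankel_norm_le Phi 1.

Lemma contrP f : H2 f -> N2 (Hk f) <= N2 f.
Proof. by move=> hf; have := contr (Hk_hankel hf); rewrite mul1r l2norm_le. Qed.

Lemma hkform1 : hform (@H2 R n) (hkform idf).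
Proof.
apply: hkform_hform; first exact: Linf_cst.
  by apply: aeDT => t _; exact: adj1.
by move=> f hf; rewrite hkform1E subr_ge0 contrP.
Qed.

Definition maxv f : Prop := H2 f /\ N2 (Hk f) = N2 f.

Lemma maxv_form0 f g : maxv f -> H2 g -> hkform idf f g = 0.
Proof.
move=> [hf ef] hg; apply: (hform_CS0 hkform1) => //.
by rewrite hkform1E ef subrr.
Qed.
(** Maximizing vectors are the null vectors of the semidefinite defect form, that is, the elements
    of [H2] orthogonal to every [h - Phi^* H h]. Together with the conditions defining [H2], this
    gives the form that [proj_exists] requires. *)
Lemma maxvP f : maxv f <-> L2 f /\ forall g,
  ((exists (k : nat) (i : 'I_n), (0 < k)%N /\ g = shiftf (0%N%:Z - k%:Z) (cstf (delta_mx i 0))) \/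
   (exists2 h, H2 h & g = h - mulf (fun t => adjmx (Phi t)) (Hk h))) -> ip f g = 0.
Proof.
have adjf f' h : L2 f' -> H2 f' -> H2 h ->
    ip f' (h - mulf (fun t => adjmx (Phi t)) (Hk h)) = hkform idf f' h.
  move=> hf2 hf hh; rewrite (hformBr ipf) //; last 2 first.
  - exact: H2_L2.
  - by exact: (L2_mulf (Linf_adj hPhi) (Hk_L2 hh)).
  rewrite /hkform mulf1 -inner_mulf Hk_inner //; exact: Hk_H2m.
split=> [mf|[hf cf]].
  have [hf ef] := mf; split; first exact: H2_L2.
  move=> g [[k [i [k0 ->]]]|[h hh ->]].
    by have /H2tail0/H2tailP [_] := hf; apply; exists k, i.
  by rewrite adjf //; [exact: maxv_form0|exact: H2_L2].
have hf2 : H2 f by apply/H2tail0/H2tailP; split=> // g Pg; apply: cf; left.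
split=> //; have : ip f (f - mulf (fun t => adjmx (Phi t)) (Hk f)) = 0.
  by apply: cf; right; exists f.
rewrite adjf // => /(congr1 (@cRe R)); rewrite hkform1E => h.
by apply/esym/eqP; rewrite -subr_eq0 h.
Qed.

Lemma maxv_proj f : L2 f ->
  exists p, [/\ maxv p, L2 p & forall g, maxv g -> ip (f - p) g = 0].
Proof.
move=> hf; apply: proj_exists maxvP _ _ hf => g [[k [i [_ ->]]]|[h hh ->]].
  by apply: L2_shift; exact: L2_cst.
apply: L2_sub; first exact: H2_L2.
by exact: (L2_mulf (Linf_adj hPhi) (Hk_L2 hh)).
Qed.

(** In [|H f| <= |(Phi - F) f| <= |f| = |H f|] all norms agree, so [(Phi - F) f] equals its
    projection [H f]. The pointwise inequality between [H f] and [f] then has equal integrals on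
    both sides, hence is an equality almost everywhere, and [contr_isom] applies. *)
Lemma maxv_contr (F : R -> 'M[C]_n) f : Hinf F ->
  aeD (fun t => forall v, vsq ((Phi t - F t) *m v) <= vsq v) -> maxv f ->
  aeD (fun t => (Phi t - F t) *m f t = Hk f t /\ adjmx (Phi t - F t) *m Hk f t = f t).
Proof.
move=> hF cF [hf ef]; set Psi := fun t => Phi t - F t.
have hPsi : Linf Psi by exact: (Linf_sub hPhi (Hinf_Linf hF)).
have hfL := H2_L2 hf; have hk := Hk_L2 hf; have pf := L2_mulf hPsi hfL.
have le1 : N2 (mulf Psi f) <= N2 f.
  rewrite -[leRHS]mul1r; apply: (N2_mulf_le hPsi hfL).
  by apply: aeDS cF => t _ h v; rewrite mul1r.
have e1 : aeD (fun t => Psi t *m f t = Hk f t).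
  have : N2 (mulf Psi f - Hk f) = 0.
    apply/eqP; rewrite eq_le N2_ge0 andbT N2B // [ip (mulf Psi f) _]Hk_sub //; last exact: Hk_H2m.
    rewrite -N2_def; lra.
  move/(N2_eq0 (L2_sub pf hk)); apply: aeDS => t _ /eqP; rewrite subr_eq0 => /eqP.
  by rewrite /mulf.
have e2 : aeD (fun t => vsq (f t) - vsq (Hk f t) = 0).
  apply: Ri_eq0_ae.
  - by apply: rintB; exact: L2_rint.
  - apply: aeDS2 cF e1 => t _ h <-; by rewrite subr_ge0.
  - by rewrite RiB -?N2E ?ef ?subrr //; exact: L2_rint.
have e12 := aeD2 e1 e2.
apply: aeDS2 cF e12 => t _ h [h1 h2]; split=> //.
rewrite -h1; apply: contr_isom => //; rewrite -/(Psi t) h1.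
by apply/esym/eqP; rewrite -subr_eq0 h2.
Qed.

Hypothesis ess : hankel_ess_norm_lt1 Phi.

(** Without a gap there are unit vectors, orthogonal to all maximizing vectors, whose defects tend
    to 0. By [key] and the compactness of [K] a subsequence is Cauchy. Its limit is maximizing,
    hence orthogonal to itself, although its norm is 1. *)
Lemma gap : exists2 e : R, 0 < e & forall f, H2 f -> (forall g, maxv g -> ip f g = 0) ->
  e * N2 f <= N2 f - N2 (Hk f).
Proof.
case: ess => K [[K1 [K2 K3]] [r [r1 hr]]].
apply: contrapT => nogap.
pose Q f := cRe (hkform idf f f).
have QE f : Q f = N2 f - N2 (Hk f) by exact: hkform1E.
have Q0 f : H2 f -> 0 <= Q f by move=> hf; exact: (hform_ge0 hkform1).
have /choice [u hu] : forall k : nat, exists f, [/\ H2 f, N2 f = 1, Q f <= k.+1%:R^-1 &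
    forall g, maxv g -> ip f g = 0].
  move=> k; apply: contrapT => nk; apply: nogap; exists k.+1%:R^-1; first by rewrite invr_gt0.
  move=> f hf fM; rewrite leNgt; apply/negP => lt; apply: nk.
  have hfL := H2_L2 hf; rewrite -QE in lt.
  have Nf : 0 < N2 f.
    rewrite lt_def N2_ge0 andbT; apply/eqP => N0.
    by move: lt; rewrite N0 mulr0 ltNge Q0.
  pose c : C := ((Num.sqrt (N2 f))^-1)%:C.
  have nc : nsq c = (N2 f)^-1 by rewrite nsq_real exprVn sqr_sqrtr // N2_ge0.
  exists (c *: f); split.
  - exact: H2_scale.
  - by rewrite N2Z // nc mulVf // gt_eqF.
  - rewrite /Q (hqZ hkform1) // nc mulrC ler_pdivrMr //; exact: ltW.
  - by move=> g mg; rewrite (hformZl ipf) ?fM ?mulr0 //; exact: H2_L2 (proj1 mg).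
have uH k : H2 (u k) by have [] := hu k.
have uL k : L2 (u k) by exact: H2_L2.
have [|phi [phiS hphi]] := K3 u.
  by move=> k; have [h1 h2 _ _] := hu k; split=> //; rewrite l2normE h2 sqrtr1.
have phik k : (k <= phi k)%N by elim: k => // k IH; apply: leq_ltn_trans IH (phiS k).
(* The given [r] may be negative, hence the maximum with 0. The value of [eta] makes
   [rho ^+ 2 = 1 - 2 * eta], so that [(1 + eta) * rho ^+ 2 <= 1 - eta]. *)
pose rho := Num.max r 0.
have rho0 : 0 <= rho by rewrite le_max lexx orbT.
have rho1 : rho < 1 by rewrite gt_max r1 ltr01.
pose eta := (1 - rho ^+ 2) / 2.
have rr : rho ^+ 2 < 1 by rewrite exprn_ilt1.
have eta0 : 0 < eta by rewrite divr_gt0 // subr_gt0.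
have key d : H2 d -> eta * N2 d <= Q d + (1 + eta^-1) * N2 (K d).
  move=> hd; have hk := Hk_L2 hd; have hK := H2m_L2 (K1 _ hd).
  have h1 : N2 (Hk d - K d) <= rho ^+ 2 * N2 d.
    have := hr _ _ (Hk_hankel hd); rewrite !l2normE => h.
    have {}h : Num.sqrt (N2 (Hk d - K d)) <= rho * Num.sqrt (N2 d).
      apply: le_trans h _; apply: ler_wpM2r; first exact: sqrtr_ge0.
      by rewrite le_max lexx.
    have : Num.sqrt (N2 (Hk d - K d)) ^+ 2 <= (rho * Num.sqrt (N2 d)) ^+ 2.
      by rewrite ler_sqr ?nnegrE ?mulr_ge0 ?sqrtr_ge0.
    by rewrite exprMn !sqr_sqrtr // N2_ge0.
  (* The weighted arithmetic-geometric inequality [2 Re <x, y> <= eta |x|^2 + eta^-1 |y|^2]. *)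
  have h2 : N2 (Hk d) <= (1 + eta) * N2 (Hk d - K d) + (1 + eta^-1) * N2 (K d).
    have hs := L2_sub hk hK.
    have -> : N2 (Hk d) = N2 ((Hk d - K d) + K d) by rewrite subrK.
    rewrite N2D //.
    have cs := le_trans (cRe_le_nsq _) (inner_CS hs hK).
    have a0 := N2_ge0 (Hk d - K d); have b0 := N2_ge0 (K d).
    move: (cRe _) (N2 (Hk d - K d)) (N2 (K d)) cs a0 b0 => x a b cs a0 b0.
    have ei : eta * eta^-1 = 1 by rewrite divff // gt_eqF.
    have ei0 : 0 < eta^-1 by rewrite invr_gt0.
    move: (eta^-1) ei ei0 => i ei ei0.
    have : 2 * x <= eta * a + i * b.
      have p : 0 <= eta * a + i * b by rewrite addr_ge0 // mulr_ge0 // ltW.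
      apply: le_trans (ler_norm _) _; rewrite -ler_sqr ?nnegrE // real_normK ?num_real //.
      have : (2 * x) ^+ 2 <= 4 * (a * b) by rewrite exprMn; nra.
      move/le_trans; apply.
      have -> : 4 * (a * b) = 4 * ((eta * a) * (i * b)) by rewrite mulrACA ei mul1r.
      have := sqr_ge0 (eta * a - i * b); nra.
    by move=> hx; rewrite !mulrDl !mul1r; lra.
  have h3 : (1 + eta) * N2 (Hk d - K d) <= (1 - eta) * N2 d.
    have a1 : (1 + eta) * N2 (Hk d - K d) <= (1 + eta) * (rho ^+ 2 * N2 d).
      by rewrite ler_pM2l //; lra.
    apply: le_trans a1 _; rewrite mulrA; apply: ler_wpM2r; first exact: N2_ge0.
    rewrite /eta; have := sqr_ge0 rho; nra.
  rewrite QE; lra.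
have cK : forall e : R, 0 < e -> exists N : nat, forall k l, (N <= k)%N -> (N <= l)%N ->
    N2 (K (u (phi k) - u (phi l))) <= e.
  move=> e e0; have [|N hN] := hphi (Num.sqrt e); first by rewrite sqrtr_gt0.
  exists N => k l kN lN; have := hN k l kN lN.
  have kH := uH (phi k); have lH := uH (phi l).
  have hk := H2m_L2 (K1 _ kH); have hl := H2m_L2 (K1 _ lH).
  have hd : H2 (u (phi k) - u (phi l)) by exact: H2_sub.
  have hdL := H2m_L2 (K1 _ hd).
  rewrite l2normE -ler_sqr ?nnegrE ?sqrtr_ge0 // !sqr_sqrtr ?N2_ge0 ?(ltW e0) //.
  have ee : u (phi k) - u (phi l) = fun t => -1 *: u (phi l) t + u (phi k) t.
    by apply/funext => t; rewrite !fctE scaleN1r addrC.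
  have := K2 (-1) _ _ lH kH; rewrite -ee => ae1.
  have -> // : N2 (K (u (phi k) - u (phi l))) = N2 (K (u (phi k)) - K (u (phi l))).
  have hs := L2_sub hk hl.
  have ae2 : aeD (fun t => K (u (phi k) - u (phi l)) t = (K (u (phi k)) - K (u (phi l))) t).
    by apply: aeDS ae1 => t _ ->; rewrite !fctE scaleN1r addrC.
  exact: N2_aeE.
have inv_small (e : R) : 0 < e -> exists N : nat, forall k, (N <= k)%N -> k.+1%:R^-1 <= e.
  move=> e0; exists (Num.truncn e^-1) => k hk; rewrite invf_ple ?posrE ?ltr0Sn //.
  apply: ltW; apply: lt_le_trans (truncnS_gt _) _; by rewrite ler_nat ltnS.
have Qsmall (e : R) : 0 < e -> exists N : nat, forall k, (N <= k)%N -> Q (u (phi k)) <= e.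
  move=> /inv_small [N hN]; exists N => k kN; have [_ _ h _] := hu (phi k).
  by apply: le_trans h (hN _ (leq_trans kN (phik k))).
have cu : hcauchy ip (fun k => u (phi k)).
  (* The defects contribute at most [4 * e1 = eta * e / 2] and the compact part at most
     [eta * e / 2], which add up to [eta * e]. *)
  apply/hcauchyP => e e0; pose e1 := eta * e / 8; pose e2 := eta * e / 2 / (1 + eta^-1).
  have ei0 : 0 < 1 + eta^-1 by rewrite addr_gt0 // invr_gt0.
  have [|N1 h1] := Qsmall e1; first by rewrite divr_gt0 // mulr_gt0.
  have [|N2' h2] := cK e2; first by rewrite !divr_gt0 // mulr_gt0.
  exists (maxn N1 N2') => k l; rewrite !geq_max => /andP[k1 k2] /andP[l1 l2].
  have hd : H2 (u (phi k) - u (phi l)) by exact: H2_sub.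
  have := key _ hd; have := hqB_le hkform1 (uH (phi k)) (uH (phi l)).
  rewrite -/(Q _) -/(Q (u (phi k))) -/(Q (u (phi l))).
  have a1 := h1 _ k1; have a2 := h1 _ l1; have a3 := h2 _ _ k2 l2 => b1 b2.
  have a4 : (1 + eta^-1) * N2 (K (u (phi k) - u (phi l))) <= eta * e / 2.
    by rewrite mulrC -ler_pdivlMr.
  rewrite -(ler_pM2l eta0); rewrite /e1 in a1 a2; lra.
have [|v [_ [hv uv _ _]]] := L2_complete _ cu; first by move=> k; exact: uL.
have vH : H2 v by apply: H2_lim uv.
have vM : maxv v.
  split=> //; suff : Q v = 0 by rewrite QE => /eqP; rewrite subr_eq0 => /eqP ->.
  apply/eqP; rewrite eq_le Q0 // andbT; apply/ler_addgt0Pr => e e0; rewrite add0r.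
  have [|N1 h1] := Qsmall (e / 4); first lra.
  have [|N2' h2] := (iffLR (hlimP _ _) uv) (e / 4); first lra.
  pose k := maxn N1 N2'; have {}h1 := h1 k (leq_maxl _ _); have {}h2 := h2 k (leq_maxr _ _).
  have hd : H2 (u (phi k) - v) by exact: H2_sub.
  have h3 : Q v <= 2 * Q (u (phi k)) + 2 * Q (u (phi k) - v).
    by have := hqB_le hkform1 (uH (phi k)) hd; rewrite opprB addrC subrK.
  rewrite (QE (u (phi k) - v)) in h3.
  have := N2_ge0 (Hk (u (phi k) - v)); lra.
have v0 : ip v v = 0.
  by apply: hlim_inner uv _ => // k; have [_ _ _ h] := hu (phi k); exact: h.
have [|N hN] := (iffLR (hlimP _ _) uv) (1 / 4); first lra.
have [_ n1 _ _] := hu (phi N); have := hN N (leqnn _) => h.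
have := N2D_le (L2_sub (uL (phi N)) hv) hv; rewrite subrK n1 (N2_def v) v0 cRe0; lra.
Qed.

End HankelForm.

(** * Analyticity of the reciprocal of a function with positive real part *)

Section Reciprocal.
Variable R : realType.
Local Notation D := (@circD R).
Local Notation C := (complex R).
Implicit Types f g h : R -> C.

Lemma const_of_coefs g : cL1 g -> (forall k : int, k != 0 -> cint (fun t => g t * ez k t) = 0) ->
  aeD (fun t => g t = cint g / (2 * pi)%:C).
Proof.
move=> hg cg; set a := _ / _.
have p0 : (2 * pi)%:C != 0 :> C by rewrite -nsq_eq0 nsq_real expf_neq0 // gt_eqF // twopi_gt0.
have ha : cL1 (fun t => g t - a) by apply: cL1B => //; exact: cL1_cst.
have : aeD (fun t => g t - a = 0); last by apply: aeDS => t _ /eqP; rewrite subr_eq0 => /eqP.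
apply: fourier_unique => // k.
have z1 := cL1_ez k hg; have z2 : cL1 (fun t => a * ez k t).
  by apply: cL1Z; exact: sL2_L1 (sLinf_sL2 (sLinf_ez R k)).
under eq_fun do rewrite mulrBl; rewrite cintB //.
have [->|k0] := eqVneq k 0.
  have -> : (fun t => g t * ez 0 t) = g by apply/funext => t; rewrite ez0 mulr1.
  have -> : (fun t => a * ez 0 t) = fun=> a by apply/funext => t; rewrite ez0 mulr1.
  by rewrite cint_cst divfK // subrr.
rewrite cg // cintZ ?cint_ez ?mulr0 ?subr0 //.
exact: sL2_L1 (sLinf_sL2 (sLinf_ez R k)).
Qed.

Lemma scalar_CS f g : sL2 f -> sL2 g ->
  nsq (cint (fun t => f t * g t)) <= Ri (fun t => nsq (f t)) * Ri (fun t => nsq (g t)).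
Proof.
move=> hf hg.
pose F : R -> 'cV[C]_1 := fun t => const_mx (f t).
pose G : R -> 'cV[C]_1 := fun t => const_mx (cconj (g t)).
have hF : L2 F by apply/L2P => i; under eq_fun do rewrite mxE.
have hG : L2 G by apply/L2P => i; under eq_fun do rewrite mxE; exact: sL2_conj.
have := inner_CS hF hG; rewrite !N2E ipE.
have -> : (fun t => vdot (F t) (G t)) = fun t => f t * g t.
  by apply/funext => t; rewrite /vdot big_ord1 !mxE cconjK.
have -> : (fun t => vsq (F t)) = fun t => nsq (f t).
  by apply/funext => t; rewrite /vsq big_ord1 !mxE.
have -> // : (fun t => vsq (G t)) = fun t => nsq (g t).
by apply/funext => t; rewrite /vsq big_ord1 !mxE nsq_conj.
Qed.

Lemma sH2_unshift f : sH2 f -> cint f = 0 -> sH2 (fun t => ez (- 1) t * f t).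
Proof.
move=> hf f0; pose F : R -> 'cV[C]_1 := fun t => const_mx (f t).
have hF : H2 F by apply/H2P => i; under eq_fun do rewrite mxE.
have hF1 : H2 (shiftf (-1) F).
  by apply: H2_unshift => // i; rewrite -[RHS]f0; congr cint; apply/funext => t; rewrite mxE.
by have /H2P /(_ ord0) := hF1; under eq_fun do rewrite !mxE.
Qed.

Lemma sH2_ae f g : sH2 f -> cmeas g -> aeD (fun t => f t = g t) -> sH2 g.
Proof.
move=> [hf cf] mg fg; have hg := sL2_ae hf mg fg; split=> // k k0; rewrite -(cf k k0).
apply: cint_ae; first exact: cmeasM mg (cmeas_ez R k).
  by apply: cmeasM (cmeas_ez R k); case: hf.
by apply: aeDS fg => t _ ->.
Qed.

(* Although [l * f * s] is only integrable, its Fourier coefficients depend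
   continuously on [f] in the quadratic norm: they are finite convolutions. *)
Lemma triple_coef_bound (l : R -> C) (j : nat) : sH2 l -> forall s, sH2 s ->
  exists c : R, forall f, sH2 f -> sL2 (fun t => l t * f t) ->
    nsq (cint (fun t => l t * f t * s t * ez (- j%:Z) t)) <= c * Ri (fun t => nsq (f t)).
Proof.
move=> hl; have p0 : (2 * pi)%:C != 0 :> C.
  by rewrite -nsq_eq0 nsq_real expf_neq0 // gt_eqF // twopi_gt0.
have lin (k : int) f : sH2 f ->
    nsq (cint (fun t => l t * f t * ez k t)) <= Ri (fun t => nsq (l t)) * Ri (fun t => nsq (f t)).
  move=> hf; have h1 : sL2 (fun t => ez k t * l t) by apply: sL2_ez; exact: sH2_L2.
  have := scalar_CS h1 (sH2_L2 hf).
  have -> : (fun t => ez k t * l t * f t) = fun t => l t * f t * ez k t.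
    by apply/funext => t; ring.
  have -> // : (fun t => nsq (ez k t * l t)) = fun t => nsq (l t).
  by apply/funext => t; rewrite nsqM nsq_ez mul1r.
elim: j => [|j IH] s hs.
  exists (nsq (cint s / (2 * pi)%:C) * Ri (fun t => nsq (l t))) => f hf lf.
  have hlf : sH2 (fun t => l t * f t) by split=> // k k0; exact: sH2_prod.
  have -> : (fun t => l t * f t * s t * ez (- 0%N%:Z) t) = fun t => l t * f t * s t.
    by apply/funext => t; rewrite oppr0 ez0 mulr1.
  have -> : cint (fun t => l t * f t * s t) = cint s / (2 * pi)%:C * cint (fun t => l t * f t).
    by apply: (mulIf p0); rewrite sH2_prod0 // mulrAC divfK // mulrC.
  rewrite nsqM -mulrA ler_wpM2l ?nsq_ge0 //; have := lin 0 _ hf.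
  have -> // : (fun t => l t * f t * ez 0 t) = fun t => l t * f t.
  by apply/funext => t; rewrite ez0 mulr1.
(* Writing [s = a + z s'] lowers the index: the coefficient [j.+1] of [l * f * s] is [a] times that
   of [l * f] plus the coefficient [j] of [l * f * s']. *)
pose a := cint s / (2 * pi)%:C; pose s' t := ez (- 1) t * (s t - a).
have hs' : sH2 s'.
  apply: sH2_unshift; first by apply: sH2B => //; exact: sH2_cst.
  rewrite cintB ?cint_cst ?divfK ?subrr //; last exact: cL1_cst.
  exact: sL2_L1 (sH2_L2 hs).
have [c hc] := IH s' hs'.
exists (2 * (nsq a * Ri (fun t => nsq (l t))) + 2 * c) => f hf lf.
have z1 : cL1 (fun t => l t * f t * ez (- j.+1%:Z) t) by apply: cL1_ez; exact: sL2_L1.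
have z2 : cL1 (fun t => l t * f t * s' t * ez (- j%:Z) t).
  by apply: cL1_ez; apply: sL2_L1M => //; exact: sH2_L2.
have -> : (fun t => l t * f t * s t * ez (- j.+1%:Z) t) = fun t =>
    a * (l t * f t * ez (- j.+1%:Z) t) + l t * f t * s' t * ez (- j%:Z) t.
  apply/funext => t; rewrite /s' -[j.+1]addn1 PoszD opprD ezD; ring.
rewrite cintD ?cintZ //; last exact: cL1Z.
apply: le_trans (nsqD_le _ _) _; rewrite nsqM.
have h1 := ler_wpM2l (nsq_ge0 a) (lin (- j.+1%:Z) _ hf); have h2 := hc _ hf lf.
move: (nsq (cint _)) (nsq (cint _)) (Ri _) (Ri _) h1 h2 => x y u v h1 h2; lra.
Qed.

Section Galerkin.
Variables (n : nat) (c0 : C) (l s : 'I_n -> R -> C) (e : R).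
Hypotheses (hl : forall i, sH2 (l i)) (hs : forall i, sH2 (s i)) (e0 : 0 < e).
Let d (t : R) : C := c0 + \sum_i l i t * s i t.
Hypothesis Red : aeD (fun t => e + \sum_i nsq (l i t) <= cRe (d t)).

Let ls_L1 i : cL1 (fun t => l i t * s i t).
Proof. by apply: sL2_L1M; exact: sH2_L2. Qed.
Let d_L1 : cL1 d.
Proof. by apply: cL1D; [exact: cL1_cst|exact: cL1_sum]. Qed.

Let d_pos (k : nat) : (0 < k)%N -> cint (fun t => d t * ez k t) = 0.
Proof.
move=> k0; under eq_fun do rewrite mulrDl mulr_suml.
rewrite cintD; last 2 first.
- by apply: cL1Z; exact: sL2_L1 (sLinf_sL2 (sLinf_ez R k)).
- by apply: cL1_sum => i; exact: cL1_ez.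
rewrite cint_sum; last by move=> i; exact: cL1_ez.
rewrite big1 ?addr0; last by move=> i _; exact: sH2_prod.
by have [_] := sH2_cst c0; apply.
Qed.

Let tpi : C := (2 * pi)%:C.
Let dm : C := cint d.
Let dm_neq0 : dm != 0.
Proof.
apply/eqP => d0; have : cRe dm = 0 by rewrite d0.
rewrite /dm cRe_cint => h.
have : e * (2 * pi) <= Ri (fun t => cRe (d t)).
  rewrite -Ri_cst; apply: Ri_le_ae; [exact: rint_cst|by case: d_L1|].
  apply: aeDS Red => t _; apply: le_trans; rewrite lerDl; apply: sumr_ge0 => i _.
  exact: nsq_ge0.
by rewrite h leNgt mulr_gt0 // twopi_gt0.
Qed.

Let b0 : C := tpi / dm.
(* [gal N] is the polynomial of degree less than [N] for which [d * gal N] has the same first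
   [N] coefficients as [1]. Pairing [d * gal N] with [gal N] bounds it in the weighted norm
   [\int (e + \sum_i |l_i|^2) |f|^2]. *)
Fixpoint gal (N : nat) : R -> C :=
  if N is M.+1 then fun t => gal M t +
    ((if M == 0%N then tpi else 0) - cint (fun t => d t * gal M t * ez (- M%:Z) t)) / dm * ez M t
  else fun=> 0.
Let gc (M : nat) : C :=
  ((if M == 0%N then tpi else 0) - cint (fun t => d t * gal M t * ez (- M%:Z) t)) / dm.
Let galS M t : gal M.+1 t = gal M t + gc M * ez M t. Proof. by []. Qed.

Let gal_inf N : sLinf (gal N) /\ sH2 (gal N).
Proof.
elim: N => [|N [h1 h2]]; first by split; [exact: sLinf_cst|exact: sH2_cst].
split.
  by apply: sLinfD => //; apply: sLinfM; [exact: sLinf_cst|exact: sLinf_ez].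
apply: sH2D => //; have := sH2_ez N (sH2_cst (gc N)).
by under eq_fun do rewrite mulrC.
Qed.
Let dgal_L1 N : cL1 (fun t => d t * gal N t).
Proof.
have [[m [M hM]] _] := gal_inf N; under eq_fun do rewrite mulrC.
exact: cL1_bM m hM d_L1.
Qed.
Let gc0 : gc 0 = b0.
Proof.
rewrite /gc /=; under eq_fun do rewrite mulr0 mul0r; by rewrite cint_cst mul0r subr0.
Qed.

Let gal_coef N (j : nat) : (j < N)%N ->
  cint (fun t => d t * gal N t * ez (- j%:Z) t) = if j == 0%N then tpi else 0.
Proof.
elim: N => // N IH; rewrite ltnS leq_eqVlt => jN.
have -> : (fun t => d t * gal N.+1 t * ez (- j%:Z) t) = fun t =>
    d t * gal N t * ez (- j%:Z) t + gc N * (d t * ez (N%:Z - j%:Z) t).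
  by apply/funext => t; rewrite galS ezD; ring.
have z : cL1 (fun t => d t * ez (N%:Z - j%:Z) t) by exact: cL1_ez.
rewrite cintD; [|exact: cL1_ez|exact: cL1Z].
rewrite cintZ //; case/orP: jN => [/eqP ->|jN].
  have -> : (fun t => d t * ez (N%:Z - N%:Z) t) = d.
    by apply/funext => t; rewrite subrr ez0 mulr1.
  by rewrite -/dm /gc divfK // addrC subrK.
rewrite IH // subzn ?(ltnW jN) // d_pos ?subn_gt0 // mulr0 addr0 //.
Qed.

(** As [gal N] has degree less than [N], the pairing sees only prescribed coefficients, of which
    just the constant one is nonzero; the value is thus independent of [N >= 1]. The function [g]
    stands for [d * gal N] and stays fixed while the induction shortens the conjugated factor. *)
Let gal_conj N g : cL1 g ->
  (forall j, (j < N)%N -> cint (fun t => g t * ez (- j%:Z) t) = if j == 0%N then tpi else 0) ->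
  cint (fun t => g t * cconj (gal N t)) = if N == 0%N then 0 else cconj b0 * tpi.
Proof.
move=> hg; elim: N => [|N IH] cg.
  by under eq_fun do rewrite cconj0 mulr0; rewrite cint_cst mul0r.
have [[m [M hM]] _] := gal_inf N.
have z1 : cL1 (fun t => g t * cconj (gal N t)).
  under eq_fun do rewrite mulrC; apply: cL1_bM hg; first exact: cmeas_conj.
  by under eq_fun do rewrite nsq_conj; exact: hM.
have -> : (fun t => g t * cconj (gal N.+1 t)) = fun t =>
    g t * cconj (gal N t) + cconj (gc N) * (g t * ez (- N%:Z) t).
  by apply/funext => t; rewrite galS cconjD cconjM ezN; ring.
rewrite cintD ?cintZ; [|exact: cL1_ez|done|by apply: cL1Z; exact: cL1_ez].
rewrite IH ?cg //; last by move=> j jN; apply: cg; exact: ltnW.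
by case: (N) gc0 => [->|N' _] /=; rewrite ?add0r ?mulr0 ?addr0.
Qed.

Let gal_high N (j : nat) : (N <= j)%N -> cint (fun t => gal N t * ez (- j%:Z) t) = 0.
Proof.
elim: N => [|N IH] Nj.
  by under eq_fun do rewrite mul0r; rewrite cint_cst mul0r.
have [_ h2] := gal_inf N.
have -> : (fun t => gal N.+1 t * ez (- j%:Z) t) = fun t =>
    gal N t * ez (- j%:Z) t + gc N * ez (N%:Z - j%:Z) t.
  by apply/funext => t; rewrite galS ezD; ring.
have z : cL1 (@ez R (N%:Z - j%:Z)) by exact: sL2_L1 (sLinf_sL2 (sLinf_ez R _)).
rewrite cintD; [|by apply: cL1_ez; exact: sL2_L1 (sH2_L2 h2)|exact: cL1Z].
rewrite IH ?(ltnW Nj) // cintZ // cint_ez ?mulr0 ?addr0 //.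
by rewrite subr_eq0 eqz_nat ltn_eqF.
Qed.

Let gal_bound N : Ri (fun t => (e + \sum_i nsq (l i t)) * nsq (gal N t)) <=
    `|cRe (cconj b0 * tpi)| /\ rint (fun t => (e + \sum_i nsq (l i t)) * nsq (gal N t)).
Proof.
have [[m [M hM]] h2] := gal_inf N.
have z : cL1 (fun t => d t * gal N t * cconj (gal N t)).
  under eq_fun do rewrite mulrC; apply: cL1_bM (dgal_L1 N); first exact: cmeas_conj.
  by under eq_fun do rewrite nsq_conj; exact: hM.
have zE : (fun t => cRe (d t * gal N t * cconj (gal N t))) =
    fun t => cRe (d t) * nsq (gal N t).
  by apply/funext => t; rewrite -mulrA mulcconj cReM cRe_real cIm_real mulr0 subr0.
have iz : rint (fun t => cRe (d t) * nsq (gal N t)) by rewrite -zE; case: z.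
have ir : rint (fun t => (e + \sum_i nsq (l i t)) * nsq (gal N t)).
  apply: rint_le_ae iz _.
    apply: rmeasM; last exact: rmeas_nsq.
    apply: rmeasD; first exact: rmeas_cst.
    by apply: rint_meas; apply: rint_sum => i; have [[]] := hl i.
  apply: aeDS Red => t _ h; rewrite ger0_norm; first by rewrite ler_wpM2r // nsq_ge0.
  by rewrite mulr_ge0 ?nsq_ge0 // addr_ge0 ?(ltW e0) // sumr_ge0 // => i _; exact: nsq_ge0.
split=> //; apply: (@le_trans _ _ (Ri (fun t => cRe (d t) * nsq (gal N t)))).
  by apply: Ri_le_ae => //; apply: aeDS Red => t _ h; rewrite ler_wpM2r // nsq_ge0.
rewrite -zE -cRe_cint gal_conj //; last by move=> j; exact: gal_coef.
by case: eqP => _; [rewrite normr_ge0|exact: ler_norm].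
Qed.

Let K : R := `|cRe (cconj b0 * tpi)|.
Let w N : R -> 'cV[C]_1 := fun t => const_mx (gal N t).
Let wL2 N : L2 (w N).
Proof. by apply/L2P => i; under eq_fun do rewrite mxE; have [_ /sH2_L2] := gal_inf N. Qed.
Let wH2 N : H2 (w N).
Proof. by apply/H2P => i; under eq_fun do rewrite mxE; have [_] := gal_inf N. Qed.

(** Passing from [gal M] to [gal M.+1] adds a multiple of [z^M], which is orthogonal to [gal N] for
    [N <= M]. The [gal N] are therefore partial sums of one power series, and bounded norms imply
    convergence. *)
Let w_orth N M : (N <= M)%N -> ip (w N) (w M) = ip (w N) (w N).
Proof.
elim: M => [|M IH]; first by rewrite leqn0 => /eqP ->.
rewrite leq_eqVlt => /orP[/eqP -> //|]; rewrite ltnS => NM; rewrite -IH // !ipE.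
have [_ h2] := gal_inf N; have [_ hM] := gal_inf M.
have -> : (fun t => vdot (w N t) (w M.+1 t)) = fun t =>
    vdot (w N t) (w M t) + cconj (gc M) * (gal N t * ez (- M%:Z) t).
  apply/funext => t; rewrite /vdot !big_ord1 !mxE galS cconjD cconjM ezN; ring.
have z : cL1 (fun t => gal N t * ez (- M%:Z) t) by apply: cL1_ez; exact: sL2_L1 (sH2_L2 h2).
rewrite cintD ?cintZ ?gal_high ?mulr0 ?addr0 //; last exact: cL1Z.
by apply: L2_L1.
Qed.

Let w_bound N : e * N2 (w N) <= K.
Proof.
have [h1 h2] := gal_bound N; apply: le_trans h1.
have vE : (fun t => vsq (w N t)) = fun t => nsq (gal N t).
  by apply/funext => t; rewrite /vsq big_ord1 mxE.
have hr : rint (fun t => nsq (gal N t)) by rewrite -vE; exact: L2_rint.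
rewrite N2E vE -RiZ //; apply: Ri_le => //; first exact: rintZ.
move=> t _; rewrite ler_wpM2r ?nsq_ge0 // lerDl; apply: sumr_ge0 => i _; exact: nsq_ge0.
Qed.

Let w_pyth N M : (N <= M)%N -> N2 (w M - w N) = N2 (w M) - N2 (w N).
Proof.
move=> NM; rewrite N2B // (hformC (inner_hform R 1) (wL2 N) (wL2 M)) cRe_conj w_orth //.
rewrite -N2_def; ring.
Qed.

Let w_cauchy : hcauchy (@ip R 1) w.
Proof.
apply/hcauchyP => x x0.
have mono N M : (N <= M)%N -> N2 (w N) <= N2 (w M).
  by move=> NM; rewrite -subr_ge0 -w_pyth // N2_ge0.
have hS : has_sup (range (fun N => N2 (w N))).
  split; first by exists (N2 (w 0%N)); exists 0%N.
  by exists (K / e) => _ [N _ <-]; rewrite ler_pdivlMr // mulrC.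
pose S := sup (range (fun N => N2 (w N))).
have Sle k : N2 (w k) <= S by apply: (ub_le_sup hS.2); exists k.
have [_ [N _ <-] hN] := sup_adherent x0 hS; rewrite -/S in hN.
exists N => k j kN jN; have h1 := mono _ _ kN; have h2 := mono _ _ jN.
have Sk := Sle k; have Sj := Sle j.
have [kj|jk] := leqP k j; last by rewrite w_pyth ?(ltnW jk) //; lra.
rewrite -opprB -scaleN1r N2Z ?nsqN ?nsq1 ?mul1r; last exact: L2_sub.
by rewrite w_pyth //; lra.
Qed.

(** The limit [b] of the [gal N] lies in [H2], and all Fourier coefficients of [d * b] are those of
    the constant 1, so [b] is the reciprocal of [d]. *)
Lemma reciprocal_sH2 : sLinf (fun t => (d t)^-1) /\ sH2 (fun t => (d t)^-1).
Proof.
have md : cmeas d by exact: cL1_meas.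
have inv_inf : sLinf (fun t => (d t)^-1).
  split; first exact: cmeas_inv.
  exists (e ^- 2); apply: aeDS Red => t _ h.
  have ed : e <= cRe (d t).
    by apply: le_trans h; rewrite lerDl; apply: sumr_ge0 => i _; exact: nsq_ge0.
  have n2 : e ^+ 2 <= nsq (d t).
    by apply: le_trans (cRe_le_nsq _); rewrite ler_sqr ?nnegrE ?(ltW e0) //; apply: le_trans ed; exact: ltW.
  have p2 : 0 < e ^+ 2 by rewrite exprn_gt0.
  rewrite cinvE nsqM nsq_real nsq_conj expr2 -mulrA mulVf ?mulr1; last by rewrite gt_eqF // (lt_le_trans p2).
  by rewrite lef_pV2 ?posrE // (lt_le_trans p2).
split=> //.
have [v [phi [vL2 wv phik aev]]] := L2_complete wL2 w_cauchy.
have vH2 : H2 v by apply: H2_lim wv.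
pose b t := v t ord0 0; have hb : sH2 b by have /H2P := vH2; exact.
have cvb : aeD (fun t => nsq (gal (phi k) t) @[k --> \oo] --> nsq (b t)).
  apply: aeDS aev => t _ /(_ ord0) [h1 h2].
  have -> : (fun k => nsq (gal (phi k) t)) = fun k => cRe (w (phi k) t ord0 0) * cRe (w (phi k) t ord0 0)
     + cIm (w (phi k) t ord0 0) * cIm (w (phi k) t ord0 0).
    by apply/funext => k; rewrite mxE /nsq !expr2.
  rewrite /nsq !expr2; apply: cvgD; apply: cvgM => //.
(* Fatou's lemma carries the weighted bound to the limit. As the [l i] and [s i] are only square
   integrable, this is what makes [d * b] integrable. *)
have lb i : sL2 (fun t => l i t * b t).
  have ml : cmeas (l i) by have [[]] := hl i.
  have mb : cmeas b by have [[]] := hb.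
  have mg k : cmeas (gal k) by have [[]] := gal_inf k.
  split; first exact: cmeasM.
  have gi k : rint (fun t => nsq (l i t) * nsq (gal k t)).
    have [_ h] := gal_bound k; apply: rint_le h _; first by apply: rmeasM; exact: rmeas_nsq.
    move=> t _; rewrite ger0_norm ?mulr_ge0 ?nsq_ge0 // ler_wpM2r ?nsq_ge0 //.
    rewrite (bigD1 i) //= addrCA lerDl addr_ge0 ?(ltW e0) // sumr_ge0 // => j _; exact: nsq_ge0.
  have [|||||||h _] := @rfatou R (fun k t => nsq (l i t) * nsq (gal (phi k) t))
    (fun t => nsq (l i t) * nsq (b t)) K.
  - by move=> k; apply: rmeasM; exact: rmeas_nsq.
  - by apply: rmeasM; exact: rmeas_nsq.
  - by move=> k; exact: gi.
  - by move=> k t _; rewrite mulr_ge0 ?nsq_ge0.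
  - by move=> t _; rewrite mulr_ge0 ?nsq_ge0.
  - by apply: aeDS cvb => t _ h; apply: cvgM => //; exact: cvg_cst.
  - exists 0%N => k _; have [h1 h2] := gal_bound (phi k); apply: le_trans h1.
    apply: Ri_le => // t _; rewrite ler_wpM2r ?nsq_ge0 //.
    rewrite (bigD1 i) //= addrCA lerDl addr_ge0 ?(ltW e0) // sumr_ge0 // => j _; exact: nsq_ge0.
  by under eq_fun do rewrite nsqM.
have lbH i : sH2 (fun t => l i t * b t) by split=> // k k0; exact: sH2_prod.
have expand f (k : int) : sH2 f -> (forall i, sL2 (fun t => l i t * f t)) ->
    cL1 (fun t => d t * f t) /\
    cint (fun t => d t * f t * ez k t) = c0 * cint (fun t => f t * ez k t) +
      \sum_i cint (fun t => l i t * f t * s i t * ez k t).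
  move=> hf lf; have z1 : cL1 f by exact: sL2_L1 (sH2_L2 hf).
  have z2 i : cL1 (fun t => l i t * f t * s i t) by apply: sL2_L1M => //; exact: sH2_L2.
  have -> : (fun t => d t * f t) = fun t => c0 * f t + \sum_i l i t * f t * s i t.
    by apply/funext => t; rewrite /d mulrDl mulr_suml; congr (_ + _); apply: eq_bigr => i _; ring.
  split; first by apply: cL1D; [exact: cL1Z|exact: cL1_sum].
  have -> : (fun t => d t * f t * ez k t) = fun t =>
      c0 * (f t * ez k t) + \sum_i l i t * f t * s i t * ez k t.
    apply/funext => t; rewrite /d mulrDl mulrDl mulr_suml mulr_suml; congr (_ + _); first by ring.
    by apply: eq_bigr => i _; ring.
  rewrite cintD; [|by apply: cL1Z; exact: cL1_ez|by apply: cL1_sum => i; exact: cL1_ez].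
  rewrite cintZ; last exact: cL1_ez.
  by rewrite cint_sum // => i; exact: cL1_ez.
have lgal i N : sL2 (fun t => l i t * gal N t).
  have [h1 _] := gal_inf N; under eq_fun do rewrite mulrC.
  by apply: sLinfM_sL2 => //; exact: sH2_L2.
have [db_L1 _] := expand b 0 hb lb.
(* For [j < N] the coefficient is already right for [d * gal N]. Replacing [gal N] by [b] costs a
   multiple of [N2 (w N - v)], by Cauchy-Schwarz for the term with [c0] and by [triple_coef_bound]
   for the products. *)
have coef_neg (j : nat) : cint (fun t => d t * b t * ez (- j%:Z) t) = if j == 0%N then tpi else 0.
  have /choice [c hc] : forall i, exists c : R, forall f, sH2 f -> sL2 (fun t => l i t * f t) ->
      nsq (cint (fun t => l i t * f t * s i t * ez (- j%:Z) t)) <= c * Ri (fun t => nsq (f t)).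
    by move=> i; exact: triple_coef_bound.
  have diff N : sH2 (fun t => gal N t - b t) by apply: sH2B => //; have [] := gal_inf N.
  have ldiff i N : sL2 (fun t => l i t * (gal N t - b t)).
    by under eq_fun do rewrite mulrBr; exact: sL2B.
  have N2diff N : Ri (fun t => nsq (gal N t - b t)) = N2 (w N - v).
    by rewrite N2E; congr Ri; apply/funext => t; rewrite /vsq big_ord1 !fctE !mxE.
  pose T N i := cint (fun t => l i t * (gal N t - b t) * s i t * ez (- j%:Z) t).
  pose A N := cint (fun t => (gal N t - b t) * ez (- j%:Z) t).
  have Eq N : (j < N)%N -> (if j == 0%N then tpi else 0) -
      cint (fun t => d t * b t * ez (- j%:Z) t) = c0 * A N + \sum_i T N i.
    move=> jN; rewrite -(gal_coef jN) -cintB; [|exact: cL1_ez|exact: cL1_ez].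
    have [_ <-] := expand _ (- j%:Z) (diff N) (fun i => ldiff i N).
    by congr cint; apply/funext => t; ring.
  have vsum (F : 'I_n -> C) : nsq (\sum_i F i) <= n%:R * \sum_i nsq (F i).
    pose u : 'cV[C]_n := \col_i F i; pose o : 'cV[C]_n := const_mx 1.
    have := vdot_CS u o.
    have -> : vdot u o = \sum_i F i by apply: eq_bigr => i _; rewrite !mxE cconj1 mulr1.
    have -> : vsq u = \sum_i nsq (F i) by apply: eq_bigr => i _; rewrite mxE.
    have -> : vsq o = n%:R.
      rewrite /vsq (eq_bigr (fun=> 1)) => [|i _]; last by rewrite mxE nsq1.
      by rewrite sumr_const card_ord.
    by rewrite mulrC.
  apply/esym/eqP; rewrite -subr_eq0 -nsq_eq0 eq_le nsq_ge0 andbT.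
  apply/ler_addgt0Pr => x x0; rewrite add0r.
  pose B := 2 * (nsq c0 * (2 * pi)) + 2 * (n%:R * \sum_i `|c i|) + 1.
  have B0 : 0 < B.
    rewrite /B ltr_wpDl // addr_ge0 // mulr_ge0 // mulr_ge0 ?nsq_ge0 ?sumr_ge0 //.
    by rewrite mulr_ge0 // pi_ge0.
  have [|N0 hN0] := (iffLR (hlimP _ _) wv) (x / B); first by rewrite divr_gt0.
  pose N := maxn N0 j.+1; have {}hN0 := hN0 N (leq_maxl _ _).
  rewrite (Eq N) ?leq_maxr //; apply: le_trans (nsqD_le _ _) _.
  have a1 : nsq (A N) <= 2 * pi * N2 (w N - v).
    have := scalar_CS (sH2_L2 (diff N)) (sLinf_sL2 (sLinf_ez R (- j%:Z))).
    have -> : (fun t => nsq (@ez R (- j%:Z) t)) = fun=> 1 by apply/funext => t; rewrite nsq_ez.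
    by rewrite N2diff Ri_cst mul1r mulrC.
  have a2 : \sum_i nsq (T N i) <= (\sum_i `|c i|) * N2 (w N - v).
    rewrite mulr_suml; apply: ler_sum => i _; apply: le_trans (hc i _ (diff N) (ldiff i N)) _.
    by rewrite N2diff ler_wpM2r ?N2_ge0 // ler_norm.
  apply: (@le_trans _ _ (B * N2 (w N - v))); last by rewrite mulrC -ler_pdivlMr.
  have nn := N2_ge0 (w N - v).
  have b1 := ler_wpM2l (nsq_ge0 c0) a1.
  have b2 := le_trans (vsum (T N)) (ler_wpM2l (ler0n R n) a2).
  rewrite nsqM /B; move: (nsq (A N)) (nsq (\sum_i T N i)) (N2 _) (\sum_i _) b1 b2 nn.
  move=> y z u q b1 b2 nn; lra.
have db1 : aeD (fun t => d t * b t = 1).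
  have : aeD (fun t => d t * b t = cint (fun t => d t * b t) / tpi).
    apply: const_of_coefs => // -[[|k]|k] // k0.
    - have [_ ->] := expand b k.+1 hb lb.
      have [_ ->] := hb => //; rewrite mulr0 add0r big1 // => i _; exact: sH2_prod.
    - by rewrite NegzE coef_neg.
  have := coef_neg 0%N; under eq_fun do rewrite oppr0 ez0 mulr1.
  move=> /= ->; rewrite divff //.
  by rewrite -nsq_eq0 nsq_real expf_neq0 // gt_eqF // twopi_gt0.
apply: sH2_ae hb (proj1 inv_inf) _.
apply: aeDS db1 => t _ h.
have dn0 : d t != 0 by apply/eqP => d0; move: h; rewrite d0 mul0r => /eqP; rewrite eq_sym oner_eq0.
by apply: (mulfI dn0); rewrite h divff.
Qed.

End Galerkin.
End Reciprocal.

(** * Construction of a second unitary interpolant *)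

Section SecondInterpolant.
Variable R : realType.
Local Notation D := (@circD R).
Local Notation C := (complex R).
Variable n : nat.
Local Notation V := (R -> 'cV[C]_n).
Local Notation ip := (@ip R n).
Implicit Types f g h : V.
Let ipf := inner_hform R n.

Lemma nsqV (z : C) : nsq z^-1 = (nsq z)^-1.
Proof.
have [->|z0] := eqVneq z 0; first by rewrite invr0 nsq0 invr0.
have n0 : nsq z != 0 by rewrite nsq_eq0.
by apply: (mulfI n0); rewrite -nsqM !divff ?nsq1.
Qed.

(** The two bounds make [B] equivalent to the [L^2] norm on [S], so completeness of [L^2]
    transfers. *)
Lemma coercive_complete (S : V -> Prop) (B : V -> V -> C) (e c : R) :
  (forall f, S f -> L2 f) -> hform S B -> 0 < e ->
  (forall f, S f -> e * N2 f <= cRe (B f f) /\ cRe (B f f) <= c * N2 f) ->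
  (forall u v, (forall k, S (u k)) -> L2 v -> hlim ip u v -> S v) -> hcomplete S B.
Proof.
move=> SL hB e0 eB clS u Su cu.
have [||v [phi [hv uv _ _]]] := @L2_complete R n u; first by move=> k; exact: SL.
  apply/hcauchyP => x x0; have [|N hN] := cu (e * x); first by rewrite mulr_gt0.
  exists N => k l kN lN; have := hN k l kN lN.
  have [h1 _] := eB _ (hformBS hB (Su k) (Su l)).
  by move/(le_trans h1); rewrite ler_pM2l.
have Sv : S v by apply: clS uv.
exists v => // x x0; have c1 : 0 < `|c| + 1 by rewrite ltr_wpDl.
have [|N hN] := (iffLR (hlimP _ _) uv) (x / (`|c| + 1)); first by rewrite divr_gt0.
exists N => k /hN h; have [_ h2] := eB _ (hformBS hB (Su k) Sv); apply: le_trans h2 _.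
rewrite ler_pdivlMr // in h.
by apply: le_trans h; rewrite mulrC; apply: ler_wpM2l; [exact: N2_ge0|apply: le_trans (ler_norm c) _; lra].
Qed.

Lemma H2_ae f g : H2 f -> vmeas g -> aeD (fun t => f t = g t) -> H2 g.
Proof.
move=> /H2P hf mg fg; apply/H2P => i; apply: sH2_ae (hf i) (mg i) _.
by apply: aeDS fg => t _ ->.
Qed.

Lemma H2m_zbar c : H2minus (shiftf (- 1) (cstf c) : V).
Proof.
apply: H2mI; first by apply: L2_shift; exact: L2_cst.
move=> g hg; rewrite inner_shift opprK.
have hz := H2_shift 1%N hg; have hzL := H2_L2 hz.
rewrite (hformC ipf hzL (L2_cst c)) inner_sum //; last exact: L2_cst.
rewrite big1 ?cconj0 // => i _.
have -> : (fun t => shiftf 1%N g t i 0 * cconj (cstf c t i 0)) =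
    fun t => cconj (c i 0) * shiftf 1%N g t i 0 by apply/funext => t; rewrite mulrC.
rewrite cintZ; last by apply: sL2_L1; exact: (iffLR (L2P _) hzL).
by rewrite (cint_coord_shift i hg) mulr0.
Qed.

Lemma H2m_conj f i : H2minus f -> sH2 (fun t => cconj (f t i 0)) /\
  cint (fun t => cconj (f t i 0)) = 0.
Proof.
move=> hf; have h2 := iffLR (L2P _) (H2m_L2 hf) i.
have key (k : nat) : cint (fun t => cconj (f t i 0) * ez k t) = 0.
  have -> : (fun t => cconj (f t i 0) * ez k t) = fun t => cconj (f t i 0 * ez (- k%:Z) t).
    by apply/funext => t; rewrite cconjM ezN cconjK.
  rewrite cint_conj; first by rewrite H2m_coef // cconj0.
  by apply: cL1_ez; exact: sL2_L1.
split; first by split=> [|k _]; [exact: sL2_conj|exact: key].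
by rewrite -[RHS](key 0%N); congr cint; apply/funext => t; rewrite ez0 mulr1.
Qed.

Lemma isometry_unitary (A : 'M[C]_n) : (forall v, vsq (A *m v) = vsq v) -> adjmx A *m A = 1%:M.
Proof.
move=> h; apply: mx_ext => v; rewrite mul1mx -mulmxA; apply: contr_isom => // w.
by rewrite h.
Qed.
Lemma unitary_isometry (A : 'M[C]_n) v : adjmx A *m A = 1%:M -> vsq (A *m v) = vsq v.
Proof. by move=> h; rewrite !vsqE vdot_adj mulmxA h mul1mx. Qed.

Variable Phi : R -> 'M[C]_n.
Hypotheses (hPhi : Linf Phi) (contr : hankel_norm_le Phi 1) (ess : hankel_ess_norm_lt1 Phi).
Local Notation Hk := (Hk Phi).
Variable U : R -> 'M[C]_n.
Hypothesis hU : unitary_interpolant Phi U.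

Let UL : Linf U. Proof. by case: hU. Qed.
Let Uu : aeD (fun t => adjmx (U t) *m U t = 1%:M). Proof. by case: hU => _ []. Qed.
Let UH : Hinf (fun t => Phi t - U t). Proof. by case: hU => _ []. Qed.

Let Uip f g : H2 f -> H2minus g -> ip (mulf U f) g = ip (Hk f) g.
Proof.
move=> hf hg; rewrite -(Hk_sub hPhi UH hf hg); congr (ip _ _).
by apply/funext => t; rewrite /mulf opprB addrC subrK.
Qed.
Let Udiff f : H2 f -> H2 (mulf U f - Hk f).
Proof.
move=> hf; have [_ h1] := HkP hPhi hf; have h2 := H2_mulf UH hf.
have -> : mulf U f - Hk f = (mulf Phi f - Hk f) - mulf (fun t => Phi t - U t) f.
  apply/funext => t; rewrite !fctE /mulf mulmxBl opprB.
  by rewrite [RHS]addrC addrA subrK.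
exact: H2_sub.
Qed.

(** The vector solves [s = H^* (zbar c + H s)]. The gap makes the defect form coercive on the
    orthogonal complement of the maximizing vectors, so the Riesz theorem provides [s] there; the
    equation extends to all of [H2] because both sides vanish on maximizing vectors, one of them by
    the assumption on [c]. *)
Lemma defect_vector (c : 'cV[C]_n) : c != 0 ->
  (forall m, maxv Phi m -> ip (Hk m) (shiftf (- 1) (cstf c)) = 0) ->
  exists s, [/\ H2 s, forall f, H2 f -> ip f s = ip (Hk f) (shiftf (- 1) (cstf c) + Hk s) &
    0 <= cRe (ip (Hk s) (shiftf (- 1) (cstf c)))].
Proof.
move=> c0 cM; set zc := shiftf (- 1) (cstf c).
have hzc : H2minus zc by exact: H2m_zbar.
have hzcL := H2m_L2 hzc.
have [e e0 he] := gap hPhi contr ess.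
pose S f := H2 f /\ forall g, maxv Phi g -> ip f g = 0.
have SH f : S f -> H2 f by case.
have SL f : S f -> L2 f by move=> /SH /H2_L2.
have hB : hform S (hkform Phi (@idf R n)).
  apply: hform_sub (hkform1 hPhi contr) SH _ _.
    split; first exact: H2_0.
    by move=> g [/H2_L2 hg _]; rewrite (hform0l ipf).
  move=> a u v [hu ou] [hv ov]; split; first exact: H2_lin.
  move=> g mg; have hg := H2_L2 (proj1 mg).
  by rewrite (hformL ipf a (H2_L2 hu) (H2_L2 hv) hg) ou // ov // mulr0 addr0.
have cB : hcomplete S (hkform Phi (@idf R n)).
  apply: (coercive_complete (e := e) (c := 1)) => //.
    move=> f [hf of_]; rewrite hkform1E; split; first exact: he.
    by rewrite mul1r gerBl N2_ge0.
  move=> u v Su hv uv; split; first by apply: H2_lim uv => // k; exact: SH.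
  move=> g mg; apply: hlim_inner uv _ => //; first by move=> k; exact: SL.
    exact: H2_L2 (proj1 mg).
  by move=> k; case: (Su k) => _; apply.
have [|f Sf|s Ss hs] := riesz (l := fun f => ip (Hk f) zc) (c := N2 zc / e) hB cB.
- by move=> a u v Su Sv; apply: (Hk_lin hPhi) => //; exact: SH.
- have hf := SH _ Sf; apply: le_trans (inner_CS (Hk_L2 hPhi hf) hzcL) _.
  rewrite hkform1E mulrC -mulrA; apply: ler_wpM2l; first exact: N2_ge0.
  have h1 := contrP hPhi contr hf; have := he _ hf (proj2 Sf) => h2.
  apply: le_trans h1 _; rewrite -(ler_pM2l e0) mulrA divff ?gt_eqF // mul1r //.
have hsH := SH _ Ss.
exists s; split=> //; last first.
  by rewrite -hs //; exact: (hform_ge0 hB).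
move=> f hf; have [p [mp pL op]] := maxv_proj hPhi contr (H2_L2 hf).
have pH := proj1 mp; have Sfp : S (f - p) by split; [exact: H2_sub|].
have := hs _ Sfp.
have -> : f - p = -1 *: p + f by rewrite scaleN1r addrC.
rewrite (hformL (hkform1 hPhi contr) (-1) pH hf hsH) (Hk_lin hPhi (-1) pH hf hzc).
rewrite (maxv_form0 hPhi contr mp hsH) cM // !mulr0 !add0r /hkform mulf1 => h.
rewrite (hformDr ipf hzcL (Hk_L2 hPhi hsH) (Hk_L2 hPhi hf)) -h; ring.
Qed.

(* With [s] from [defect_vector], [r := zbar c + H s] and [l := U^* r - s] in [H2minus], the
   function [a := |r|^2 - |s|^2] is a positive constant and [d := a - 2 l^* s] satisfies
   [Re d = |l|^2], so that [W := U (1 - (2 / d) l l^* )] is unitary. It interpolates [Phi]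
   because [z U l] and [zbar l^*] are analytic and [1 / d] is a limit of the analytic
   functions [1 / (d + e)]. *)
Lemma second_interpolant (c : 'cV[C]_n) : c != 0 ->
  (forall m, maxv Phi m -> ip (Hk m) (shiftf (- 1) (cstf c)) = 0) ->
  exists2 W, unitary_interpolant Phi W & ~ aeD (fun t => W t = U t).
Proof.
move=> c0 cM; have [s [sH sE s0]] := defect_vector c0 cM.
set zc := shiftf (- 1) (cstf c) in sE s0 *.
have hzc : H2minus zc by exact: H2m_zbar.
pose r := zc + Hk s.
have hHs := Hk_H2m hPhi sH.
have rH : H2minus r by exact: (hformDS (H2m_form R n)).
have rL := H2m_L2 rH; have sL := H2_L2 sH.
pose Ua t := adjmx (U t); have UaL : Linf Ua by exact: (Linf_adj UL).
have UUa : aeD (fun t => U t *m adjmx (U t) = 1%:M).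
  by apply: aeDS Uu => t _; exact: mulmx1C.
pose l := mulf Ua r - s.
have UarL := L2_mulf UaL rL.
have lL : L2 l by exact: (L2_sub UarL sL).
(* Here [<l, f> = <r, U f> - <s, f>], and the two terms are the conjugates of [<H f, r>] and
   [<f, s>], which agree by the choice of [s]. *)
have lH : H2minus l.
  apply: H2mI => // f hf; have hfL := H2_L2 hf.
  rewrite (hformBl ipf UarL sL hfL) inner_mulf.
  have -> : mulf (fun t => adjmx (Ua t)) f = mulf U f.
    by apply/funext => t; rewrite /mulf /Ua adjmxK.
  rewrite (hformC ipf (L2_mulf UL hfL) rL) (Uip hf rH) -sE // -(hformC ipf hfL sL).
  by rewrite subrr.
pose x := shiftf 1 (mulf U l).
have UlL := L2_mulf UL lL.
(* As [U U^* = 1], one has [U l = zbar c - (U s - H s)], and [U s - H s] is analytic. *)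
have xH : H2 x.
  have h1 : H2 (cstf c - shiftf 1%N (mulf U s - Hk s)).
    by apply: H2_sub; [exact: H2_cst|apply: H2_shift; exact: Udiff].
  apply: H2_ae h1 _ _; first exact: L2_vmeas (L2_shift 1 UlL).
  apply: aeDS UUa => t _ uu.
  have e1 : U t *m l t = zc t - (U t *m s t - Hk s t).
    rewrite /l !fctE /mulf mulmxBr mulmxA uu mul1mx /r !fctE.
    by rewrite opprB addrA addrAC.
  have e2 : ez 1 t *: zc t = c by rewrite /zc /shiftf /cstf scalerA ezK scale1r.
  by rewrite /x /shiftf /mulf e1 scalerBr e2.
pose rho t := vdot (r t) (r t) - vdot (s t) (s t).
have rr1 := L2_L1 rL rL; have ss1 := L2_L1 sL sL.
(* For [k > 0] the vector [z^k zbar c] lies in [H2] and is orthogonal to [r], so that [<z^k r, r> =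
   <z^k H s, r> = <H (z^k s), r> = <z^k s, s>]. *)
have rho_pos (k : nat) : (0 < k)%N -> cint (fun t => rho t * ez k t) = 0.
  move=> k0; have -> : (fun t => rho t * ez k t) = fun t =>
      vdot (shiftf k r t) (r t) - vdot (shiftf k s t) (s t).
    by apply/funext => t; rewrite /shiftf !vdotZl /rho; ring.
  rewrite cintB; [|exact: (L2_L1 (L2_shift k rL) rL)|exact: (L2_L1 (L2_shift k sL) sL)].
  rewrite -!ipE.
  have -> : shiftf k r = shiftf k zc + shiftf k (Hk s).
    by apply/funext => t; rewrite /shiftf /r !fctE scalerDr.
  have zcL := H2m_L2 hzc; have HsL := H2m_L2 hHs.
  rewrite (hformDl ipf (L2_shift k zcL) (L2_shift k HsL) rL).
  rewrite -(Hk_shift hPhi k sH rH) -sE; last exact: H2_shift.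
  have hz : H2 (shiftf k zc).
    have -> : shiftf k zc = shiftf k.-1%:Z (cstf c).
      rewrite /zc shiftfD; congr shiftf.
      by case: (k) k0 => // k' _; rewrite /= -addn1 PoszD addrK.
    by apply: H2_shift; exact: H2_cst.
  by rewrite addrK (H2m_orthr rH hz).
have rho_real t : cconj (rho t) = rho t by rewrite /rho !vdotvv cconjB !cconj_real.
have rho_const : aeD (fun t => rho t = cint rho / (2 * pi)%:C).
  apply: const_of_coefs; first exact: (cL1B rr1 ss1).
  case=> k k0; first by apply: rho_pos; rewrite lt0n.
  have -> : (fun t => rho t * ez (Negz k) t) = fun t => cconj (rho t * ez k.+1 t).
    by apply/funext => t; rewrite cconjM rho_real NegzE ezN.
  by rewrite cint_conj ?rho_pos ?cconj0 //; apply: cL1_ez; exact: (cL1B rr1 ss1).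
pose a := (N2 r - N2 s) / (2 * pi).
have aE : cint rho / (2 * pi)%:C = a%:C.
  rewrite cintB // -!ipE (inner_self rL) (inner_self sL).
  have p0 : (2 * pi)%:C != 0 :> C by rewrite -nsq_eq0 nsq_real expf_neq0 // gt_eqF // twopi_gt0.
  have e : a * (2 * pi) = N2 r - N2 s by rewrite /a divfK // gt_eqF // twopi_gt0.
  by apply: (mulIf p0); rewrite divfK //; apply: complexP; rewrite !cRIE ?e; ring.
(* The numerator equals [|zbar c|^2 + Re <H s, zbar c>]: the first term is positive because [c] is
   nonzero, the second is nonnegative by the last property of [s]. *)
have a0 : 0 < a.
  have zcL := H2m_L2 hzc; have HsL := H2m_L2 hHs.
  have e1 : ip r r = ip zc r + ip s s.
    by rewrite {1}/r (hformDl ipf zcL HsL rL) -(sE _ sH).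
  have e2 : ip zc r = ip zc zc + cconj (ip (Hk s) zc).
    by rewrite (hformDr ipf zcL HsL zcL) (hformC ipf HsL zcL).
  have : N2 r - N2 s = N2 zc + cRe (ip (Hk s) zc).
    by rewrite !N2_def e1 e2 !cRIE; ring.
  rewrite /a => ->; rewrite divr_gt0 ?twopi_gt0 // ltr_pwDl //.
  rewrite /zc N2_shift N2E -[Ri _]/(Ri (fun=> vsq c)) Ri_cst mulr_gt0 ?twopi_gt0 // lt_def vsq_ge0 andbT.
  by apply: contraNN c0 => /eqP /vsq_eq0 ->.
have rs : aeD (fun t => vsq (r t) - vsq (s t) = a).
  apply: aeDS rho_const => t _; rewrite aE /rho !vdotvv => /(congr1 (@cRe R)).
  by rewrite !cRIE.
pose d t : C := a%:C - 2 * vdot (s t) (l t).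
have Red : aeD (fun t => cRe (d t) = vsq (l t)).
  apply: aeDS2 UUa rs => t _ uu e; rewrite /d /l !fctE vsqB vdotBr !cRIE.
  have iso : vsq (mulf Ua r t) = vsq (r t).
    by apply: unitary_isometry; rewrite /Ua adjmxK.
  rewrite iso (vdotC (s t) (mulf Ua r t)) cRe_conj -vsqE.
  by rewrite -e; ring.
have md : cmeas d.
  apply: cmeasB; first exact: cmeas_cst.
  by apply: cmeasM; [exact: cmeas_cst|exact: cL1_meas (L2_L1 sL lL)].
pose lam i t := cconj (l t i 0).
have lamH i : sH2 (lam i) by have [] := H2m_conj i lH.
have lam1 i : sH2 (fun t => ez (- 1) t * lam i t).
  by have [h1 h2] := H2m_conj i lH; exact: sH2_unshift.
have mUl i : cmeas (fun t => (U t *m l t) i 0) by exact: (L2_vmeas UlL i).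
have ml i : cmeas (fun t => l t i 0) by exact: (L2_vmeas lL i).
have iUl : aeD (fun t => vsq (U t *m l t) = vsq (l t)).
  by apply: aeDS Uu => t _; exact: unitary_isometry.
(* The entries of [2 / (d + x0) U l l^*]. A positive [x0] supplies the strict lower bound on the
   real part that [reciprocal_sH2] asks for. Where [d = 0] also [l = 0], so the convention
   [0^-1 = 0] does no harm at [x0 = 0]. *)
pose psi (x0 : R) i j t : C := 2 * (d t + x0%:C)^-1 * ((U t *m l t) i 0 * cconj (l t j 0)).
have mpsi x0 i j : cmeas (psi x0 i j).
  apply: cmeasM; last by apply: cmeasM => //; exact: cmeas_conj.
  apply: cmeasM; first exact: cmeas_cst.
  by apply: cmeas_inv; apply: cmeasD => //; exact: cmeas_cst.
have n2 : nsq (2 : C) = 4.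
  by have -> : (2 : C) = (2 : R)%:C by [rewrite rmorph_nat|]; rewrite nsq_real; ring.
(* Each product of entries of [U l] and [l] is at most [|l|^2 = Re d], hence at most [|d + x0|].
   Being independent of [x0], the bound serves for dominated convergence as [x0] tends to 0. *)
have psi_bound : aeD (fun t => forall x0, 0 <= x0 -> forall i j, nsq (psi x0 i j t) <= 4).
  apply: aeDS2 Red iUl => t _ e1 e2 x0 p0 i j; rewrite /psi !nsqM n2 nsq_conj -mulrA.
  rewrite -[leRHS]mulr1 ler_pM2l //.
  have n1 := nsq_le_vsq (U t *m l t) i; have n3 := nsq_le_vsq (l t) j; rewrite e2 in n1.
  have q1 := nsq_ge0 ((U t *m l t) i 0); have q2 := nsq_ge0 (l t j 0).
  have h : nsq ((U t *m l t) i 0) * nsq (l t j 0) <= nsq (d t + x0%:C).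
    apply: le_trans (cRe_le_nsq _); rewrite cReD cRe_real e1.
    apply: (@le_trans _ _ (vsq (l t) * vsq (l t))); first exact: ler_pM.
    have v0 := vsq_ge0 (l t); nra.
  have [->|dn] := eqVneq (d t + x0%:C) 0; first by rewrite invr0 nsq0 mul0r.
  have dp := nsq_gt0 dn.
  by rewrite nsqV mulrC ler_pdivrMr // mul1r.
(* Three analytic factors: an entry of [z U l], the reciprocal of [d + x0], and the conjugate of an
   entry of [l] divided by [z], which is analytic because [l] lies in [H2minus]. *)
have psiH x0 i j (k : nat) : 0 < x0 -> (0 < k)%N -> cint (fun t => psi x0 i j t * ez k t) = 0.
  move=> p0 k0.
  have dE t : d t + x0%:C = (a%:C + x0%:C) + \sum_q lam q t * (-2 * s t q 0).
    rewrite /d /vdot mulr_sumr -sumrN addrAC; congr (_ + _); apply: eq_bigr => q _.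
    by rewrite /lam; ring.
  have sH' q : sH2 (fun t => -2 * s t q 0) by apply: sH2Z; have /H2P := sH; exact.
  have [|hinf hH] := reciprocal_sH2 lamH sH' p0 (c0 := a%:C + x0%:C).
    apply: aeDS Red => t _ e; rewrite -dE cReD cRe_real e addrC lerD2r.
    by rewrite /vsq; apply: ler_sum => q _; rewrite /lam nsq_conj.
  have hprod := sH2M hinf hH (lam1 j).
  have xi : sH2 (fun t => x t i 0) by have /H2P := xH; exact.
  have := sH2_prod (sH2Z 2 xi) hprod k0 => <-; congr cint; apply/funext => t.
  rewrite -dE /psi /x /shiftf [in RHS]mxE /lam /mulf.
  move: (ez 1 t) (ez (-1) t) (@ezK R 1 t) (d t + x0%:C)^-1 ((U t *m l t) i 0) => y w yw b z.
  by rewrite [2 * (y * z)]mulrC -!mulrA [y * _]mulrC !mulrA -[LHS]mulr1 -yw; ring.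
have psi0H i j (k : nat) : (0 < k)%N -> cint (fun t => psi 0 i j t * ez k t) = 0.
  move=> k0; pose F (q : nat) t := psi q.+1%:R^-1 i j t * ez k t.
  apply: (cdct (F := F) (g := fun=> 2)).
  - by move=> q; apply: cmeasM => //; exact: cmeas_ez.
  - by apply: cmeasM => //; exact: cmeas_ez.
  - exact: rint_cst.
  - apply: aeDS2 Red iUl => t _ e1 e2.
    pose y (q : nat) : R := q.+1%:R^-1.
    have cy : y @ \oo --> (0 : R) by exact: cvg_harmonic.
    pose z := 2 * ((U t *m l t) i 0 * cconj (l t j 0)) * ez k t.
    have FE q : F q t = (d t + (y q)%:C)^-1 * z by rewrite /F /psi /z /y; ring.
    have fE : psi 0 i j t * ez k t = (d t)^-1 * z.
      by rewrite /psi /z rmorph0 addr0; ring.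
    have [d0|dn] := eqVneq (d t) 0.
      have l0 : l t = 0 by apply: vsq_eq0; rewrite -e1 d0.
      have z0 : z = 0 by rewrite /z l0 mulmx0 mxE mul0r mulr0 mul0r.
      rewrite fE z0 mulr0; under eq_cvg do rewrite FE z0 mulr0.
      split; last by under eq_cvg do rewrite FE z0 mulr0; exact: cvg_cst.
      exact: cvg_cst.
    have dp := nsq_gt0 dn.
    have cn : (nsq (d t + (y q)%:C))^-1 @[q --> \oo] --> (nsq (d t))^-1.
      apply: cvgV; first by rewrite gt_eqF.
      have -> : (fun q => nsq (d t + (y q)%:C)) = fun q =>
          (cRe (d t) + y q) * (cRe (d t) + y q) + cIm (d t) * cIm (d t).
        by apply/funext => q; rewrite /nsq cReD cImD cRe_real cIm_real !expr2 addr0.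
      have -> : nsq (d t) = (cRe (d t) + 0) * (cRe (d t) + 0) + cIm (d t) * cIm (d t).
        by rewrite /nsq !expr2 addr0.
      apply: cvgD; last exact: cvg_cst.
      by apply: cvgM; apply: cvgD => //; exact: cvg_cst.
    have invE (w : C) : (cRe (w^-1 * z) = (nsq w)^-1 * (cRe w * cRe z + cIm w * cIm z)) /\
        (cIm (w^-1 * z) = (nsq w)^-1 * (cRe w * cIm z - cIm w * cRe z)).
      by rewrite cinvE !cRIE; split; ring.
    rewrite fE; have [-> ->] := invE (d t); split.
    + have -> : (fun q => cRe (F q t)) = fun q => (nsq (d t + (y q)%:C))^-1 *
          ((cRe (d t) + y q) * cRe z + cIm (d t) * cIm z).
        by apply/funext => q; rewrite FE; have [-> _] := invE (d t + (y q)%:C); rewrite cReD cImD cRe_real cIm_real addr0.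
      apply: cvgM => //; apply: cvgD; last exact: cvg_cst.
      apply: cvgM; last exact: cvg_cst.
      by rewrite -[X in _ --> X]addr0; apply: cvgD => //; exact: cvg_cst.
    + have -> : (fun q => cIm (F q t)) = fun q => (nsq (d t + (y q)%:C))^-1 *
          ((cRe (d t) + y q) * cIm z - cIm (d t) * cRe z).
        by apply/funext => q; rewrite FE; have [_ ->] := invE (d t + (y q)%:C); rewrite cReD cImD cRe_real cIm_real addr0.
      apply: cvgM => //; apply: cvgB; last exact: cvg_cst.
      apply: cvgM; last exact: cvg_cst.
      by rewrite -[X in _ --> X]addr0; apply: cvgD => //; exact: cvg_cst.
  - apply: aeDS psi_bound => t _ h q.
    have {}h : nsq (F q t) <= 4 by rewrite /F nsqM nsq_ez mulr1; apply: h; rewrite invr_ge0.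
    split; rewrite -ler_sqr ?nnegrE // real_normK ?num_real //.
    + by apply: le_trans (cRe_le_nsq _) _; apply: le_trans h _; rewrite expr2 -natrM.
    + by apply: le_trans (cIm_le_nsq _) _; apply: le_trans h _; rewrite expr2 -natrM.
  - by move=> q; apply: psiH => //; rewrite invr_gt0.
pose Psi t : 'M[C]_n := \matrix_(i, j) psi 0 i j t.
have PsiH : Hinf Psi.
  apply/HinfP => i j; have inf : sLinf (fun t => Psi t i j).
    under eq_fun do rewrite mxE; split=> //; exists 4.
    by apply: aeDS psi_bound => t _; exact.
  split=> //; split; first exact: sLinf_sL2.
  by move=> k k0; under eq_fun do rewrite mxE; exact: psi0H.
pose W t := U t - Psi t.
have WL : Linf W by exact: (Linf_sub UL (Hinf_Linf PsiH)).
have PsiE t v : Psi t *m v = (2 * (d t)^-1 * vdot v (l t)) *: (U t *m l t).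
  apply/matrixP => i j; rewrite (ord1 j) [LHS]mxE [RHS]mxE /vdot mulr_sumr mulr_suml.
  apply: eq_bigr => q _; rewrite [Psi t i q]mxE /psi rmorph0 addr0; ring.
(* After removing [U], the squared norm changes by [4 |<v, l>|^2 (|l|^2 - Re d) / |d|^2], which is
   0. *)
have Wiso : aeD (fun t => forall v, vsq (W t *m v) = vsq v).
  apply: aeDS2 Uu Red => t _ uu e v.
  have -> : W t *m v = U t *m (v - (2 * (d t)^-1 * vdot v (l t)) *: l t).
    by rewrite /W mulmxBl PsiE [RHS]mulmxBr -scalemxAr.
  rewrite unitary_isometry // vsqB vsqZ vdotZr !nsqM n2.
  have [d0|dn] := eqVneq (d t) 0.
    by rewrite d0 invr0 nsq0 !(mulr0, mul0r) cconj0 mul0r cRe0; ring.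
  have dp := nsq_gt0 dn.
  rewrite nsqV.
  have -> : cRe (cconj (2 * (d t)^-1 * vdot v (l t)) * vdot v (l t)) =
      2 * ((nsq (d t))^-1 * cRe (d t)) * nsq (vdot v (l t)).
    rewrite !cconjM -mulrA [cconj (vdot _ _) * _]mulrC mulcconj cconj_nat cinvE.
    rewrite cconjM cconj_real cconjK.
    have -> : (2 : C) = (2 : R)%:C by rewrite rmorph_nat.
    by rewrite !cRIE; ring.
  by rewrite e; ring.
exists W.
  split; first exact: WL.
  split; first by apply: aeDS Wiso => t _; exact: isometry_unitary.
  have -> : (fun t => Phi t - W t) = fun t => (Phi t - U t) + Psi t.
    by apply/funext => t; rewrite /W opprB addrCA addrC.
  move/HinfP: UH => h1; move/HinfP: PsiH => h2; apply/HinfP => i j.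
  have [a1 a2] := h1 i j; have [b1 b2] := h2 i j.
  under eq_fun do rewrite mxE; split; first exact: sLinfD.
  exact: sH2D.
(* If [W = U] then [l = 0] almost everywhere, so [Re d = |l|^2] has integral 0; but [s] and [l] are
   orthogonal, so [d] has integral [2 pi a > 0]. *)
move=> WU.
have l0 : aeD (fun t => vsq (l t) = 0).
  apply: aeDS2 WU (aeD2 Red iUl) => t _ h [e1 e2].
  have P0 : Psi t = 0 by rewrite -[LHS](subKr (U t)) -/(W t) h subrr.
  have := PsiE t (l t); rewrite P0 mul0mx vdotvv => /(congr1 (@vsq R n)).
  rewrite vsq0 vsqZ e2 !nsqM n2 nsq_real => /esym/eqP.
  have [-> //|v0] := eqVneq (vsq (l t)) 0.
  have dn : d t != 0 by apply/eqP => d0; move: v0; rewrite -e1 d0 cRe0 eqxx.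
  by rewrite !mulf_eq0 (negbTE v0) !orbF pnatr_eq0 /= nsq_eq0 invr_eq0 (negbTE dn).
have i0 : Ri (fun t => vsq (l t)) = 0.
  have -> : Ri (fun t => vsq (l t)) = Ri (fun=> 0); last by rewrite Ri_cst mul0r.
  by apply: Ri_ae => //; [exact: rint_meas (L2_rint lL)|exact: rmeas_cst].
have : Ri (fun t => cRe (d t)) = 0.
  by rewrite -i0; apply: Ri_ae => //; [case: md|exact: rint_meas (L2_rint lL)].
rewrite -cRe_cint.
have slL1 := L2_L1 sL lL.
have -> : cint d = a%:C * (2 * pi)%:C - 2 * ip s l.
  rewrite /d cintB; [|exact: cL1_cst|exact: cL1Z].
  by rewrite cint_cst cintZ // -ipE.
rewrite (H2m_orthr lH sH) mulr0 subr0 -rmorphM /= => h.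
by have := mulr_gt0 a0 (twopi_gt0 R); rewrite h ltxx.
Qed.

End SecondInterpolant.

(** * A unique interpolant forces the superoptimal singular values to be 1 *)

Section Superoptimal.
Variable R : realType.
Local Notation D := (@circD R).
Local Notation C := (complex R).
Variable n : nat.
Local Notation V := (R -> 'cV[C]_n).
Local Notation ip := (@ip R n).
Implicit Types f g h : V.
Let ipf := inner_hform R n.

Lemma sval0 (A : 'M[C]_n) : Defs.sval 0 A = opnorm A.
Proof.
apply/eqP; rewrite eq_le sval_le_opnorm /=; apply: lb_le_inf.
  by exists (opnorm (A - 0)); exists 0 => //=; rewrite mxrank0.
by move=> _ [B /= + <-]; rewrite leqn0 mxrank_eq0 => /eqP ->; rewrite subr0.
Qed.

Lemma esssup_const (g : R -> R) (c : R) : aeD (fun t => g t = c) -> esssupD g = c%:E.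
Proof.
move=> gc; apply/eqP; rewrite eq_le; apply/andP; split.
  by apply/esssup_leP; apply: aeDS gc => t _ ->.
apply: le_ereal_inf_tmp => y hy; apply: (@aeD_const R).
by apply: aeDS2 gc hy => t _ ->.
Qed.

Lemma ereal_inf_attained (S : set (\bar R)) (y : \bar R) :
  S y -> (forall x, S x -> (y <= x)%E) -> ereal_inf S = y.
Proof.
move=> Sy yS; apply/eqP; rewrite eq_le; apply/andP; split; first exact: ereal_inf_lbound.
exact: le_ereal_inf_tmp.
Qed.

Lemma dev0_le (Phi F : R -> 'M[C]_n) (a : R) : 0 <= a -> (dev Phi 0 F <= a%:E)%E ->
  aeD (fun t => forall v, vsq ((Phi t - F t) *m v) <= a ^+ 2 * vsq v).
Proof.
move=> a0 /esssup_leP; apply: aeDS => t _; rewrite sval0 => h v.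
apply: le_trans (opnorm_ge _ v) _; apply: ler_wpM2r; first exact: vsq_ge0.
by rewrite ler_sqr ?nnegrE // opnorm_ge0.
Qed.

(** Up to null sets [F0] is the only contractive competitor, so it is the only element of every
    [Omega] with index below [n], and a unitary matrix has all singular values 1. A competitor with
    essential supremum below 1 would itself coincide with [F0], where the value is 1. *)
Lemma superopt_of_unique (Phi F0 : R -> 'M[C]_n) : Hinf F0 ->
  aeD (fun t => adjmx (Phi t - F0 t) *m (Phi t - F0 t) = 1%:M) ->
  (forall F, Hinf F -> aeD (fun t => forall v, vsq ((Phi t - F t) *m v) <= vsq v) ->
    aeD (fun t => F t = F0 t)) ->
  forall j, (j < n)%N -> superopt_sv Phi j = 1%:E.
Proof.
move=> hF0 unit uniq.
have dev1 F j : (j < n)%N -> aeD (fun t => F t = F0 t) -> dev Phi j F = 1%:E.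
  move=> jn h; apply: esssup_const; apply: aeDS2 unit h => t _ u ->.
  exact: sval_unitary.
have lt0 F : Hinf F -> (dev Phi 0 F <= 1%:E)%E -> aeD (fun t => F t = F0 t).
  move=> hF h; apply: uniq => //; apply: aeDS (dev0_le ler01 h) => t _ {}h v.
  by have := h v; rewrite expr1n mul1r.
have refl : aeD (fun t => F0 t = F0 t) by exact: aeDT.
have step j : (j < n)%N -> [/\ superopt_sv Phi j = 1%:E, Omega Phi j F0 &
    forall F, Omega Phi j F -> aeD (fun t => F t = F0 t)].
  elim: j => [|j IH] jn.
    have e : superopt_sv Phi 0 = 1%:E.
      apply: ereal_inf_attained; first by exists F0 => //; exact: dev1.
      move=> _ [G hG <-]; rewrite leNgt; apply/negP => h.
      by move: (h); rewrite (dev1 G 0%N jn) ?ltxx //; apply: lt0 => //; exact: ltW.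
    split=> //; first by split=> //; rewrite dev1.
    by move=> F [hF h]; apply: lt0 => //; rewrite h -[X in (X <= _)%E]/(superopt_sv Phi 0) e.
  have [_ o1 o2] := IH (ltnW jn).
  have e : superopt_sv Phi j.+1 = 1%:E.
    apply: ereal_inf_attained; first by exists F0 => //; exact: dev1.
    by move=> _ [G hG <-]; rewrite (dev1 G _ jn) //; exact: o2.
  split=> //; first by split=> //; rewrite dev1.
  by move=> F [/o2].
by move=> j /step [].
Qed.

Variable Phi : R -> 'M[C]_n.
Hypotheses (hPhi : Linf Phi) (contr : hankel_norm_le Phi 1) (ess : hankel_ess_norm_lt1 Phi).
Local Notation Hk := (Hk Phi).

(** Since [H m] lies in [H2minus], its pairing with [zbar f] sees only the constant coefficient of
    [f], and [noc] forces that coefficient to be 0. Pointwise orthogonality survives division by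
    [z], so the argument repeats and removes all coefficients. *)
Lemma orth_max_images f :
  (forall c, (forall m, maxv Phi m -> ip (Hk m) (shiftf (- 1) (cstf c)) = 0) -> c = 0) ->
  H2 f -> (forall m, maxv Phi m -> aeD (fun t => vdot (f t) (Hk m t) = 0)) ->
  aeD (fun t => f t = 0).
Proof.
move=> noc hf fm.
have mean0 g : H2 g -> (forall m, maxv Phi m -> ip (shiftf (- 1) g) (Hk m) = 0) ->
    forall i, cint (fun t => g t i 0) = 0.
  move=> hg gm; pose c : 'cV[C]_n := \col_i (cint (fun t => g t i 0) / (2 * pi)%:C).
  have p0 : (2 * pi)%:C != 0 :> C.
    by rewrite -nsq_eq0 nsq_real expf_neq0 // gt_eqF // twopi_gt0.
  have hgc : H2 (shiftf (- 1) (g - cstf c)).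
    apply: H2_unshift => [|i]; first exact: H2_sub hg (H2_cst c).
    have -> : (fun t => (g - cstf c) t i 0) = fun t => g t i 0 - c i 0.
      by apply/funext => t; rewrite !fctE !mxE.
    rewrite cintB; [|by apply: sL2_L1; exact: (iffLR (L2P _) (H2_L2 hg))|exact: cL1_cst].
    by rewrite cint_cst mxE divfK // subrr.
  have c0 : c = 0.
    apply: noc => m mm; have hm := Hk_H2m hPhi (proj1 mm); have hmL := H2m_L2 hm.
    have gL := L2_shift (- 1) (H2_L2 hg); have cL := L2_shift (- 1) (L2_cst c).
    have := gm m mm.
    have -> : shiftf (- 1) g = shiftf (- 1) (g - cstf c) + shiftf (- 1) (cstf c).
      by rewrite shiftfB subrK.
    rewrite (hformDl ipf (H2_L2 hgc) cL hmL) (H2m_orthr hm hgc) add0r => h.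
    by rewrite (hformC ipf cL hmL) h cconj0.
  move=> i; have := congr1 (fun v : 'cV[C]_n => v i 0) c0; rewrite !mxE => /eqP.
  by rewrite mulf_eq0 invr_eq0 (negbTE p0) orbF => /eqP.
have tail (N : nat) : H2 (shiftf (- N%:Z) f) /\
    forall i, cint (fun t => shiftf (- N%:Z) f t i 0) = 0.
  have orth (k : int) m : maxv Phi m -> ip (shiftf k f) (Hk m) = 0.
    move=> mm; rewrite ipE -[RHS](mul0r (2 * pi)%:C) -cint_cst.
    have hmL := H2m_L2 (Hk_H2m hPhi (proj1 mm)).
    apply: cint_ae; [exact: cL1_meas (L2_L1 (L2_shift k (H2_L2 hf)) hmL)|exact: cmeas_cst|].
    by apply: aeDS (fm m mm) => t _ h; rewrite /shiftf vdotZl h mulr0.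
  elim: N => [|N [h1 h2]].
    rewrite oppr0 shiftf0; split; first exact: hf.
    by apply: (mean0 _ hf) => m mm; exact: orth.
  have e : shiftf (- 1) (shiftf (- N%:Z) f) = shiftf (- N.+1%:Z) f.
    by rewrite shiftfD -opprD; congr (shiftf (- _)); rewrite -addn1 PoszD addrC.
  have hN : H2 (shiftf (- N.+1%:Z) f) by rewrite -e; exact: H2_unshift.
  split; first exact: hN.
  apply: (mean0 _ hN) => m mm; rewrite shiftfD; exact: orth.
apply: (H2_coef0 hf) => i k; have [_ /(_ i) <-] := tail k.
by congr cint; apply/funext => t; rewrite mxE mulrC.
Qed.

(** By [maxv_contr] both [(Phi - F)^*] and [(Phi - G)^*] send [H m] to [m], so the columns of
    [F - G] are pointwise orthogonal to all [H m]. *)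
Lemma contractive_unique (F G : R -> 'M[C]_n) :
  (forall c, (forall m, maxv Phi m -> ip (Hk m) (shiftf (- 1) (cstf c)) = 0) -> c = 0) ->
  Hinf F -> Hinf G ->
  aeD (fun t => forall v, vsq ((Phi t - F t) *m v) <= vsq v) ->
  aeD (fun t => forall v, vsq ((Phi t - G t) *m v) <= vsq v) -> aeD (fun t => F t = G t).
Proof.
move=> noc hF hG cF cG.
have col0 (j : 'I_n) : aeD (fun t => col j (F t - G t) = 0).
  apply: (orth_max_images noc).
    apply/H2P => i; have [_ h1] := iffLR (HinfP _) hF i j; have [_ h2] := iffLR (HinfP _) hG i j.
    by have := sH2B h1 h2; congr sH2; apply/funext => t; rewrite !mxE.
  move=> m mm; have h1 := maxv_contr hPhi hF cF mm.
  have h2 := maxv_contr hPhi hG cG mm; apply: aeDS2 h1 h2 => t _ [_ e1] [_ e2].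
  rewrite colE vdot_adj.
  suff -> : adjmx (F t - G t) *m Hk m t = 0 by rewrite /vdot big1 // => i _; rewrite [X in cconj X]mxE cconj0 mulr0.
  have -> : adjmx (F t - G t) = adjmx (Phi t - G t) - adjmx (Phi t - F t).
    by apply/matrixP => a b; rewrite !(mxE, adjmxE) -!cconjB; congr cconj; ring.
  by rewrite mulmxBl e1 e2 subrr.
apply: aeDS (aeD_fin col0) => t _ h; apply/eqP; rewrite -subr_eq0; apply/eqP/matrixP => i j.
by have := congr1 (fun v : 'cV[C]_n => v i 0) (h j); rewrite !mxE.
Qed.

Lemma superopt_of_unique_interpolant : unique_unitary_interpolant Phi ->
  forall j, (j < n)%N -> superopt_sv Phi j = 1%:E.
Proof.
move=> [U [hU uU]]; have [UL [Uu UH]] := hU.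
have UE t : Phi t - (Phi t - U t) = U t by rewrite opprB addrC subrK.
have noc c : (forall m, maxv Phi m -> ip (Hk m) (shiftf (- 1) (cstf c)) = 0) -> c = 0.
  move=> h; have [//|c0] := eqVneq c 0.
  have [W hW []] := second_interpolant hPhi contr ess hU c0 h.
  exact: uU.
apply: (superopt_of_unique UH); first by apply: aeDS Uu => t _; rewrite UE.
move=> F hF cF; apply: (contractive_unique noc hF UH cF).
by apply: aeDS Uu => t _ u v; rewrite UE unitary_isometry.
Qed.

End Superoptimal.

(** * The weighted Nehari theorem for a coercive form *)

Section StrictNehari.
Variable R : realType.
Local Notation D := (@circD R).
Local Notation C := (complex R).
Variable n : nat.
Local Notation V := (R -> 'cV[C]_n).
Local Notation ip := (@ip R n).
Implicit Types f g h : V.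
Let ipf := inner_hform R n.

Lemma hform_suml (U : lmodType C) (S : U -> Prop) (B : U -> U -> C) (I : Type) (r : seq I)
    (a : I -> C) (u : I -> U) w : hform S B -> (forall i, S (u i)) -> S w ->
  S (\sum_(i <- r) a i *: u i) /\
  B (\sum_(i <- r) a i *: u i) w = \sum_(i <- r) a i * B (u i) w.
Proof.
move=> hB Su Sw; elim: r => [|i r [IS IB]].
  by rewrite !big_nil (hform0l hB Sw); split=> //; exact: hform0 hB.
by rewrite !big_cons (hformL hB _ (Su i) IS Sw) IB; split=> //; apply: (hformS hB).
Qed.

Lemma inj_unitmx (A : 'M[C]_n) : (forall v : 'cV_n, A *m v = 0 -> v = 0) -> A \in unitmx.
Proof.
move=> h; rewrite -unitmx_tr -row_free_unit -kermx_eq0.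
apply/eqP/row_matrixP => i; rewrite row0.
have := h (row i (kermx A^T))^T.
have -> : A *m (row i (kermx A^T))^T = 0.
  by rewrite -[LHS]trmxK trmx_mul trmxK -row_mul mulmx_ker row0 trmx0.
by move=> /(_ erefl) /(congr1 trmx); rewrite trmxK trmx0.
Qed.

Lemma cRe_vdot_le m (u v : 'cV[C]_m) : cRe (vdot u v) <= vsq u + vsq v.
Proof.
have := vsq_ge0 (u - v); rewrite vsqB => h.
have h1 := vsq_ge0 u; have h2 := vsq_ge0 v; lra.
Qed.

Lemma vdot_delta m (u : 'cV[C]_m) i : vdot u (delta_mx i 0) = u i 0.
Proof.
rewrite /vdot (bigD1 i) //= big1 ?addr0 => [|k ki].
  by rewrite [X in cconj X]mxE !eqxx cconj1 mulr1.
by rewrite [X in cconj X]mxE eqxx andbT (negbTE ki) cconj0 mulr0.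
Qed.
Lemma vsq_delta m i : vsq (delta_mx i 0 : 'cV[C]_m) = 1.
Proof. by rewrite vsqE vdot_delta mxE !eqxx cRe1. Qed.

Lemma cmeas_det m (F : R -> 'M[C]_m) : mxmeas F -> cmeas (fun t => \det (F t)).
Proof.
move=> hF; apply: cmeas_sum => s; apply: cmeasM; first exact: cmeas_cst.
by apply: cmeas_prod => i; exact: hF.
Qed.

(** Cramer's formula shows measurability. It agrees with [invmx] only at invertible matrices, since
    [invmx] returns a singular matrix unchanged. *)
Lemma mxmeas_inv m (F : R -> 'M[C]_m) : mxmeas F -> aeD (fun t => F t \in unitmx) ->
  exists2 X : R -> 'M[C]_m, mxmeas X & aeD (fun t => X t = invmx (F t)).
Proof.
move=> hF uF; exists (fun t => (\det (F t))^-1 *: \adj (F t)).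
  move=> i j; rewrite (_ : (fun t => _) = fun t => (\det (F t))^-1 * cofactor (F t) j i); last first.
    by apply/funext => t; rewrite !mxE.
  apply: cmeasM; first by apply: cmeas_inv; exact: cmeas_det.
  apply: cmeasM; first exact: cmeas_cst.
  apply: cmeas_det => a b; rewrite (_ : (fun t => _) = fun t => F t (lift j a) (lift i b)) //.
  by apply/funext => t; rewrite !mxE.
by apply: aeDS uF => t _; rewrite /invmx => ->.
Qed.

Definition mean f : 'cV[C]_n := \col_i (cint (fun t => f t i 0) / (2 * pi)%:C).

Let p0 : (2 * pi)%:C != 0 :> C.
Proof. by rewrite -nsq_eq0 nsq_real expf_neq0 // gt_eqF // twopi_gt0. Qed.

Lemma ip_cst f c : L2 f -> ip f (cstf c) = vdot (mean f) c * (2 * pi)%:C.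
Proof.
move=> hf; rewrite inner_sum //; last exact: L2_cst.
rewrite /vdot mulr_suml; apply: eq_bigr => i _; rewrite mxE.
have -> : (fun t => f t i 0 * cconj (cstf c t i 0)) = fun t => cconj (c i 0) * f t i 0.
  by apply/funext => t; rewrite mulrC.
rewrite cintZ; last by apply: sL2_L1; exact: (iffLR (L2P _) hf).
by rewrite mulrAC divfK // mulrC.
Qed.

Lemma H2_unshift_mean f : H2 f -> mean f = 0 -> H2 (shiftf (- 1) f).
Proof.
move=> hf m0; apply: (H2_unshift hf) => i.
by have := congr1 (fun v : 'cV[C]_n => v i 0 * (2 * pi)%:C) m0; rewrite !mxE mul0r divfK.
Qed.

Variables (Phi W : R -> 'M[C]_n) (delta : R).
Hypotheses (hPhi : Linf Phi) (hW : Linf W) (herm : aeD (fun t => adjmx (W t) = W t)).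
Hypotheses (d0 : 0 < delta)
  (coer : forall f, H2 f -> delta * N2 f <= cRe (hkform Phi W f f)).
Local Notation Hk := (Hk Phi).
Local Notation B := (hkform Phi W).

Let hB : hform (@H2 R n) B.
Proof.
apply: hkform_hform => // f hf; apply: le_trans (coer hf).
by rewrite mulr_ge0 ?N2_ge0 // ltW.
Qed.

Let bdW : exists2 M : R, 0 < M & aeD (fun t => forall v, vsq (W t *m v) + vsq v <= M * vsq v).
Proof.
have [M M0 h] := Linf_bound hW; exists (M + 1); first by rewrite ltr_wpDl.
by apply: aeDS h => t _ {}h v; rewrite mulrDl mul1r lerD2r.
Qed.
Let M : R := projT1 (cid2 bdW).
Let M0 : 0 < M. Proof. by rewrite /M; case: cid2. Qed.
Let MW : aeD (fun t => forall v, vsq (W t *m v) + vsq v <= M * vsq v).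
Proof. by rewrite /M; case: cid2. Qed.

Let B_le f : H2 f -> cRe (B f f) <= M * N2 f.
Proof.
move=> hf; have hfL := H2_L2 hf; have hWf := L2_mulf hW hfL.
have r1 := L2_rint hWf; have r2 := L2_rint hfL.
apply: (@le_trans _ _ (N2 (mulf W f) + N2 f)).
  rewrite /hkform cReD cReN -/(N2 (Hk f)); have h1 := N2_ge0 (Hk f).
  have := N2_ge0 (mulf W f - f); rewrite (N2B hWf hfL).
  have h2 := N2_ge0 (mulf W f); have h3 := N2_ge0 f.
  move: (cRe (ip (mulf W f) f)) (N2 (Hk f)) (N2 (mulf W f)) (N2 f) h1 h2 h3 => *; lra.
rewrite !N2E -RiD // -RiZ //; apply: Ri_le_ae; [exact: rintD|exact: rintZ|].
by apply: aeDS MW => t _; exact.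
Qed.

(** By [ip_cst] the represented functional is evaluation at the origin paired with [c], up to
    [2 pi]; [p] is the reproducing kernel at the origin for the form [B]. *)
Let repr (c : 'cV[C]_n) : exists2 p, H2 p & forall f, H2 f -> B f p = ip f (cstf c).
Proof.
apply: (riesz hB (c := N2 (cstf c) / delta)).
- apply: (coercive_complete (e := delta) (c := M)) => //; first by move=> f /H2_L2.
    by move=> f hf; split; [exact: coer|exact: B_le].
  by move=> u v Hu hv uv; exact: (H2_lim Hu hv uv).
- by move=> a u v hu hv; apply: (hformL ipf); [exact: H2_L2|exact: H2_L2|exact: L2_cst].
- move=> f hf; apply: le_trans (inner_CS (H2_L2 hf) (L2_cst c)) _.
  rewrite mulrC -mulrA ler_wpM2l ?N2_ge0 // -(ler_pM2l d0) mulrA divff ?gt_eqF // mul1r.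
  exact: coer.
Qed.

Let p (j : 'I_n) : V := projT1 (cid2 (repr (delta_mx j 0))).
Let pH j : H2 (p j). Proof. by rewrite /p; case: cid2. Qed.
Let pE j f : H2 f -> B f (p j) = ip f (cstf (delta_mx j 0)).
Proof. by rewrite /p; case: cid2 => x hx h; exact: h. Qed.

(* [P^* W P - Q^* Q] turns out to be the constant matrix [A], so [F := Phi - Q P^-1] will do
   once [P^-1] is known to be analytic. *)
Let P t : 'M[C]_n := \matrix_(i, j) p j t i 0.
Let Q t : 'M[C]_n := \matrix_(i, j) Hk (p j) t i 0.
Let pc (c : 'cV[C]_n) : V := fun t => P t *m c.

Let pcE c : pc c = \sum_j c j 0 *: p j.
Proof.
apply/funext => t; rewrite fct_sumE; apply/matrixP => i j; rewrite (ord1 j) summxE mxE.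
by apply: eq_bigr => k _; rewrite !mxE mulrC.
Qed.
Let pcH c : H2 (pc c).
Proof. by rewrite pcE; case: (hform_suml (index_enum _) (fun j => c j 0) hB pH (H2_0 R n)). Qed.
Let pc_form c f : H2 f -> B (pc c) f = ip (cstf c) f.
Proof.
move=> hf; rewrite pcE.
have [_ ->] := hform_suml (index_enum _) (fun j => c j 0) hB pH hf.
rewrite (hformC ipf (H2_L2 hf) (L2_cst c)) (ip_cst c (H2_L2 hf)) /vdot mulr_suml cconj_sum.
apply: eq_bigr => j _; rewrite (hformC hB hf (pH j)) pE // (ip_cst _ (H2_L2 hf)).
by rewrite vdot_delta !cconjM cconjK mulrA [c j 0 * _]mulrC.
Qed.
Let pc_formr c f : H2 f -> B f (pc c) = ip f (cstf c).
Proof.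
move=> hf; rewrite (hformC hB (pcH c) hf) pc_form // -(hformC ipf (L2_cst c)) //.
exact: H2_L2.
Qed.

Let G t : 'M[C]_n := adjmx (P t) *m (W t *m P t) - adjmx (Q t) *m Q t.
Let A : 'M[C]_n := \matrix_(i, j) mean (p j) i 0.

Let mx_entry (X : 'M[C]_n) i j : X i j = vdot (X *m delta_mx j 0) (delta_mx i 0).
Proof.
by rewrite vdot_delta -colE mxE.
Qed.
Let Pcol t j : P t *m delta_mx j 0 = p j t.
Proof. by rewrite -colE; apply/matrixP => i k; rewrite (ord1 k) !mxE. Qed.
Let Qcol t j : Q t *m delta_mx j 0 = Hk (p j) t.
Proof. by rewrite -colE; apply/matrixP => i k; rewrite (ord1 k) !mxE. Qed.

Let GE t c e : vdot (G t *m c) e =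
  vdot (W t *m (P t *m c)) (P t *m e) - vdot (Q t *m c) (Q t *m e).
Proof. by rewrite /G mulmxBl vdotBl -!mulmxA !vdot_adj !adjmxK. Qed.
Let Gij t i j : G t i j = vdot (mulf W (p j) t) (p i t) - vdot (Hk (p j) t) (Hk (p i) t).
Proof. by rewrite mx_entry GE !Pcol !Qcol. Qed.
Let G_L1 i j : cL1 (fun t => G t i j).
Proof.
under eq_fun do rewrite Gij; apply: cL1B.
  exact: (L2_L1 (L2_mulf hW (H2_L2 (pH j))) (H2_L2 (pH i))).
exact: (L2_L1 (Hk_L2 hPhi (pH j)) (Hk_L2 hPhi (pH i))).
Qed.
(** The coefficient is [B (z^k p_j) p_i], which the reproducing property of [p_i] turns into a mean
    of [z^k p_j], equal to 0 for [k > 0]. As [G] is Hermitian, it is therefore constant. *)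
Let G_coef i j (k : nat) :
  cint (fun t => G t i j * ez k t) = ip (shiftf k (p j)) (cstf (delta_mx i 0)).
Proof.
rewrite -pE; last exact: H2_shift.
rewrite (hkform_shift hPhi W k (pH j) (pH i)) !ipE -cintB; first last.
- exact: (L2_L1 (L2_shift k (Hk_L2 hPhi (pH j))) (Hk_L2 hPhi (pH i))).
- exact: (L2_L1 (L2_shift k (L2_mulf hW (H2_L2 (pH j)))) (H2_L2 (pH i))).
by congr cint; apply/funext => t; rewrite Gij /shiftf !vdotZl; ring.
Qed.
Let G_herm : aeD (fun t => forall i j, G t j i = cconj (G t i j)).
Proof.
apply: aeDS herm => t _ h i j; rewrite !Gij cconjB -!vdotC; congr (_ - _).
by rewrite /mulf -{1}h -vdot_adjr.
Qed.
Let G_const : aeD (fun t => G t = A).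
Proof.
have Gpos i j (k : nat) : (0 < k)%N -> cint (fun t => G t i j * ez k t) = 0.
  case: k => // k _; rewrite G_coef ip_cst; last by apply: L2_shift; exact: H2_L2.
  suff -> : mean (shiftf k.+1 (p j)) = 0.
    by rewrite /vdot big1 ?mul0r // => q _; rewrite mxE mul0r.
  apply/matrixP => q r; rewrite (ord1 r) !mxE.
  have -> : shiftf k.+1 (p j) = shiftf 1 (shiftf k (p j)) by rewrite shiftfD -PoszD add1n.
  by rewrite cint_coord_shift ?mul0r //; exact: H2_shift.
have : aeD (fun t => forall i j, G t i j = A i j).
  apply: aeD_fin => i; apply: aeD_fin => j.
  have := const_of_coefs (G_L1 i j); rewrite (_ : cint _ / _ = A i j); last first.
    have -> : (fun t => G t i j) = fun t => G t i j * ez 0%N t.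
      by apply/funext => t; rewrite ez0 mulr1.
    rewrite G_coef shiftf0 ip_cst ?mulfK //; last exact: H2_L2.
    by rewrite vdot_delta [RHS]mxE.
  apply; case=> k k0; first by apply: Gpos; rewrite lt0n.
  have -> : cint (fun t => G t i j * ez (Negz k) t) = cint (fun t => cconj (G t j i * ez k.+1 t)).
    apply: cint_ae.
    - by apply: cmeasM; [exact: cL1_meas|exact: cmeas_ez].
    - by apply: cmeas_conj; apply: cmeasM; [exact: cL1_meas|exact: cmeas_ez].
    by apply: aeDS G_herm => t _ h; rewrite cconjM -h NegzE ezN.
  by rewrite cint_conj ?Gpos ?cconj0 //; apply: cL1_ez.
by apply: aeDS => t _ h; apply/matrixP.
Qed.

Let mean_pc c : mean (pc c) = A *m c.
Proof.
apply/matrixP => i k; rewrite (ord1 k) !mxE.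
have -> : (fun t => pc c t i 0) = fun t => \sum_j c j 0 * p j t i 0.
  by apply/funext => t; rewrite mxE; apply: eq_bigr => j _; rewrite mxE mulrC.
have l1 j : cL1 (fun t => p j t i 0) by apply: sL2_L1; exact: (iffLR (L2P _) (H2_L2 (pH j))).
rewrite cint_sum => [|j]; last exact: cL1Z.
rewrite mulr_suml; apply: eq_bigr => j _; rewrite cintZ // !mxE; ring.
Qed.

(** Cauchy-Schwarz for [B] between the constant [c] and its kernel [pc c]: their product is
    [2 pi |c|^2], the first has square at most [2 pi M |c|^2], and the second has square
    [2 pi <A c, c>]. *)
Let A_coer c : vsq c <= M * cRe (vdot (A *m c) c).
Proof.
have cH := H2_cst c; have cL := L2_cst c.
have h1 : B (cstf c) (pc c) = (vsq c * (2 * pi))%:C.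
  rewrite pc_formr // inner_self //; congr (_%:C).
  by rewrite N2E -[Ri _]/(Ri (fun=> vsq c)) Ri_cst.
have h2 : cRe (B (pc c) (pc c)) = cRe (vdot (A *m c) c) * (2 * pi).
  by rewrite pc_formr // ip_cst ?mean_pc ?cRIE ?mulr0 ?subr0 //; exact: H2_L2.
have := hform_CS hB cH (pcH c); rewrite h1 nsq_real h2.
have := B_le cH; rewrite N2E -[Ri _]/(Ri (fun=> vsq c)) Ri_cst.
have := hform_ge0 hB (pcH c); rewrite h2 pmulr_lge0 ?twopi_gt0 //.
move: (cRe (B _ _)) (cRe (vdot _ _)) (vsq c) (vsq_ge0 c) (2 * pi) (twopi_gt0 R).
move=> b a v v0 tp tp0 a0 hb hc.
have [->|vn] := eqVneq v 0; first by rewrite mulr_ge0 // ltW.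
have vp : 0 < v by rewrite lt_def vn.
have h3 : (v * tp) ^+ 2 <= (M * (v * tp)) * (a * tp).
  by apply: le_trans hc _; apply: ler_wpM2r => //; rewrite mulr_ge0 // ltW.
have q0 : 0 < v * tp * tp by rewrite !mulr_gt0.
rewrite -(ler_pM2l q0); apply: le_trans (le_trans _ h3) _.
  by rewrite expr2 -!mulrA [tp * v]mulrC.
by rewrite le_eqVlt; apply/orP; left; apply/eqP; ring.
Qed.

Let A_unit : A \in unitmx.
Proof.
apply: inj_unitmx => v Av; apply: vsq_eq0; apply/eqP; rewrite eq_le vsq_ge0 andbT.
apply: le_trans (A_coer v) _; rewrite Av /vdot big1 ?cRe0 ?mulr0 // => i _.
by rewrite mxE mul0r.
Qed.

(** Both bounds are read off from [G = A] and the coercivity of [A]. The first makes [P] invertible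
    with bounded inverse; the second is the desired estimate for [Q P^-1]. *)
Let P_low : aeD (fun t => forall c, vsq c <= M * (M * vsq (P t *m c)) /\
   vsq (Q t *m c) <= cRe (vdot (W t *m (P t *m c)) (P t *m c))).
Proof.
apply: aeDS2 G_const MW => t _ e h c; have h1 := A_coer c; rewrite -e GE cReD cReN -vsqE in h1.
have h2 := h (P t *m c); have h3 := cRe_vdot_le (W t *m (P t *m c)) (P t *m c).
have h4 := vsq_ge0 (Q t *m c); have h5 := vsq_ge0 c; split.
  by apply: le_trans h1 _; rewrite ler_pM2l //; lra.
by have := le_trans h5 h1; rewrite pmulr_rge0 // subr_ge0.
Qed.

Let P_unit : aeD (fun t => P t \in unitmx).
Proof.
apply: aeDS P_low => t _ h; apply: inj_unitmx => v Pv; apply: vsq_eq0; apply/eqP.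
by rewrite eq_le vsq_ge0 andbT; have [+ _] := h v; rewrite Pv vsq0 !mulr0.
Qed.

Let X_ex : exists X, [/\ Linf X, aeD (fun t => P t *m X t = 1%:M /\ X t *m P t = 1%:M) &
  aeD (fun t => forall v, vsq (X t *m v) <= M * M * vsq v)].
Proof.
have mP : mxmeas P.
  by move=> i j; under eq_fun do rewrite mxE; exact: (L2_vmeas (H2_L2 (pH j)) i).
have [X mX XE] := mxmeas_inv mP P_unit.
have inv : aeD (fun t => P t *m X t = 1%:M /\ X t *m P t = 1%:M).
  by apply: aeDS2 XE P_unit => t _ -> u; rewrite mulmxV // mulVmx.
have bd : aeD (fun t => forall v, vsq (X t *m v) <= M * M * vsq v).
  apply: aeDS2 inv P_low => t _ [e1 e2] h v; have [+ _] := h (X t *m v).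
  by rewrite mulmxA e1 mul1mx mulrA.
exists X; split; [|exact: inv|exact: bd]; apply/LinfP => i j; split; first exact: mX.
exists (M * M); apply: aeDS bd => t _ /(_ (delta_mx j 0)); rewrite -colE.
rewrite vsq_delta mulr1; apply: le_trans.
by have := nsq_le_vsq (col j (X t)) i; rewrite mxE.
Qed.

(* Iterated [N] times: [f = P q + z^N g] with a polynomial [q] and [g] bounded independently
   of [N]; hence [P^-1 f] is analytic. *)
Let step f : H2 f -> exists c f1, [/\ H2 f1, f = pc c + shiftf 1 f1 &
  cRe (B f1 f1) <= cRe (B f f)].
Proof.
(* This [c] gives [pc c] the same mean as [f], so that the difference is divisible by [z]. *)
move=> hf; pose c := invmx A *m mean f; pose g := f - pc c.
have gH : H2 g by exact: (H2_sub hf (pcH c)).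
have g0 : mean g = 0.
  have : mean g = mean f - mean (pc c).
    apply/matrixP => i k; rewrite (ord1 k) !mxE -mulrBl -cintB; last 2 first.
    - by apply: sL2_L1; exact: (iffLR (L2P _) (H2_L2 hf)).
    - by apply: sL2_L1; exact: (iffLR (L2P _) (H2_L2 (pcH c))).
    by congr (cint _ / _); apply/funext => t; rewrite /g !fctE !mxE.
  by rewrite mean_pc mulmxA mulmxV // mul1mx subrr.
exists c, (shiftf (- 1) g); have hg1 := H2_unshift_mean gH g0.
have e : shiftf 1 (shiftf (- 1) g) = g by rewrite shiftfD subrr shiftf0.
split; first exact: hg1.
  by rewrite e /g addrC subrK.
apply: le_trans (hkform_expansive hPhi W hg1) _; rewrite e.
have -> : f = pc c + g by rewrite /g addrC subrK.
(* The splitting [f = pc c + g] is orthogonal for [B], because [B (pc c) g] is the pairing of [c]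
   with the mean of [g], which is 0. *)
rewrite (hqD hB (pcH c) gH) (pc_form c gH) (hformC ipf (H2_L2 gH) (L2_cst c)) ip_cst; last exact: H2_L2.
rewrite g0 [vdot 0 c]big1 ?mul0r => [|i _]; last by rewrite mxE mul0r.
by rewrite cconj0 cRe0 mulr0 addr0 lerDr; exact: (hform_ge0 hB (pcH c)).
Qed.

Lemma strict_nehari : exists2 F, Hinf F &
  aeD (fun t => forall v, vsq ((Phi t - F t) *m v) <= cRe (vdot (W t *m v) v)).
Proof.
have [X [hX inv bdX]] := X_ex.
(* Each division contributes [X (P c) = c], a constant, which is orthogonal to the negative powers
   of [z]. What remains is the pairing of [z^N g] with a fixed vector, and [shift_tail] makes it
   arbitrarily small. *)
have XH f : H2 f -> H2 (mulf X f).
  move=> hf; have hXf := L2_mulf hX (H2_L2 hf).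
  apply/H2tail0/H2tailP; split=> // _ [k [i [k0 ->]]].
  set u := shiftf _ _; have uL : L2 u by apply: L2_shift; exact: L2_cst.
  pose u' := mulf (fun t => adjmx (X t)) u; have u'L := L2_mulf (Linf_adj hX) uL.
  have it (N : nat) : exists g, [/\ H2 g, cRe (B g g) <= cRe (B f f) &
      ip (mulf X f) u = ip (shiftf N g) u'].
    elim: N => [|N [g [hg bg ig]]]; first by exists f; rewrite shiftf0 inner_mulf.
    have [c [g1 [hg1 eg bg1]]] := step hg; exists g1; split=> //; first exact: le_trans bg1 bg.
    rewrite ig eg -inner_mulf mulf_shift -[shiftf N.+1 g1](_ : shiftf N (shiftf 1 g1) = _); last first.
      by rewrite shiftfD; congr shiftf; rewrite -addn1 PoszD.
    rewrite -inner_mulf mulf_shift.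
    have hzg := L2_shift 1 (H2_L2 hg1); have hXz := L2_mulf hX hzg.
    have hXp := L2_mulf hX (H2_L2 (pcH c)).
    have -> : mulf X (pc c + shiftf 1 g1) = mulf X (pc c) + mulf X (shiftf 1 g1).
      by apply/funext => t; rewrite /mulf !fctE mulmxDr.
    have -> : shiftf N (mulf X (pc c) + mulf X (shiftf 1 g1)) =
        shiftf N (mulf X (pc c)) + shiftf N (mulf X (shiftf 1 g1)).
      by apply/funext => t; rewrite /shiftf !fctE scalerDr.
    rewrite (hformDl ipf (L2_shift N hXp) (L2_shift N hXz) uL).
    have -> : ip (shiftf N (mulf X (pc c))) u = ip (shiftf N (cstf c)) u.
      apply: (inner_ae (L2_shift N hXp) (L2_shift N (L2_cst c)) uL).
      by apply: aeDS inv => t _ [_ e]; rewrite /shiftf /mulf /pc mulmxA e mul1mx.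
    have hc := H2_shift N (H2_cst c).
    have /H2tail0/H2tailP [_ h] := hc.
    by rewrite h ?add0r //; exists k, i.
  apply/eqP; rewrite -nsq_eq0 eq_le nsq_ge0 andbT; apply/ler_addgt0Pr => e e0; rewrite add0r.
  have b0 : 0 < cRe (B f f) / delta + 1.
    by rewrite ltr_wpDl // divr_ge0 ?(ltW d0) //; exact: (hform_ge0 hB hf).
  have [|N hN] := shift_tail u'L (e := e / (cRe (B f f) / delta + 1)); first by rewrite divr_gt0.
  have [g [hg bg ->]] := it N; apply: le_trans (hN g hg) _.
  rewrite mulrAC ler_pdivrMr // ler_pM2l //.
  have := le_trans (coer hg) bg; rewrite mulrC -ler_pdivlMr // => /le_trans; apply.
  by rewrite lerDl.
have XHinf i j : sLinf (fun t => X t i j) /\ sH2 (fun t => X t i j).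
  split; first exact: (iffLR (LinfP _) hX).
  have := XH _ (H2_cst (delta_mx j 0)) => /H2P /(_ i); congr sH2; apply/funext => t.
  by rewrite /mulf -colE mxE.
pose F t := Phi t - Q t *m X t.
have FE t : Phi t - F t = Q t *m X t by rewrite /F opprB addrC subrK.
have bdF : aeD (fun t => forall v, vsq ((Phi t - F t) *m v) <= cRe (vdot (W t *m v) v)).
  apply: aeDS2 inv P_low => t _ [e1 _] h v; rewrite FE -mulmxA.
  by have [_] := h (X t *m v); rewrite ![P t *m _]mulmxA e1 mul1mx.
exists F; last exact: bdF.
have mQX i j : cmeas (fun t => (Q t *m X t) i j).
  under eq_fun do rewrite mxE; apply: cmeas_sum => k; apply: cmeasM.
    by under eq_fun do rewrite mxE; exact: (L2_vmeas (Hk_L2 hPhi (pH k)) i).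
  by have [[]] := XHinf k j.
have QXL : Linf (fun t => Q t *m X t).
  apply/LinfP => i j; split=> //; exists M.
  apply: aeDS2 bdF MW => t _ h1 h2; have := h1 (delta_mx j 0); rewrite FE -colE => h3.
  apply: (@le_trans _ _ (vsq (col j (Q t *m X t)))).
    by have := nsq_le_vsq (col j (Q t *m X t)) i; rewrite mxE.
  apply: le_trans h3 _; apply: le_trans (cRe_vdot_le _ _) _; apply: le_trans (h2 _) _.
  by rewrite vsq_delta mulr1.
have FL : Linf F by exact: (Linf_sub hPhi QXL).
apply/HinfP => i j; split; first exact: (iffLR (LinfP _) FL).
(* The matrix [Q] is not analytic, but [F = (Phi P - Q) P^-1], and the columns [Phi p_k - H p_k] of
   the first factor lie in [H2]. *)
have h k : sH2 (fun t => X t k j * (mulf Phi (p k) - Hk (p k)) t i 0).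
  have [x1 x2] := XHinf k j; apply: sH2M => //.
  by have [_ /H2P /(_ i)] := HkP hPhi (pH k).
apply: sH2_ae (sH2_sum (index_enum _) xpredT h) _ _; first by have [] := iffLR (LinfP _) FL i j.
apply: aeDS inv => t _ [e1 _].
have -> : F t = (Phi t *m P t - Q t) *m X t by rewrite mulmxBl -mulmxA e1 mulmx1.
rewrite [RHS]mxE; apply: eq_bigr => k _; rewrite mulrC; congr (_ * _).
rewrite !fctE /mulf -(Pcol t k) -(Qcol t k) mulmxA -mulmxBl -colE mxE //.
Qed.

End StrictNehari.

(** * The weighted Nehari theorem for a semidefinite form *)

Section Nehari.
Variable R : realType.
Local Notation D := (@circD R).
Local Notation C := (complex R).

Lemma nsq_half : nsq (2^-1 : C) = 4^-1.
Proof. by rewrite nsqV -(rmorph_nat (real_complex R)) nsq_real -natrX. Qed.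

Lemma cvg_fsum (I : Type) (r : seq I) (f : I -> nat -> R) (l : I -> R) :
  (forall i, f i k @[k --> \oo] --> l i) ->
  \sum_(i <- r) f i k @[k --> \oo] --> \sum_(i <- r) l i.
Proof.
move=> h; elim: r => [|i r IH].
  rewrite big_nil (_ : (fun k => _) = fun=> 0); first exact: cvg_cst.
  by apply/funext => k; rewrite big_nil.
rewrite big_cons (_ : (fun k => _) = fun k => f i k + \sum_(i <- r) f i k).
  exact: cvgD (h i) IH.
by apply/funext => k; rewrite big_cons.
Qed.

(* Almost minimal elements of a decreasing sequence of convex sets are Cauchy, by the
   parallelogram identity. *)
Lemma nested_convex_cauchy m (S : nat -> (R -> 'cV[C]_m) -> Prop) (c : R) :
  (forall k u, S k u -> L2 u /\ N2 u <= c) -> (forall k, exists u, S k u) ->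
  (forall k l u, (k <= l)%N -> S l u -> S k u) ->
  (forall k u v, S k u -> S k v -> S k ((2^-1 : C) *: (u + v))) ->
  exists2 u : nat -> R -> 'cV[C]_m, forall k, S k (u k) & hcauchy (@ip R m) u.
Proof.
move=> SL S0 SS Sm; pose E k := [set N2 u | u in S k].
have E0 k : has_inf (E k).
  split; first by have [u hu] := S0 k; exists (N2 u); exists u.
  by exists 0 => _ [u _ <-]; exact: N2_ge0.
have lb k u : S k u -> inf (E k) <= N2 u by move=> hu; apply: ge_inf; [exact: (E0 k).2|exists u].
have ex k : exists2 u, S k u & N2 u < inf (E k) + k.+1%:R^-1.
  by have [|_ [u hu <-] h] := inf_adherent (eps := k.+1%:R^-1) _ (E0 k); [rewrite invr_gt0|exists u].
pose u k := projT1 (cid2 (ex k)).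
have uS k : S k (u k) by rewrite /u; case: cid2.
have uN k : N2 (u k) < inf (E k) + k.+1%:R^-1 by rewrite /u; case: cid2.
exists u => //; apply/hcauchyP => e e0.
pose s := sup (range (fun k => inf (E k))).
have hs : has_sup (range (fun k => inf (E k))).
  split; first by exists (inf (E 0%N)); exists 0%N.
  exists c => _ [k _ <-]; apply: le_trans (lb k _ (uS k)) _; exact: (SL k _ (uS k)).2.
have le_s k : inf (E k) <= s by apply: ub_le_sup; [exact: hs.2|exists k].
have mono k l : (k <= l)%N -> inf (E k) <= inf (E l).
  move=> kl; apply: lb_le_inf; first exact: (E0 l).1.
  by move=> _ [v hv <-]; apply: lb; exact: SS hv.
have [|_ [N1 _ <-] hN1] := sup_adherent (eps := e / 8) _ hs; first by rewrite divr_gt0.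
have [N2' hN2] : exists N : nat, forall k, (N <= k)%N -> k.+1%:R^-1 <= e / 8.
  have /cvgrPdist_le /(_ (e / 8)) := @cvg_harmonic R.
  case; first by rewrite divr_gt0.
  move=> N _ h; exists N => k /h /=; rewrite sub0r normrN ger0_norm ?invr_ge0 //.
exists (maxn N1 N2') => k l; rewrite !geq_max => /andP [k1 k2] /andP [l1 l2].
have sk : S N1 (u k) by apply: SS (uS k).
have sl : S N1 (u l) by apply: SS (uS l).
(* The midpoint has squared norm above [s - e / 8] and both vectors have theirs below [s + e / 8],
   so the parallelogram identity leaves at most [e]. *)
have := lb _ _ (Sm _ _ _ sk sl); have [kL _] := SL _ _ sk; have [lL _] := SL _ _ sl.
have ipf := inner_hform R m.
rewrite N2Z ?nsq_half; last exact: (L2_add kL lL).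
have /eqP := hq_par ipf kL lL; rewrite -!/(N2 _) => /eqP par h.
have h1 := uN k; have h2 := uN l; have h3 := hN2 k k2; have h4 := hN2 l l2.
have h5 := le_s k; have h6 := le_s l; rewrite -/s in hN1.
move: (N2 (u k - u l)) (N2 (u k + u l)) (N2 (u k)) (N2 (u l)) (k.+1%:R^-1) (l.+1%:R^-1)
  (inf (E k)) (inf (E l)) (inf (E N1)) par h h1 h2 h3 h4 h5 h6 hN1 => *; lra.
Qed.

Variable n : nat.

(** Flattening matrix functions to columns of length [n * n] makes [L2_complete] and
    [nested_convex_cauchy] applicable to them. *)
Definition mxfun (u : R -> 'cV[C]_(n * n)) : R -> 'M[C]_n := fun t => vec_mx (u t)^T.
Definition funmx (F : R -> 'M[C]_n) : R -> 'cV[C]_(n * n) := fun t => (mxvec (F t))^T.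
Lemma funmxK F : mxfun (funmx F) = F.
Proof. by apply/funext => t; rewrite /mxfun /funmx trmxK mxvecK. Qed.
Lemma mxfunE u t i j : mxfun u t i j = u t (mxvec_index i j) 0.
Proof. by rewrite /mxfun !mxE. Qed.

Lemma convex_sqnorm m (a b : 'cV[C]_m) (M : R) : vsq a <= M -> vsq b <= M ->
  vsq ((2^-1 : C) *: (a + b)) <= M.
Proof.
move=> ha hb; rewrite vsqZ nsq_half.
have := vsqD_le a b; lra.
Qed.

Lemma entry_le (A F : 'M[C]_n) (L M : R) i j : (forall v, vsq (A *m v) <= L * vsq v) ->
  (forall v, vsq ((A - F) *m v) <= M * vsq v) -> nsq (F i j) <= 2 * L + 2 * M.
Proof.
move=> hA hF; pose v : 'cV[C]_n := delta_mx j 0.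
apply: (@le_trans _ _ (vsq (F *m v))).
  by have := nsq_le_vsq (col j F) i; rewrite mxE -colE.
have -> : F *m v = A *m v - (A - F) *m v by rewrite mulmxBl opprB addrC subrK.
have := vsqD_le (A *m v) (- ((A - F) *m v)); rewrite vsqN.
by have := hA v; have := hF v; rewrite vsq_delta !mulr1 => *; lra.
Qed.

Variables (Phi W : R -> 'M[C]_n).
Hypotheses (hPhi : Linf Phi) (hW : Linf W) (herm : aeD (fun t => adjmx (W t) = W t)).
Hypothesis (pos : forall f, H2 f -> 0 <= cRe (hkform Phi W f f)).

(** Replacing [W] by [W + e] adds [e |f|^2] to the form, which becomes coercive with constant
    [e]. *)
Let eps_nehari (e : R) : 0 < e -> exists2 F, Hinf F &
  aeD (fun t => forall v, vsq ((Phi t - F t) *m v) <= cRe (vdot (W t *m v) v) + e * vsq v).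
Proof.
move=> e0; pose We t := W t + (e%:C)%:M.
have hWe : Linf We by exact: (Linf_add hW (Linf_cst (e%:C)%:M)).
have WeE t v : We t *m v = W t *m v + e%:C *: v by rewrite mulmxDl mul_scalar_mx.
have [| |F hF h] := strict_nehari hPhi hWe _ e0.
- apply: aeDS herm => t _ h; apply/matrixP => i j; rewrite adjmxE !mxE cconjD.
  rewrite -[cconj (W t j i)]adjmxE h eq_sym; congr (_ + _).
  by case: eqP => _; rewrite ?mulr1n ?mulr0n ?cconj0 // cconj_real.
- move=> f hf; have hfL := H2_L2 hf; have hWf := L2_mulf hW hfL.
  have ipf := inner_hform R n.
  have -> : hkform Phi We f f = e%:C * ip f f + hkform Phi W f f.
    rewrite /hkform; have -> : mulf We f = e%:C *: f + mulf W f.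
      by apply/funext => t; rewrite /mulf !fctE WeE addrC.
    by rewrite (hformL ipf _ hfL hWf hfL) addrA.
  by rewrite inner_self // cReD -rmorphM cRe_real lerDl; exact: pos.
exists F => //; apply: aeDS h => t _ h v; apply: le_trans (h v) _.
by rewrite WeE vdotDl vdotZl vdotvv !cRIE mul0r subr0.
Qed.

Let Wb : exists M : R, aeD (fun t => forall v, cRe (vdot (W t *m v) v) + vsq v <= M * vsq v).
Proof.
have [M M0 h] := Linf_bound hW; exists (M + 2); apply: aeDS h => t _ h v.
have h1 := h v; have h2 := cRe_vdot_le (W t *m v) v; have h3 := vsq_ge0 v.
rewrite mulrDl; lra.
Qed.

Let bound k (F : R -> 'M[C]_n) := aeD (fun t => forall v, vsq ((Phi t - F t) *m v) <=
  cRe (vdot (W t *m v) v) + (k.+1%:R^-1 : R) * vsq v).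

Let S (k : nat) (u : R -> 'cV[C]_(n * n)) := Hinf (mxfun u) /\ bound k (mxfun u).

Lemma harm_le1 (k : nat) : (k.+1%:R^-1 : R) <= 1.
Proof. by rewrite invf_le1 // ler1n. Qed.

Let S_entry : exists c : R, forall k u, S k u ->
  aeD (fun t => forall i j, nsq (mxfun u t i j) <= c).
Proof.
have [M hM] := Wb; have [L L0 hL] := Linf_bound hPhi.
exists (2 * L + 2 * M) => k u [hu bu].
apply: aeDS2 bu (aeD2 hM hL) => t _ h1 [h2 h3] i j.
apply: entry_le h3 _ => v; apply: le_trans (h1 v) _; apply: le_trans (h2 v).
by rewrite lerD2l ler_piMl ?vsq_ge0 // harm_le1.
Qed.

Let S_L2 : exists c : R, forall k u, S k u -> L2 u /\ N2 u <= c.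
Proof.
have [c hc] := S_entry; exists ((n * n)%:R * c * (2 * pi)) => k u Su.
have [hu bu] := Su.
have entry t a : exists i j, u t a 0 = mxfun u t i j.
  by case/mxvec_indexP: a => i j; exists i, j; rewrite mxfunE.
have uL : L2 u.
  apply/L2P => a; case/mxvec_indexP: a => i j.
  have [_ [h _]] := iffLR (HinfP _) hu i j; move: h; congr sL2; apply/funext => t.
  by rewrite mxfunE.
split=> //; rewrite N2E -Ri_cst; apply: Ri_le_ae; [exact: L2_rint|exact: rint_cst|].
apply: aeDS (hc _ _ Su) => t _ h.
rewrite /vsq; apply: (@le_trans _ _ (\sum_(a < n * n) c)).
  by apply: ler_sum => a _; have [i [j ->]] := entry t a.
by rewrite sumr_const card_ord mulr_natl.
Qed.

Let vsq_cvg (A : nat -> 'M[C]_n) (A0 : 'M[C]_n) v :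
  (forall i j, cRe (A k i j) @[k --> \oo] --> cRe (A0 i j) /\
               cIm (A k i j) @[k --> \oo] --> cIm (A0 i j)) ->
  vsq (A k *m v) @[k --> \oo] --> vsq (A0 *m v).
Proof.
move=> h; rewrite /vsq; apply: cvg_fsum => i.
have e (X : 'M[C]_n) : nsq ((X *m v) i 0) =
    (\sum_j (cRe (X i j) * cRe (v j 0) - cIm (X i j) * cIm (v j 0))) *
    (\sum_j (cRe (X i j) * cRe (v j 0) - cIm (X i j) * cIm (v j 0))) +
    (\sum_j (cRe (X i j) * cIm (v j 0) + cIm (X i j) * cRe (v j 0))) *
    (\sum_j (cRe (X i j) * cIm (v j 0) + cIm (X i j) * cRe (v j 0))).
  rewrite /nsq mxE cRe_sum cIm_sum !expr2.
  by congr (_ * _ + _ * _); apply: eq_bigr => j _; rewrite ?cReM ?cImM.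
rewrite e; under eq_cvg do rewrite e.
have c1 : \sum_j (cRe (A k i j) * cRe (v j 0) - cIm (A k i j) * cIm (v j 0)) @[k --> \oo] -->
    \sum_j (cRe (A0 i j) * cRe (v j 0) - cIm (A0 i j) * cIm (v j 0)).
  apply: cvg_fsum => j; have [h1 h2] := h i j.
  by apply: cvgB; apply: cvgMl.
have c2 : \sum_j (cRe (A k i j) * cIm (v j 0) + cIm (A k i j) * cRe (v j 0)) @[k --> \oo] -->
    \sum_j (cRe (A0 i j) * cIm (v j 0) + cIm (A0 i j) * cRe (v j 0)).
  apply: cvg_fsum => j; have [h1 h2] := h i j.
  by apply: cvgD; apply: cvgMl.
by apply: cvgD; apply: cvgM.
Qed.

(** The sets [S k] are nested, convex, nonempty and bounded in [L^2], so almost minimal elements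
    converge. Along an almost everywhere convergent subsequence the pointwise inequalities pass to
    the limit while the error [1 / k.+1] disappears. *)
Lemma nehari : exists2 F, Hinf F &
  aeD (fun t => forall v, vsq ((Phi t - F t) *m v) <= cRe (vdot (W t *m v) v)).
Proof.
have [c hc] := S_L2.
have [|||u uS cu] := @nested_convex_cauchy _ S c hc.
- move=> k; have [|F hF hb] := @eps_nehari (k.+1%:R^-1); first by rewrite invr_gt0.
  by exists (funmx F); rewrite /S funmxK; split.
- move=> k l u kl [hu bu]; split; first exact: hu.
  apply: aeDS bu => t _ h v; apply: le_trans (h v) _; rewrite lerD2l ler_wpM2r ?vsq_ge0 //.
  by rewrite lef_pV2 ?posrE // ler_nat ltnS.
- move=> k u v [hu bu] [hv bv].
  have e t : mxfun ((2^-1 : C) *: (u + v)) t = (2^-1 : C) *: (mxfun u t + mxfun v t).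
    by apply/matrixP => i j; rewrite [RHS]mxE [X in _ * X]mxE !mxfunE !fctE !mxE.
  split.
    apply/HinfP => i j; have [u1 u2] := iffLR (HinfP _) hu i j; have [v1 v2] := iffLR (HinfP _) hv i j.
    have -> : (fun t => mxfun ((2^-1 : C) *: (u + v)) t i j) =
        fun t => 2^-1 * (mxfun u t i j + mxfun v t i j).
      by apply/funext => t; rewrite e !mxE.
    split; first by apply: sLinfM; [exact: sLinf_cst|exact: sLinfD].
    by apply: sH2Z; exact: sH2D.
  apply: aeDS2 bu bv => t _ h1 h2 w.
  have -> : (Phi t - mxfun ((2^-1 : C) *: (u + v)) t) *m w =
      (2^-1 : C) *: ((Phi t - mxfun u t) *m w + (Phi t - mxfun v t) *m w).
    rewrite e -mulmxDl addrACA -opprD scalemxAl scalerBr; congr ((_ - _) *m _).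
    by rewrite scalerDr -scalerDl (_ : 2^-1 + 2^-1 = 1) ?scale1r // [RHS]splitr mul1r.
  exact: convex_sqnorm.
have uL k : L2 (u k) by exact: (hc _ _ (uS k)).1.
have uH k : H2 (u k).
  have [h _] := uS k; apply/H2P => a; case/mxvec_indexP: a => i j.
  have [_ {}h] := iffLR (HinfP _) h i j; move: h; congr sH2; apply/funext => t.
  by rewrite mxfunE.
have [v [phi [vL uv phik cv]]] := L2_complete uL cu.
have vH := H2_lim uH vL uv.
have vb : aeD (fun t => forall w, vsq ((Phi t - mxfun v t) *m w) <= cRe (vdot (W t *m w) w)).
  have bu : aeD (fun t => forall k w, vsq ((Phi t - mxfun (u k) t) *m w) <=
      cRe (vdot (W t *m w) w) + (k.+1%:R^-1 : R) * vsq w).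
    by apply: aeD_nat => k; exact: (uS k).2.
  apply: aeDS2 cv bu => t _ h1 h2 w.
  have c1 : vsq ((Phi t - mxfun (u (phi k)) t) *m w) @[k --> \oo] -->
      vsq ((Phi t - mxfun v t) *m w).
    apply: (vsq_cvg (A := fun k => Phi t - mxfun (u (phi k)) t)) => i j.
    have [a1 a2] := h1 (mxvec_index i j).
    have e x : (Phi t - mxfun x t) i j = Phi t i j - x t (mxvec_index i j) 0.
      by rewrite mxE [X in _ + X]mxE mxfunE.
    rewrite e cReD cReN cImD cImN; split.
      by under eq_cvg do rewrite e cReD cReN; apply: cvgB => //; exact: cvg_cst.
    by under eq_cvg do rewrite e cImD cImN; apply: cvgB => //; exact: cvg_cst.
  have c2 : cRe (vdot (W t *m w) w) + (k.+1%:R^-1 : R) * vsq w @[k --> \oo] -->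
      cRe (vdot (W t *m w) w) + 0 * vsq w.
    apply: cvgD; first exact: cvg_cst.
    by apply: cvgMl; exact: cvg_harmonic.
  rewrite mul0r addr0 in c2; apply: ler_cvg_to c1 c2 _; near=> k.
  apply: le_trans (h2 (phi k) w) _; rewrite lerD2l ler_wpM2r ?vsq_ge0 //.
  by rewrite lef_pV2 ?posrE // ler_nat ltnS.
exists (mxfun v); last exact: vb.
have [M hM] := Wb; have [L L0 hL] := Linf_bound hPhi.
apply/HinfP => i j; have vij : sH2 (fun t => mxfun v t i j).
  have /H2P /(_ (mxvec_index i j)) := vH; congr sH2; apply/funext => t.
  by rewrite mxfunE.
split=> //; split; first by case: vij => [[]].
exists (2 * L + 2 * M); apply: aeDS2 vb (aeD2 hM hL) => t _ h1 [h2 h3].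
apply: entry_le h3 _ => w; apply: le_trans (h1 w) _; apply: le_trans (h2 w).
by rewrite lerDl vsq_ge0.
Unshelve. all: by end_near.
Qed.

End Nehari.

(** * Orthonormal systems and their projections *)

Section Orthonormal.
Variable R : realType.
Local Notation C := (complex R).
Variables (n d : nat) (g : 'I_d -> 'cV[C]_n).

Definition projmx : 'M[C]_n := \matrix_(a, b) \sum_j g j a 0 * cconj (g j b 0).

Lemma projmxE v : projmx *m v = \sum_j vdot v (g j) *: g j.
Proof.
apply/matrixP => a b; rewrite (ord1 b) mxE summxE.
under eq_bigr do rewrite mxE mulr_suml.
rewrite exchange_big /=; apply: eq_bigr => j _; rewrite mxE /vdot mulr_suml.
by apply: eq_bigr => k _; ring.
Qed.

Lemma adj_projmx : adjmx projmx = projmx.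
Proof.
apply/matrixP => a b; rewrite adjmxE !mxE cconj_sum; apply: eq_bigr => j _.
by rewrite cconjM cconjK mulrC.
Qed.

Let Gt : 'M[C]_(d, n) := \matrix_(i, j) cconj (g i j 0).
Let GtE v i : (Gt *m v) i 0 = vdot v (g i).
Proof. by rewrite mxE; apply: eq_bigr => k _; rewrite mxE mulrC. Qed.

Lemma unit_orthogonal : (d < n)%N -> exists2 v, vsq v = 1 & forall j, vdot v (g j) = 0.
Proof.
move=> dn; have : kermx Gt^T != 0.
  by rewrite -mxrank_eq0 mxrank_ker mxrank_tr subn_eq0 -ltnNge (leq_ltn_trans (rank_leq_row _)).
case/rowV0Pn => r /sub_kermxP r0 rn0.
have Gv : Gt *m r^T = 0 by rewrite -[Gt]trmxK -trmx_mul r0 trmx0.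
have vn0 : r^T != 0 by rewrite -[0]trmx0 (inj_eq (can_inj (@trmxK _ _ _))).
have vp : 0 < vsq r^T.
  by rewrite lt_def vsq_ge0 andbT; apply: contraNN vn0 => /eqP /vsq_eq0 ->.
exists ((Num.sqrt (vsq r^T))^-1%:C *: r^T).
  by rewrite vsqZ nsq_real exprVn sqr_sqrtr ?vsq_ge0 // mulVf // gt_eqF.
by move=> j; rewrite vdotZl -GtE Gv mxE mulr0.
Qed.

Hypothesis ong : forall i j, vdot (g i) (g j) = (i == j)%:R.

Let G : 'M[C]_(n, d) := \matrix_(i, j) g j i 0.
Let GtG : Gt *m G = 1%:M.
Proof.
apply/matrixP => i j; rewrite !mxE eq_sym -ong; apply: eq_bigr => k _.
by rewrite !mxE mulrC.
Qed.
Lemma orthonormal_le : (d <= n)%N.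
Proof.
have := mxrankM_maxl Gt G; rewrite GtG mxrank1 => /leq_trans; apply.
exact: rank_leq_col.
Qed.

Lemma orthonormal_ann (A : 'M[C]_n) : d = n -> (forall j, A *m g j = 0) -> A = 0.
Proof.
move=> dn Ag; have AG : A *m G = 0.
  apply/matrixP => i j; have := congr1 (fun v : 'cV[C]_n => v i 0) (Ag j).
  by rewrite !mxE => h; rewrite -[RHS]h; apply: eq_bigr => k _; rewrite mxE.
have GGt : G *m Gt = 1%:M.
  by move: (G) (Gt) GtG; rewrite dn => X Y; exact: mulmx1C.
by rewrite -[A]mulmx1 -GGt mulmxA AG mul0mx.
Qed.

Lemma projmx_sq v : vsq (v - projmx *m v) = vsq v - cRe (vdot (projmx *m v) v).
Proof.
have h w : vdot (projmx *m v) w = \sum_j vdot v (g j) * vdot (g j) w.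
  by rewrite projmxE vdot_suml; apply: eq_bigr => j _; rewrite vdotZl.
have e : vdot (projmx *m v) (projmx *m v) = vdot (projmx *m v) v.
  rewrite !h; apply: eq_bigr => j _; rewrite [vdot (g j) (projmx *m v)]vdotC [vdot (g j) v]vdotC; congr (_ * cconj _).
  by rewrite h (bigD1 j) //= ong eqxx mulr1 big1 ?addr0 // => i ij; rewrite ong (negbTE ij) mulr0.
by rewrite vsqB [vsq (projmx *m v)]vsqE e [vdot v (projmx *m v)]vdotC cRe_conj; ring.
Qed.

End Orthonormal.

(** * Closed shift-invariant subspaces generated inside [H2] *)

Section Beurling.
Variable R : realType.
Local Notation D := (@circD R).
Local Notation C := (complex R).
Variable n : nat.
Local Notation V := (R -> 'cV[C]_n).
Local Notation ip := (@ip R n).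
Implicit Types f g h : V.
Let ipf := inner_hform R n.

Variable M : V -> Prop.
Hypothesis MH : forall m, M m -> H2 m.

(* [shift_span] is the closed shift-invariant subspace generated by [M], as a double
   orthogonal complement. *)
Definition shift_orth g := L2 g /\ forall m, M m -> forall k : nat, ip (shiftf k m) g = 0.
Definition shift_span f := L2 f /\ forall g, shift_orth g -> ip f g = 0.
Local Notation N := shift_span.

Lemma shift_span_mem m : M m -> N m.
Proof.
move=> hm; split; first exact: H2_L2 (MH hm).
by move=> g [_ /(_ m hm 0%N)]; rewrite shiftf0.
Qed.

Lemma shift_span_shift f : N f -> N (shiftf 1 f).
Proof.
move=> [hf of_]; split; first exact: (L2_shift 1 hf).
move=> g [hg og]; rewrite inner_shift; apply: of_; split; first exact: (L2_shift (- 1) hg).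
move=> m hm k; rewrite -inner_shift shiftfD -PoszD add1n; exact: og.
Qed.

Lemma shift_span_H2 f : N f -> H2 f.
Proof.
move=> [hf of_]; apply/H2tail0/H2tailP; split; first exact: hf.
move=> g hg; have [k [i [k0 gE]]] := hg; apply: of_; split.
  by rewrite gE; apply: L2_shift; exact: L2_cst.
move=> m hm l; have /H2tail0/H2tailP [_] := H2_shift l (MH hm); exact.
Qed.

Lemma shift_span_lin a f g : N f -> N g -> N (a *: f + g).
Proof.
move=> [hf of_] [hg og]; split; first exact: L2_lin.
by move=> h hh; rewrite (hformL ipf a hf hg hh.1) of_ // og // mulr0 addr0.
Qed.

Let N_L2 f : N f -> L2 f. Proof. by case. Qed.

Lemma shift_span_proj f : L2 f -> exists p, [/\ N p, L2 p & forall g, N g -> ip (f - p) g = 0].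
Proof.
by apply: (proj_exists (P := shift_orth)) => // g [].
Qed.

(** Multiplication by [T] commutes with the shift, so [T^* T f] is orthogonal to all [z^k m], hence
    to [f], which gives [|T f|^2 = 0]. *)
Lemma shift_span_ann (T : R -> 'M[C]_n) f : Linf T ->
  (forall m, M m -> aeD (fun t => T t *m m t = 0)) -> N f -> aeD (fun t => T t *m f t = 0).
Proof.
move=> hT Tm [hf of_]; have hTf := L2_mulf hT hf.
apply: (N2_eq0 hTf); rewrite N2_def inner_mulf of_ ?cRe0 //.
split; first exact: (L2_mulf (Linf_adj hT) hTf).
move=> m hm k; have hmL := H2_L2 (MH hm); have hz := L2_shift k hmL.
rewrite -inner_mulf (inner_ae (L2_mulf hT hz) (L2_0 R n) hTf) ?(hform0l ipf hTf) //.
by apply: aeDS (Tm m hm) => t _ e; rewrite /mulf /shiftf -scalemxAr e scaler0.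
Qed.

(** The wandering subspace: the orthogonal complement of [z N] in [N]. *)
Definition wandering f := N f /\ forall h, N h -> ip f (shiftf 1 h) = 0.
Local Notation E := wandering.

Lemma wandering_lin a f g : E f -> E g -> E (a *: f + g).
Proof.
move=> [hf of_] [hg og]; split; first exact: shift_span_lin.
move=> h hh; have hz := L2_shift 1 (N_L2 hh).
by rewrite (hformL ipf a (N_L2 hf) (N_L2 hg) hz) of_ // og // mulr0 addr0.
Qed.

Let N_0 : N 0.
Proof.
split; first exact: L2_0.
by move=> g [hg _]; rewrite (hform0l ipf hg).
Qed.

Let E_0 : E 0.
Proof. by split=> // h hh; rewrite (hform0l ipf (L2_shift 1 (N_L2 hh))). Qed.

(** The quotient [f1] is the projection of [zbar f] onto [N]; this makes [f - z f1] orthogonal to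
    [z N] and [f1] no longer than [f]. *)
Lemma wandering_decomp f : N f -> exists e f1, [/\ E e, N f1, f = e + shiftf 1 f1 & N2 f1 <= N2 f].
Proof.
move=> hf; have hfL := N_L2 hf; have hz := L2_shift (- 1) hfL.
have [p [Np pL op]] := shift_span_proj hz; have zp := shift_span_shift Np.
have zpL := N_L2 zp.
exists (f - shiftf 1 p), p; split=> //.
- have -> : f - shiftf 1 p = -1 *: shiftf 1 p + f by rewrite scaleN1r addrC.
  split; first exact: (shift_span_lin (-1) zp hf).
  have -> : -1 *: shiftf 1 p + f = shiftf 1 (shiftf (- 1) f - p).
    by rewrite shiftfB shiftfD subrr shiftf0 scaleN1r addrC.
  by move=> h hh; rewrite inner_shift2 op.
- by rewrite subrK.
have := op p Np; rewrite (hformBl ipf hz pL pL) (inner_self pL) => /eqP; rewrite subr_eq0 => /eqP e.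
have := N2_ge0 (shiftf (- 1) f - p); rewrite (N2B hz pL) e cRe_real N2_shift.
by move: (N2 f) (N2 p) => x y; lra.
Qed.

(** For [k > 0] both [z^k f] and [z^k g] lie in [z N], which is orthogonal to [f] and [g], so all
    coefficients of [<f, g>] other than the constant one vanish. *)
Lemma wandering_const f g : E f -> E g -> exists c : C, aeD (fun t => vdot (f t) (g t) = c).
Proof.
move=> [hf of_] [hg og]; have hfL := N_L2 hf; have hgL := N_L2 hg.
have shiftS h (k : nat) : N h -> N (shiftf k h).
  move=> hh; elim: k => [|k IH]; first by rewrite shiftf0.
  have -> : shiftf k.+1 h = shiftf 1 (shiftf k h) by rewrite shiftfD -PoszD add1n.
  exact: shift_span_shift.
have shE h (k : nat) : shiftf k.+1 h = shiftf 1 (shiftf k h) by rewrite shiftfD -PoszD add1n.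
exists (cint (fun t => vdot (f t) (g t)) / (2 * pi)%:C).
apply: const_of_coefs; first exact: (L2_L1 hfL hgL).
case=> [[//|k]|k] _.
  have -> : (fun t => vdot (f t) (g t) * ez k.+1 t) = fun t => vdot (shiftf k.+1 f t) (g t).
    by apply/funext => t; rewrite /shiftf vdotZl mulrC.
  rewrite -ipE (hformC ipf hgL (L2_shift k.+1 hfL)) shE og ?cconj0 //; exact: shiftS.
have -> : (fun t => vdot (f t) (g t) * ez (Negz k) t) = fun t => vdot (f t) (shiftf k.+1 g t).
  by apply/funext => t; rewrite /shiftf vdotZr NegzE ezN mulrC.
by rewrite -ipE shE of_ //; exact: shiftS.
Qed.

Definition wandering_family (d : nat) (g : nat -> V) := (forall i, (i < d)%N -> E (g i)) /\
  aeD (fun t => forall i j : 'I_d, vdot (g i t) (g j t) = (i == j)%:R).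

Lemma wandering_family_le d (g : nat -> V) : wandering_family d g -> (d <= n)%N.
Proof.
move=> [_ h]; apply: (@aeD_const R); apply: aeDS h => t _ h.
exact: (orthonormal_le h).
Qed.

(** Pointwise orthonormality limits the size to [n], so a family of largest size exists. A wandering
    [f] pointwise orthogonal to it has constant norm; were that norm nonzero, normalizing [f] would
    enlarge the family. *)
Lemma maximal_family : exists (d : nat) (g : nat -> V), wandering_family d g /\
  forall f, E f -> aeD (fun t => forall i : 'I_d, vdot (f t) (g i t) = 0) -> aeD (fun t => f t = 0).
Proof.
pose P d := `[< exists g : nat -> V, wandering_family d g >].
have ex : exists d, P d.
  exists 0%N; apply/asboolP; exists (fun=> 0); split=> // ; apply: aeDT => t _; case=> //.
have ub d : P d -> (d <= n)%N by move=> /asboolP [g]; exact: wandering_family_le.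
have [d /asboolP [g [Eg og]] dmax] := ex_maxnP ex ub.
exists d, g; split=> // f Ef fg.
have [k hk] := wandering_const Ef Ef.
pose r := cRe k.
have hr : aeD (fun t => vsq (f t) = r) by apply: aeDS hk => t _ h; rewrite vsqE h.
have r0 : 0 <= r.
  by apply: (@aeD_const R); apply: aeDS hr => t _ <-; exact: vsq_ge0.
have [rz|rn] := eqVneq r 0.
  by apply: aeDS hr => t _; rewrite rz; exact: vsq_eq0.
have rp : 0 < r by rewrite lt_def rn.
pose a : C := (Num.sqrt r)^-1%:C.
pose g' i := if i == d then a *: f + 0 else g i.
have : P d.+1.
  apply/asboolP; exists g'; split.
    move=> i; rewrite ltnS leq_eqVlt /g'; case: eqP => [_ _|_ /= id]; last exact: Eg.
    exact: (wandering_lin a Ef E_0).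
  apply: aeDS2 og (aeD2 fg hr) => t _ h1 [h2 h3].
  have aa : a * cconj a * r%:C = 1.
    by rewrite mulcconj nsq_real exprVn sqr_sqrtr // -rmorphM mulVf.
  move=> i j; have := ltn_ord i; have := ltn_ord j.
  rewrite !ltnS [(j <= d)%N]leq_eqVlt [(i <= d)%N]leq_eqVlt /g' -val_eqE /=.
  case: (eqVneq (val j) d) => [jd _|jd /= jl]; case: (eqVneq (val i) d) => [id_ _|id_ /= il].
  - by rewrite id_ jd eqxx addr0 vdotZl vdotZr vdotvv h3 mulrA aa.
  - rewrite jd (negbTE id_) addr0 vdotZr vdotC.
    by rewrite (h2 (Ordinal il)) cconj0 mulr0.
  - rewrite id_ eq_sym (negbTE jd) addr0 vdotZl.
    by rewrite (h2 (Ordinal jl)) mulr0.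
  - by rewrite (h1 (Ordinal il) (Ordinal jl)) -val_eqE.
by move/dmax; rewrite ltnn.
Qed.

Lemma wandering_proj_Linf d (g : nat -> V) : wandering_family d g ->
  Linf (fun t => projmx (fun j : 'I_d => g j t)).
Proof.
move=> [Eg og]; apply/LinfP => a b.
rewrite (_ : (fun t => _) = fun t => \sum_(j < d) g j t a 0 * cconj (g j t b 0)); last first.
  by apply/funext => t; rewrite mxE.
have gi (j : 'I_d) c : sLinf (fun t => g j t c 0).
  split; first exact: (L2_vmeas (N_L2 (Eg j (ltn_ord j)).1) c).
  exists 1; apply: aeDS og => t _ h; apply: le_trans (nsq_le_vsq _ c) _.
  by rewrite vsqE h eqxx cRe1.
by apply: sLinf_sum => j; apply: sLinfM => //; exact: sLinf_conj.
Qed.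

(** For wandering [e] the inner products with the [g j] are constant, so [(1 - Pi) e] is again
    wandering and vanishes by maximality. Iterating [wandering_decomp] then reduces [|(1 - Pi) f|^2]
    to the pairing of some [z^K h] with a fixed vector, where [h] stays bounded, and [shift_tail]
    applies. *)
Lemma beurling : exists (d : nat) (g : nat -> V), wandering_family d g /\
  forall f, N f -> aeD (fun t => projmx (fun j : 'I_d => g j t) *m f t = f t).
Proof.
have [d [g [[Eg og] gmax]]] := maximal_family; exists d, g; split; first by [].
pose Pi t := projmx (fun j : 'I_d => g j t).
have PiL : Linf Pi by exact: (wandering_proj_Linf (conj Eg og)).
pose T t := 1%:M - Pi t.
have TL : Linf T by exact: (Linf_sub (Linf_cst 1%:M) PiL).
have TE e : E e -> aeD (fun t => T t *m e t = 0).
  move=> Ee.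
  have cex (j : 'I_d) : exists c, aeD (fun t => vdot (e t) (g j t) = c).
    exact: (wandering_const Ee (Eg j (ltn_ord j))).
  pose c j := projT1 (cid (cex j)).
  have hc : aeD (fun t => forall j : 'I_d, vdot (e t) (g j t) = c j).
    by apply: aeD_fin => j; rewrite /c; case: cid.
  pose r := -1 *: (\sum_(j < d) c j *: g j) + e.
  have Es : E (\sum_(j < d) c j *: g j).
    elim/big_ind: _ => [|x y hx hy|j _]; first exact: E_0.
      by have := wandering_lin 1 hx hy; rewrite scale1r.
    by have := wandering_lin (c j) (Eg j (ltn_ord j)) E_0; rewrite addr0.
  have Er : E r by exact: (wandering_lin (-1) Es Ee).
  have rE : aeD (fun t => r t = T t *m e t).
    apply: aeDS hc => t _ h; rewrite /T mulmxBl mul1mx projmxE /r !fctE fct_sumE addrC scaleN1r.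
    by congr (_ - _); apply: eq_bigr => j _; rewrite h.
  have : aeD (fun t => r t = 0).
    apply: (gmax r Er); apply: aeDS2 og rE => t _ h -> i.
    rewrite /T mulmxBl mul1mx vdotBl projmxE vdot_suml (bigD1 i) //= vdotZl h eqxx mulr1.
    by rewrite big1 ?addr0 ?subrr // => j ji; rewrite vdotZl h (negbTE ji) mulr0.
  by move=> r0; apply: aeDS2 r0 rE => t _ -> ->.
move=> f Nf; have hfL := N_L2 Nf; have Tf := L2_mulf TL hfL.
suff : aeD (fun t => T t *m f t = 0).
  by apply: aeDS => t _ /eqP; rewrite /T mulmxBl mul1mx subr_eq0 => /eqP.
apply: (N2_eq0 Tf); rewrite N2_def; set u := mulf T f.
pose u' := mulf (fun t => adjmx (T t)) u; have u'L := L2_mulf (Linf_adj TL) Tf.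
have it (K : nat) : exists h, [/\ N h, N2 h <= N2 f & ip u u = ip (shiftf K h) u'].
  elim: K => [|K [h [Nh bh ih]]]; first by exists f; rewrite shiftf0 /u inner_mulf.
  have [e [h1 [Ee Nh1 he bh1]]] := wandering_decomp Nh; exists h1; split=> //.
    exact: le_trans bh1 bh.
  have eL := N_L2 Ee.1; have h1L := N_L2 Nh1; have zh := L2_shift 1 h1L.
  rewrite ih he.
  have -> : shiftf K (e + shiftf 1 h1) = shiftf K e + shiftf K.+1 h1.
    apply/funext => t; rewrite /shiftf !fctE scalerDr scalerA -ezD; congr (_ + ez _ _ *: _).
    by rewrite -addn1 PoszD.
  rewrite (hformDl ipf (L2_shift K eL) (L2_shift K.+1 h1L) u'L) -inner_mulf mulf_shift.
  have Te := L2_mulf TL eL.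
  rewrite (inner_ae (L2_shift K Te) (L2_0 R n) Tf) ?(hform0l ipf Tf) ?add0r //.
  by apply: aeDS (TE e Ee) => t _ h0; rewrite /shiftf /mulf h0 scaler0.
suff -> : ip u u = 0 by rewrite cRe0.
apply/eqP; rewrite -nsq_eq0 eq_le nsq_ge0 andbT; apply/ler_addgt0Pr => e e0; rewrite add0r.
have b0 : 0 < N2 f + 1 by rewrite ltr_wpDl // N2_ge0.
have [|K hK] := shift_tail u'L (e := e / (N2 f + 1)); first by rewrite divr_gt0.
have [h [Nh bh ->]] := it K; apply: le_trans (hK h (shift_span_H2 Nh)) _.
rewrite mulrAC ler_pdivrMr // ler_pM2l //; apply: le_trans bh _.
by rewrite lerDl.
Qed.

End Beurling.

(** * Superoptimal singular values 1 give a unique interpolant *)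

Section Converse.
Variable R : realType.
Local Notation D := (@circD R).
Local Notation C := (complex R).
Variable n : nat.
Local Notation V := (R -> 'cV[C]_n).
Local Notation ip := (@ip R n).
Implicit Types f g h : V.
Let ipf := inner_hform R n.

Variable Phi : R -> 'M[C]_n.
Hypotheses (hPhi : Linf Phi) (contr : hankel_norm_le Phi 1) (ess : hankel_ess_norm_lt1 Phi).
Local Notation Hk := (Hk Phi).
Let maxH f : maxv Phi f -> H2 f. Proof. by case. Qed.

(** The bound [e <= 1] gives meaning to [sqrt (1 - e)]. *)
Lemma gap_lt1 : exists e : R, [/\ 0 < e, e <= 1 &
  forall f, H2 f -> (forall g, maxv Phi g -> ip f g = 0) -> e * N2 f <= N2 f - N2 (Hk f)].
Proof.
have [e e0 he] := gap hPhi contr ess.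
exists (Num.min e 1); split; [by rewrite lt_min e0 ltr01|by rewrite ge_min lexx orbT|].
move=> f hf of_; apply: le_trans (he f hf of_).
by apply: ler_wpM2r; [exact: N2_ge0|rewrite ge_min lexx].
Qed.

Lemma contraction_dev (F : R -> 'M[C]_n) j :
  aeD (fun t => forall v, vsq ((Phi t - F t) *m v) <= vsq v) -> (dev Phi j F <= 1%:E)%E.
Proof.
move=> h; apply/esssup_leP; apply: aeDS h => t _ h; apply: le_trans (sval_le_opnorm j _) _.
by apply: opnorm_le => // v; rewrite expr1n mul1r.
Qed.

(** A contractive [Phi - F] has every deviation at most 1, which is the minimum at each stage; so
    [F] survives all the successive minimizations. *)
Lemma contraction_superoptimal (F : R -> 'M[C]_n) : Hinf F ->
  aeD (fun t => forall v, vsq ((Phi t - F t) *m v) <= vsq v) ->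
  (forall j, (j < n)%N -> superopt_sv Phi j = 1%:E) ->
  forall j, (j < n)%N -> Omega Phi j F /\ dev Phi j F = 1%:E.
Proof.
move=> hF cF t1.
have key j (S : set (R -> 'M[C]_n)) : S F -> ereal_inf [set dev Phi j G | G in S] = 1%:E ->
    Omega_step Phi j S F /\ dev Phi j F = 1%:E.
  move=> SF e; have d1 : dev Phi j F = 1%:E.
    apply/eqP; rewrite eq_le contraction_dev //= -e; apply: ereal_inf_lbound; by exists F.
  by split=> //; split=> //; rewrite e.
elim=> [|j IH] jn; first exact: (key 0%N _ hF (t1 0%N jn)).
by have [h _] := IH (ltnW jn); exact: (key j.+1 _ h (t1 j.+1 jn)).
Qed.

Lemma unique_interpolant_of_superopt : (forall j, (j < n)%N -> superopt_sv Phi j = 1%:E) ->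
  unique_unitary_interpolant Phi.
Proof.
move=> t1; have [e [e0 e1 he]] := gap_lt1.
have [d [g [gw gN]]] := beurling maxH; have [Eg og] := gw.
pose Pi t := projmx (fun j : 'I_d => g j t).
have PiL : Linf Pi by exact: wandering_proj_Linf gw.
pose T t := 1%:M - Pi t.
have TL : Linf T by exact: (Linf_sub (Linf_cst 1%:M) PiL).
have TvE : aeD (fun t => forall v, cRe (vdot (T t *m v) v) = vsq (T t *m v)).
  apply: aeDS og => t _ h v; rewrite /T mulmxBl mul1mx (projmx_sq h) vdotBl cReD cReN.
  by rewrite -vsqE.
pose W t := 1%:M - e%:C *: T t.
have WL : Linf W by exact: (Linf_sub (Linf_cst 1%:M) (Linf_scale e%:C TL)).
have WE t v : W t *m v = v - e%:C *: (T t *m v) by rewrite mulmxBl mul1mx -scalemxAl.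
have Wv : aeD (fun t => forall v, cRe (vdot (W t *m v) v) = vsq v - e * vsq (T t *m v)).
  apply: aeDS TvE => t _ h v; rewrite WE vdotBl vdotZl cReD cReN -vsqE cReM cRe_real cIm_real.
  by rewrite h mul0r subr0.
have herm : aeD (fun t => adjmx (W t) = W t).
  apply: aeDT => t _; apply/matrixP => a b; rewrite adjmxE /W /T.
  have : adjmx (Pi t) = Pi t by exact: adj_projmx.
  move: (Pi t) => X hX; have hab : cconj (X b a) = X a b by rewrite -adjmxE hX.
  by rewrite !mxE !(cconjB, cconjM) cconj_real !cconj_nat hab [b == a]eq_sym.
have pos f : H2 f -> 0 <= cRe (hkform Phi W f f).
  move=> hf; have hfL := H2_L2 hf.
  have [m [mm mL om]] := maxv_proj hPhi contr hfL.
  have mH := maxH mm; pose f' := f - m.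
  have f'H : H2 f' by exact: (H2_sub hf mH).
  have f'L := H2_L2 f'H.
  have TLf := L2_mulf TL hfL.
  have eN : N2 (mulf T f) = N2 (mulf T f').
    apply: (N2_aeE TLf (L2_mulf TL f'L)).
    have := gN m (shift_span_mem maxH mm); apply: aeDS => t _ h.
    have Tm : T t *m m t = 0 by rewrite mulmxBl mul1mx h subrr.
    by rewrite /mulf /f' !fctE mulmxBr Tm subr0.
  have leN : N2 (mulf T f') <= N2 f'.
    rewrite -[leRHS]mul1r; apply: (N2_mulf_le TL f'L).
    apply: aeDS2 og TvE => t _ h1 h2 v; rewrite mul1r -(h2 v).
    have : 0 <= vsq (v - T t *m v) by exact: vsq_ge0.
    rewrite vsqB vdotC cRe_conj (h2 v) => h; move: (vsq _) (vsq v) h => x y; lra.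
  have fW : cRe (ip (mulf W f) f) = N2 f - e * N2 (mulf T f).
    have r1 := L2_rint hfL; have r2 := L2_rint TLf.
    rewrite ipE cRe_cint !N2E -RiZ // -RiB //; last exact: rintZ.
    apply: Ri_ae.
    - by have [h _] := L2_L1 (L2_mulf WL hfL) hfL; exact: rint_meas h.
    - by apply: rint_meas; apply: rintB => //; exact: rintZ.
    by apply: aeDS Wv => t _; exact.
  have e2 : N2 f - N2 (Hk f) = N2 f' - N2 (Hk f').
    rewrite -!hkform1E; have hB := hkform1 hPhi contr.
    have -> : f = m + f' by rewrite /f' addrC subrK.
    rewrite (hqD hB mH f'H) (maxv_form0 hPhi contr mm f'H) (maxv_form0 hPhi contr mm mH) cRe0.
    by rewrite mulr0 addr0 add0r.
  have h1 := he f' f'H om; rewrite /hkform cReD cReN fW eN -/(N2 (Hk f)).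
  have h2 : e * N2 (mulf T f') <= e * N2 f' by rewrite ler_pM2l.
  move: (N2 f) (N2 (Hk f)) (N2 f') (N2 (Hk f')) (e * N2 (mulf T f')) e2 h1 h2.
  by move=> *; lra.
have [F hF bF] := nehari hPhi WL herm pos.
have bF2 : aeD (fun t => forall v, vsq ((Phi t - F t) *m v) <= vsq v - e * vsq (T t *m v)).
  by apply: aeDS2 bF Wv => t _ h1 h2 v; rewrite -h2.
have cF : aeD (fun t => forall v, vsq ((Phi t - F t) *m v) <= vsq v).
  apply: aeDS bF2 => t _ h v; apply: le_trans (h v) _.
  by rewrite gerBl mulr_ge0 ?vsq_ge0 // ltW.
have dn : d = n.
  apply/eqP; rewrite eqn_leq (wandering_family_le gw) /= leqNgt; apply/negP => dn.
  have n0 : (0 < n)%N by exact: leq_ltn_trans dn.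
  have n1 : (n.-1 < n)%N by rewrite prednK.
  have [_ d1] := contraction_superoptimal hF cF t1 n1.
  pose a := Num.sqrt (1 - e).
  have : (dev Phi n.-1 F <= a%:E)%E.
    apply/esssup_leP; apply: aeDS bF2 => t _ h2.
    (* A unit vector orthogonal to all [g j t] is fixed by [T t], so the full loss [e] is felt on
       it; it serves as the test vector for [sval_small]. *)
    have [v v1 v0] := unit_orthogonal (fun j => g j t) dn.
    apply: (sval_small (v := v)) => //; first exact: sqrtr_ge0.
    rewrite sqr_sqrtr ?subr_ge0 //; apply: le_trans (h2 v) _.
    suff -> : T t *m v = v by rewrite v1 mulr1.
    rewrite mulmxBl mul1mx projmxE big1 ?subr0 // => j _; by rewrite v0 scale0r.
  rewrite d1 lee_fin => h; have : 1 <= a ^+ 2 by rewrite exprn_ege1.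
  rewrite sqr_sqrtr ?subr_ge0 //; move: e0; lra.
pose U t := Phi t - F t.
have UL : Linf U by exact: (Linf_sub hPhi (Hinf_Linf hF)).
(* A matrix function that kills all maximizing vectors kills their shift-invariant span, in
   particular the [g j], which form a basis at almost every point since [d = n]. It is applied to
   [U^* U - 1] and to the difference of two interpolants. *)
have ann (A : R -> 'M[C]_n) : Linf A -> (forall m, maxv Phi m -> aeD (fun t => A t *m m t = 0)) ->
    aeD (fun t => A t = 0).
  move=> AL Am; have : aeD (fun t => forall j : 'I_d, A t *m g j t = 0).
    apply: aeD_fin => j; apply: (shift_span_ann maxH AL Am).
    exact: (Eg j (ltn_ord j)).1.
  move=> Ag; apply: aeDS2 og Ag => t _ h1 h2; exact: (orthonormal_ann h1 dn h2).
exists U; split.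
  split; first exact: UL.
  split.
    have AL : Linf (fun t => adjmx (U t) *m U t - 1%:M).
      exact: (Linf_sub (Linf_mulmx (Linf_adj UL) UL) (Linf_cst 1%:M)).
    have := ann _ AL; rewrite /Defs.ae_eq => h; apply: aeDS (h _).
      by move=> t _ /eqP; rewrite subr_eq0 => /eqP.
    move=> m mm; apply: aeDS (maxv_contr hPhi hF cF mm) => t _ [h1 h2].
    by rewrite mulmxBl mul1mx -mulmxA h1 h2 subrr.
  by move: hF; congr Hinf; apply/funext => t; rewrite /U opprB addrC subrK.
move=> X [XL [Xu XH]].
have XE t : Phi t - (Phi t - X t) = X t by rewrite opprB addrC subrK.
have cX : aeD (fun t => forall v, vsq ((Phi t - (Phi t - X t)) *m v) <= vsq v).
  by apply: aeDS Xu => t _ u v; rewrite XE unitary_isometry.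
have := ann _ (Linf_sub XL UL) => h; apply: aeDS (h _).
  by move=> t _ /eqP; rewrite subr_eq0 => /eqP.
move=> m mm; apply: aeDS2 (maxv_contr hPhi XH cX mm) (maxv_contr hPhi hF cF mm).
by move=> t _ [h1 _] [h2 _]; rewrite XE in h1; rewrite mulmxBl h1 h2 subrr.
Qed.

End Converse.

Theorem theorem3p4 (R : realType) (n : nat) (Phi : R -> 'M[complex R]_n) :
  Linf Phi -> hankel_norm_le Phi 1 -> hankel_ess_norm_lt1 Phi ->
  (unique_unitary_interpolant Phi <->
     forall j : nat, (j < n)%N -> superopt_sv Phi j = 1%:E).
Proof.
move=> hPhi contr ess; split; first exact: superopt_of_unique_interpolant.
exact: unique_interpolant_of_superopt.
Qed.
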